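(* Let $\mathbf f\in (L^2(\Omega))^d$, $\mathbf g\in (L^2(\Gamma))^d$, and suppose $\mathbf u_h\in\mathbf V_h$ solves the IP-DG method $$A_h(\mathbf u_h,\mathbf v_h)=(\mathbf f,\mathbf v_h)_\Omega+\langle\mathbf g,\mathbf v_h\rangle_\Gamma\qquad\forall\,\mathbf v_h\in\mathbf V_h.$$ Then $$|\mathbf u_h|_{1,h}^2+\omega^2\rho\|\mathbf u_h\|_{L^2(\Omega)}^2\le C\Big(C_{\rm sta}^2\|\mathbf f\|_{L^2(\Omega)}^2+C_{\rm sta}\|\mathbf g\|_{L^2(\Gamma)}^2\Big),$$ $$J_0(\mathbf u_h,\mathbf u_h)+J_1(\mathbf u_h,\mathbf u_h)+\omega\langle A\mathbf u_h,\mathbf u_h\rangle_\Gamma\le\frac C\omega\Big(C_{\rm sta}\|\mathbf f\|_{L^2(\Omega)}^2+\|\mathbf g\|_{L^2(\Gamma)}^2\Big),$$ where $$C_{\rm sta}=\frac{\xi}{\omega}+\frac1{\omega^2h}+\frac1{\omega^3h^2\gamma_1},\qquad \xi=1+\frac1{\gamma_0},$$ and $C$ is a positive constant independent of $\omega$, $h$, $\gamma_0$, and $\gamma_1$ (and of $\mathbf f,\mathbf g,\mathbf u_h$).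
   Context: Setting. $\Omega\subset\mathbb R^d$, $d\in\{2,3\}$, is a bounded open domain with boundary $\Gamma=\partial\Omega$; $\omega,\rho,\lambda,\mu>0$ are constants; $A$ is a real symmetric positive definite $d\times d$ matrix; $\mathbf i=\sqrt{-1}$. For a vector field $\mathbf v$ with values in $\mathbb C^d$, $\varepsilon(\mathbf v)=\frac12(\nabla\mathbf v+\nabla\mathbf v^T)$ and $\sigma(\mathbf v)=2\mu\,\varepsilon(\mathbf v)+\lambda(\mathrm{div}\,\mathbf v)I$. $(\cdot,\cdot)_Q$ and $\langle\cdot,\cdot\rangle_\Sigma$ are the complex $L^2$ inner products (conjugate-linear in the second argument). Mesh. $\mathcal T_h$ is a shape-regular triangulation of $\Omega$ into triangles/tetrahedra $K$, $h_K=\mathrm{diam}(K)$, $h_e=\mathrm{diam}(e)$ for edges/faces $e$; $\mathcal E_h^I$ is the set of interior edges/faces. For $e=\partial K_e\cap\partial K_e'\in\mathcal E_h^I$, where $K_e$ is the element with the larger global label (otherwise exchange the roles), $[\mathbf v]|_e=\mathbf v|_{K_e}-\mathbf v|_{K_e'}$, $\{\mathbf v\}|_e=\frac12(\mathbf v|_{K_e}+\mathbf v|_{K_e'})$, and $\mathbf n_e$ is the unit normal to $e$ pointing out of $K_e$. Penalties. To each $e\in\mathcal E_h^I$ are attached parameters $\gamma_{0,e},\gamma_{1,e}$; there are $h,\gamma_0,\gamma_1>0$ and a constant $C_*$ independent of $h$ with $h_K\le h\le C_*h_K$ for all $K$, $\gamma_{0,e}\le\gamma_0\le C_*\gamma_{0,e}$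 and $\gamma_{1,e}\le\gamma_1\le C_*\gamma_{1,e}$ for all $e\in\mathcal E_h^I$. Forms. $$b_h(\mathbf u,\mathbf v)=\sum_{K\in\mathcal T_h}\big(\lambda(\mathrm{div}\,\mathbf u,\mathrm{div}\,\mathbf v)_K+2\mu(\varepsilon(\mathbf u),\varepsilon(\mathbf v))_K\big)-\sum_{e\in\mathcal E_h^I}\big(\langle\{\sigma(\mathbf u)\mathbf n_e\},[\mathbf v]\rangle_e+\langle[\mathbf u],\{\sigma(\mathbf v)\mathbf n_e\}\rangle_e\big),$$ $$J_0(\mathbf u,\mathbf v)=\sum_{e\in\mathcal E_h^I}\frac{\gamma_{0,e}}{h_e}\langle[\mathbf u],[\mathbf v]\rangle_e,\qquad J_1(\mathbf u,\mathbf v)=\sum_{e\in\mathcal E_h^I}\gamma_{1,e}h_e\langle[\sigma(\mathbf u)\mathbf n_e],[\sigma(\mathbf v)\mathbf n_e]\rangle_e,$$ $a_h=b_h+\mathbf i(J_0+J_1)$, and $A_h(\mathbf u,\mathbf v)=a_h(\mathbf u,\mathbf v)-\omega^2\rho(\mathbf u,\mathbf v)_\Omega+\mathbf i\omega\langle A\mathbf u,\mathbf v\rangle_\Gamma$. $\mathbf V_h=\prod_{K\in\mathcal T_h}(P_1(K))^d$ is the space of discontinuous piecewise linear vector fields with complex coefficients, and $|\mathbf v|_{1,h}^2=\sum_{K\in\mathcal T_h}\big(\lambda\|\mathrm{div}\,\mathbf v\|_{L^2(K)}^2+2\mu\|\varepsilon(\mathbf v)\|_{L^2(K)}^2\big)$.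 Constants may depend on $\Omega,\lambda,\mu,\rho,A$, the shape-regularity constant and $C_*$. *)

(* Defs.v *)
From HB Require Import structures.
From mathcomp Require Import all_boot all_order all_algebra.
From mathcomp Require Import complex.
From mathcomp Require Import all_classical all_reals all_analysis.

Set Implicit Arguments.
Unset Strict Implicit.
Unset Printing Implicit Defensive.

Import Order.TTheory GRing.Theory Num.Theory.
Import numFieldNormedType.Exports.

Local Open Scope classical_set_scope.
Local Open Scope ring_scope.
Local Open Scope complex_scope.

Section Lebesgue.
Context {R : realType}.

Definition tcons n (p : R * n.-tuple R) : n.+1.-tuple R := [tuple of p.1 :: p.2].

Lemma measurable_tcons n : measurable_fun setT (@tcons n).
Proof. exact: measurable_cons. Qed.

Section Extend.
Variables (n : nat) (m : {sigma_finite_measure set (n.-tuple R) -> \bar R}).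

Definition lebRn_ext : set (n.+1.-tuple R) -> \bar R :=
  pushforward (@lebesgue_measure R \x m)%E (@tcons n).

Let mtcons := @measurable_tcons n.

Let lebRn_ext0 : lebRn_ext set0 = 0%E.
Proof. exact: measure0. Qed.

Let lebRn_ext_ge0 A : (0 <= lebRn_ext A)%E.
Proof. exact: measure_ge0. Qed.

Let lebRn_ext_sigma_additive : semi_sigma_additive lebRn_ext.
Proof. exact: (@measure_semi_sigma_additive _ _ _ (pushforward _ _)). Qed.

HB.instance Definition _ := isMeasure.Build _ _ _ lebRn_ext
  lebRn_ext0 lebRn_ext_ge0 lebRn_ext_sigma_additive.

Let lebRn_ext_sigma_finite : sigma_finite setT lebRn_ext.
Proof.
have /sigma_finiteP[F [TF ndF Foo]] := sigma_finiteT (@lebesgue_measure R).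
have /sigma_finiteP[G [TG ndG Goo]] := sigma_finiteT m.
exists (fun k => [set t | F k (thead t) /\ G k [tuple of behead t]]).
  apply/esym; rewrite -subTset => t _.
  have : [set: R] (thead t) by [].
  rewrite TF => -[i _ Fi].
  have : [set: n.-tuple R] [tuple of behead t] by [].
  rewrite TG => -[j _ Gj]; exists (maxn i j) => //; split.
  - by move: Fi; exact/subsetPset/ndF/leq_maxl.
  - by move: Gj; exact/subsetPset/ndG/leq_maxr.
move=> k; have [mF Fk] := Foo k; have [mG Gk] := Goo k; split.
  have := measurable_tnth (T := measurableTypeR R) (@ord0 n) measurableT mF.
  have := measurable_behead (T := measurableTypeR R) (n := n) measurableT mG.
  rewrite !setTI => mA mB; exact: measurableI mB mA.
rewrite /lebRn_ext /pushforward (_ : _ @^-1` _ = F k `*` G k).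
  by rewrite product_measure1E// lte_mul_pinfty// ge0_fin_numE.
apply/seteqP; split => -[x t] /=; rewrite theadE.
  by rewrite (_ : [tuple of _] = t) //; exact/val_inj.
by rewrite (_ : [tuple of _] = t) //; exact/val_inj.
Qed.

HB.instance Definition _ := Measure_isSigmaFinite.Build _ _ _ lebRn_ext
  lebRn_ext_sigma_finite.

End Extend.

(* Lebesgue measure on R^n, as an iterated product of the one on R. *)
Fixpoint lebRn n : {sigma_finite_measure set (n.-tuple R) -> \bar R} :=
  match n with
  | 0 => \d_([tuple] : 0.-tuple R)
  | n'.+1 => lebRn_ext (lebRn n')
  end.

End Lebesgue.

Section EuclideanSpace.
Context {R : realType}.
Local Notation C := R[i].

(* Points of R^n are column vectors (which carry the topology and the linear
   algebra); the measure lives on tuples (which carry the sigma-algebra). *)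
Definition colv n (t : n.-tuple R) : 'cV[R]_n := \col_i tnth t i.

Definition vint n (D : set 'cV[R]_n) (f : 'cV[R]_n -> R) : R :=
  \int[lebRn n]_(t in @colv n @^-1` D) f (colv t).

Definition vintC n (D : set 'cV[R]_n) (f : 'cV[R]_n -> C) : C :=
  vint D (fun x => complex.Re (f x)) +i* vint D (fun x => complex.Im (f x)).

Definition cplxmx m n (B : 'M[R]_(m, n)) : 'M[C]_(m, n) :=
  map_mx (fun a : R => a%:C) B.

(* Conjugate-linear in the second argument; the Frobenius product on matrices. *)
Definition hdot m n (B B' : 'M[C]_(m, n)) : C :=
  \sum_i \sum_j B i j * (B' i j)^*.

Definition sqabs (z : C) : R := complex.Re z ^+ 2 + complex.Im z ^+ 2.

Definition sqnorm m n (B : 'M[C]_(m, n)) : R := \sum_i \sum_j sqabs (B i j).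

Definition inL2 n p (D : set 'cV[R]_n) (f : 'cV[R]_n -> 'cV[C]_p) : Prop :=
  (forall k,
     measurable_fun (@colv n @^-1` D) (fun t => complex.Re (f (colv t) k 0)) /\
     measurable_fun (@colv n @^-1` D) (fun t => complex.Im (f (colv t) k 0))) /\
  (\int[lebRn n]_(t in @colv n @^-1` D) (sqnorm (f (colv t)))%:E < +oo)%E.

Definition edot n (x y : 'cV[R]_n) : R := (x^T *m y) 0 0.

Definition enorm n (x : 'cV[R]_n) : R := Num.sqrt (edot x x).

Definition diam n (Q : set 'cV[R]_n) : R :=
  sup [set r | exists x y, [/\ Q x, Q y & r = enorm (x - y)]].

(* diameter of the largest ball contained in Q *)
Definition indiam n (Q : set 'cV[R]_n) : R :=
  sup [set s | exists x r,
         [/\ 0 <= r, forall y, enorm (y - x) <= r -> Q y & s = 2 * r]].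

Definition frontier n (Q : set 'cV[R]_n) : set 'cV[R]_n :=
  closure Q `&` closure (~` Q).

Definition ref_simplex n : set 'cV[R]_n :=
  [set t | (forall k, 0 <= t k 0) /\ \sum_k t k 0 <= 1].

End EuclideanSpace.

Section Simplices.
Context {R : realType} {d : nat} {V : finType} (p : V -> 'cV[R]_d).
Local Notation C := R[i].
Implicit Types (S e T : {set V}).

Definition affindep S : Prop :=
  forall l : V -> R, \sum_(v in S) l v = 0 -> \sum_(v in S) l v *: p v = 0 ->
  forall v, v \in S -> l v = 0.

Definition csimplex S : set 'cV[R]_d :=
  [set x | exists l : V -> R, [/\ forall v, v \in S -> 0 <= l v,
     \sum_(v in S) l v = 1 & x = \sum_(v in S) l v *: p v]].

Definition osimplex S : set 'cV[R]_d :=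
  [set x | exists l : V -> R, [/\ forall v, v \in S -> 0 < l v,
     \sum_(v in S) l v = 1 & x = \sum_(v in S) l v *: p v]].

Definition corner e (k : nat) : 'cV[R]_d := nth 0 [seq p v | v <- enum e] k.

(* For #|e| = d, the affine parametrization of the (d-1)-simplex e by the
   reference simplex of R^(d-1), its Jacobian matrix, and the density
   sqrt (det (J^T J)) of the surface measure. *)
Definition fparam e (t : 'cV[R]_d.-1) : 'cV[R]_d :=
  corner e 0 + \sum_k t k 0 *: (corner e k.+1 - corner e 0).

Definition fjac e : 'M[R]_(d, d.-1) :=
  \matrix_(i, k) (corner e k.+1 - corner e 0) i 0.

Definition fdensity e : R := Num.sqrt (\det ((fjac e)^T *m fjac e)).

Definition sint e (f : 'cV[R]_d -> R) : R :=
  fdensity e * vint (@ref_simplex R d.-1) (f \o fparam e).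

Definition sintC e (f : 'cV[R]_d -> C) : C :=
  sint e (fun x => complex.Re (f x)) +i* sint e (fun x => complex.Im (f x)).

(* nu is the unit normal to the facet e of T pointing out of T. *)
Definition is_onormal T e (nu : 'cV[R]_d) : Prop :=
  [/\ enorm nu = 1,
      forall x y, csimplex e x -> csimplex e y -> edot nu (x - y) = 0 &
      forall x y, csimplex T x -> csimplex e y -> edot nu (x - y) <= 0].

Definition onormal T e : 'cV[R]_d := xget 0 [set nu | is_onormal T e nu].

End Simplices.

Section Elasticity.
Context {R : realType} {d : nat} (lam mu : R).
Local Notation C := R[i].
Implicit Types (v : 'cV[R]_d -> 'cV[C]_d) (x : 'cV[R]_d).

Definition grad v x : 'M[C]_d :=
  \matrix_(i, j)
    ('D_(delta_mx j 0) (fun y => complex.Re (v y i 0)) x +i*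
     'D_(delta_mx j 0) (fun y => complex.Im (v y i 0)) x).

Definition divg v x : C := \tr (grad v x).

Definition strain v x : 'M[C]_d := 2^-1 *: (grad v x + (grad v x)^T).

Definition stress v x : 'M[C]_d :=
  (2 * mu%:C) *: strain v x + (lam%:C * divg v x)%:M.

Definition is_P1 v : Prop :=
  exists (b : 'cV[C]_d) (B : 'M[C]_d), forall x, v x = b + B *m cplxmx x.

End Elasticity.

Record mesh (R : realType) (d : nat) := Mesh {
  nvert : nat;
  nelem : nat;
  vtx : 'I_nvert -> 'cV[R]_d;
  elt : 'I_nelem -> {set 'I_nvert}
}.
Arguments vtx {R d} m.
Arguments elt {R d} m.

Section Mesh.
Context {R : realType} {d : nat} (m : mesh R d).
Local Notation C := R[i].
Local Notation face := {set 'I_(nvert m)}.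
Local Notation label := 'I_(nelem m).

Definition ifacet (i j : label) : bool :=
  (i != j) && (#|elt m i :&: elt m j| == d).

(* Two elements sharing d vertices: by conformity their closures meet exactly
   along the facet spanned by these vertices. *)
Definition interior_facet (e : face) : Prop :=
  exists i j : label, ifacet i j /\ e = elt m i :&: elt m j.

Definition bfacet (i : label) (e : face) : bool :=
  [&& e \subset elt m i, #|e| == d &
      [forall j : label, (j != i) ==> ~~ (e \subset elt m j)]].

(* A conforming simplicial triangulation of Omega, with global labels
   'I_(nelem m). The union of the boundary facets is the boundary of Omega,
   so integrals over the latter are sums over the boundary facets. *)
Definition triangulation (Omega : set 'cV[R]_d) : Prop :=
  [/\ injective (elt m) /\
      forall i, #|elt m i| = d.+1 /\ affindep (vtx m) (elt m i),
      forall i j, csimplex (vtx m) (elt m i) `&` csimplex (vtx m) (elt m j) =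
                  csimplex (vtx m) (elt m i :&: elt m j),
      closure Omega = \bigcup_i csimplex (vtx m) (elt m i) &
      frontier Omega =
        \bigcup_(ie in [set ie : label * face | bfacet ie.1 ie.2])
          csimplex (vtx m) ie.2].

Definition size_elt (i : label) : R := diam (csimplex (vtx m) (elt m i)).

Definition size_facet (e : face) : R := diam (csimplex (vtx m) e).

Definition shape_regular (kappa : R) : Prop :=
  forall i, size_elt i <= kappa * indiam (csimplex (vtx m) (elt m i)).

(* An element of the product over K of (P_1(K))^d is a family of affine
   fields indexed by the elements; the trace on a facet of K of the component
   v i is the value of v i there. *)
Definition broken := label -> 'cV[R]_d -> 'cV[C]_d.

Implicit Types (u v : broken).

Definition inVh v : Prop := forall i, is_P1 (v i).

Definition cell (i : label) : set 'cV[R]_d := osimplex (vtx m) (elt m i).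

(* The function on Omega given by a broken field (zero on the mesh skeleton). *)
Definition broken_fun v (x : 'cV[R]_d) : 'cV[C]_d :=
  \sum_(i | `[< cell i x >]) v i x.

(* Sum over the interior facets e = K_i n K_j; each is counted once, with
   i > j, so that i is the element K_e and j is the element K'_e. *)
Definition isum (F : label -> label -> face -> C) : C :=
  \sum_(i : label) \sum_(j : label | (j < i)%N && ifacet i j)
    F i j (elt m i :&: elt m j).

(* Sum over the boundary facets e, each with its element K_i. *)
Definition bsum (G : nmodType) (F : label -> face -> G) : G :=
  \sum_(i : label) \sum_(e : face | bfacet i e) F i e.

Definition jump (F : label -> 'cV[R]_d -> 'cV[C]_d) (i j : label) x : 'cV[C]_d :=
  F i x - F j x.

Definition average (F : label -> 'cV[R]_d -> 'cV[C]_d) (i j : label) x : 'cV[C]_d :=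
  2^-1 *: (F i x + F j x).

Definition sinner (e : face) (F G : 'cV[R]_d -> 'cV[C]_d) : C :=
  sintC (vtx m) e (fun x => hdot (F x) (G x)).

Section Forms.
Variables (lam mu : R).

(* The field sigma(v) n_e, where e is a facet of K_i and n_e points out of K_i. *)
Definition traction (e : face) (i : label) v : label -> 'cV[R]_d -> 'cV[C]_d :=
  fun k x => stress lam mu (v k) x *m cplxmx (onormal (vtx m) (elt m i) e).

Definition bh u v : C :=
  \sum_i (lam%:C * vintC (cell i) (fun x => divg (u i) x * (divg (v i) x)^*) +
          2 * mu%:C *
            vintC (cell i) (fun x => hdot (strain (u i) x) (strain (v i) x))) -
  isum (fun i j e =>
    sinner e (average (traction e i u) i j) (jump v i j) +
    sinner e (jump u i j) (average (traction e i v) i j)).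

Definition J0 (gam0 : face -> R) u v : C :=
  isum (fun i j e =>
    (gam0 e / size_facet e)%:C * sinner e (jump u i j) (jump v i j)).

Definition J1 (gam1 : face -> R) u v : C :=
  isum (fun i j e =>
    (gam1 e * size_facet e)%:C *
      sinner e (jump (traction e i u) i j) (jump (traction e i v) i j)).

Definition ah gam0 gam1 u v : C :=
  bh u v + 'i * (J0 gam0 u v + J1 gam1 u v).

Definition semi1h_sq v : R :=
  \sum_i (lam * vint (cell i) (fun x => sqabs (divg (v i) x)) +
          2 * mu * vint (cell i) (fun x => sqnorm (strain (v i) x))).

End Forms.

Definition inner_Omega (Omega : set 'cV[R]_d) (f : 'cV[R]_d -> 'cV[C]_d) v : C :=
  vintC Omega (fun x => hdot (f x) (broken_fun v x)).

Definition inner_Gamma (F G : label -> 'cV[R]_d -> 'cV[C]_d) : C :=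
  bsum (fun i e => sinner e (F i) (G i)).

Definition normsq_Omega (Omega : set 'cV[R]_d) (f : 'cV[R]_d -> 'cV[C]_d) : R :=
  vint Omega (fun x => sqnorm (f x)).

Definition normsq_Gamma (g : 'cV[R]_d -> 'cV[C]_d) : R :=
  bsum (fun _ e => sint (vtx m) e (fun x => sqnorm (g x))).

Definition inL2_Gamma (g : 'cV[R]_d -> 'cV[C]_d) : Prop :=
  forall i e, bfacet i e ->
    inL2 (@ref_simplex R d.-1) (g \o fparam (vtx m) e).

Definition Ah (Omega : set 'cV[R]_d) (lam mu rho omega : R) (A : 'M[R]_d)
    (gam0 gam1 : face -> R) u v : C :=
  ah lam mu gam0 gam1 u v
  - (omega ^+ 2 * rho)%:C * inner_Omega Omega (broken_fun u) v
  + 'i * omega%:C * inner_Gamma (fun i x => cplxmx A *m u i x) v.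

End Mesh.

Arguments size_elt {R d} m i.
Arguments interior_facet {R d} m e.

Definition Csta (R : realType) (omega h gamma0 gamma1 : R) : R :=
  let xi := 1 + 1 / gamma0 in
  xi / omega + 1 / (omega ^+ 2 * h) + 1 / (omega ^+ 3 * h ^+ 2 * gamma1).

(* Main.v *)
(** Since [uh] is affine on every simplex, its stress is constant there, and
    integrating by parts element by element turns the energy [|uh|_{1,h}^2] into
    facet terms only: [<{sigma n}, [uh]> + <[sigma n], {uh}>] on interior facets
    and [<sigma n, uh>] on the boundary. Trace inequalities for affine fields
    bound these by [J0], [J1], the boundary norm and small multiples of the
    energy and of [omega^2 |uh|^2]. Testing the scheme with [uh] itself, the
    imaginary part controls [J0 + J1 + omega <A uh, uh>_Gamma] by the data, and
    the real part controls [omega^2 rho |uh|^2] by the energy; absorbing the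
    small terms gives both estimates.

    Shape regularity enters through the bound [|grad lambda_v| <= C / h] on the
    barycentric coordinates. No change of variables is used: an affine function
    is at least half its maximum on a cube of size comparable to [h] next to the
    vertex where the maximum is attained, and only the volumes of cubes are
    needed. *)

Require Import Defs.
From mathcomp Require Import all_boot all_order all_algebra.
From mathcomp Require Import perm complex ring lra zify.
From mathcomp Require Import all_classical all_reals all_analysis.
From mathcomp Require Import measurable_realfun.
Set Implicit Arguments.
Unset Strict Implicit.
Unset Printing Implicit Defensive.

Import Order.TTheory GRing.Theory Num.Theory.
Import numFieldNormedType.Exports.

Local Open Scope classical_set_scope.
Local Open Scope ring_scope.
Local Open Scope complex_scope.

(** * Integrals over boxes and over the reference simplex *)

Section VectorIntegral.
Context {R : realType}.

(** The penalties enter [Ah] with the factor ['i], so the real part of the tested equation has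
    nothing to compensate the consistency term [2 * X], [X] being the sum of [flux_jump], while the
    imaginary part sees jumps but not the energy. Hence the second estimate of the energy, which
    does not use the equation. In it Young's inequality gives a free weight [s] to the terms to be
    absorbed and [1 / s] to those that the imaginary part controls: [J0] comes with [1 / gamma0],
    [J1] with [1 / (omega^2 h^2 gamma1)], [omega <A uh, uh>] with [1 / (omega h)]. Together with [1]
    these weights sum to [omega * Csta]; this is the origin of [Csta], and the reason why no
    condition ties [h] to [omega]. The constant has to precede [omega], [h], the penalties and the
    mesh, so all geometry is condensed into [element_bounds], uniform over simplices. Behind it, all
    facets of a simplex have density [D |g v|] with the same determinant [D], which makes Green's
    formula an identity between vertex values. *)

Lemma lebRn_tcons n (A : set (n.+1.-tuple R)) :
  lebRn n.+1 A = (@lebesgue_measure R \x lebRn n)%E (@tcons R n @^-1` A).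
Proof. by []. Qed.

Lemma measurable_tuple_box n (a b : 'I_n -> R) :
  measurable [set t : n.-tuple R | forall k, a k <= tnth t k <= b k].
Proof.
rewrite (_ : [set _ | _] = \bigcap_(k in [set: 'I_n])
  ((fun t : n.-tuple R => tnth t k) @^-1` `[a k, b k])).
  apply: fin_bigcap_measurable => // k _.
  rewrite -[X in measurable X]setTI.
  exact: (measurable_tnth k measurableT (measurable_itv `[a k, b k])).
apply/seteqP; split=> [t H k _|t H k]; first by rewrite /= in_itv /=; exact: H.
by have := H k I; rewrite /= in_itv.
Qed.

Lemma lebRn_box n (a b : 'I_n -> R) : (forall k, a k <= b k) ->
  lebRn n [set t | forall k, a k <= tnth t k <= b k] = (\prod_k (b k - a k))%:E.
Proof.
elim: n a b => [|n IH] a b ab.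
  rewrite big_ord0 /= diracE mem_set // => -[] //.
rewrite lebRn_tcons (_ : _ @^-1` _ = `[a ord0, b ord0]%classic `*`
  [set t : n.-tuple R | forall k, a (lift ord0 k) <= tnth t k <= b (lift ord0 k)]).
  rewrite product_measure1E //; last exact: measurable_tuple_box.
  rewrite IH; last by move=> k; exact: ab.
  have E : @lebesgue_measure R `[a ord0, b ord0]%classic =
      if (a ord0 < b ord0)%R then (b ord0 - a ord0)%:E else 0%E.
    by rewrite lebesgue_measure_itv /= lte_fin EFinB.
  transitivity (@lebesgue_measure R `[a ord0, b ord0]%classic *
    (\prod_k (b (lift ord0 k) - a (lift ord0 k)))%:E)%E; first by [].
  rewrite E.
  rewrite big_ord_recl EFinM.
  have := ab ord0; rewrite le_eqVlt => /orP[/eqP->|->].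
    by rewrite ltxx subrr !mul0e.
  by [].
apply/seteqP; split=> -[x t] /=.
  move=> H; split; first by have := H ord0; rewrite in_itv /= (tnth_nth 0).
  by move=> k; have := H (lift ord0 k); rewrite tnthS.
rewrite in_itv /= => -[H0 H] k; case: (unliftP ord0 k) => [j|] ->.
  by rewrite tnthS.
by rewrite (tnth_nth 0).
Qed.


Definition coord_bounded n (D : set 'cV[R]_n) : Prop :=
  exists M : R, forall x, D x -> forall k, `|x k 0| <= M.

Definition tame_set n (D : set 'cV[R]_n) : Prop :=
  measurable (@colv R n @^-1` D) /\ coord_bounded D.

(** Bounded and measurable, with measurability read on tuples, where the measure lives. The class is
    closed under sums and products and integrable on a [tame_set], so integrands built from affine
    fields need no integrability argument of their own. *)
Definition tame n (D : set 'cV[R]_n) (f : 'cV[R]_n -> R) : Prop :=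
  measurable_fun (@colv R n @^-1` D) (f \o @colv R n) /\ exists M : R, forall x, D x -> `|f x| <= M.

Definition vintegrable n (D : set 'cV[R]_n) (f : 'cV[R]_n -> R) : Prop :=
  (lebRn n).-integrable (@colv R n @^-1` D) (EFin \o (f \o @colv R n)).

Lemma lebRn_fin n (D : set 'cV[R]_n) : tame_set D ->
  (lebRn n (@colv R n @^-1` D) < +oo)%E.
Proof.
move=> [mD [M HM]]; pose a := fun _ : 'I_n => - `|M|; pose b := fun _ : 'I_n => `|M|.
apply: (@le_lt_trans _ _ (lebRn n [set t : n.-tuple R | forall k, a k <= tnth t k <= b k])).
  apply: le_measure; rewrite ?inE //; first exact: measurable_tuple_box.
  move=> t /= Dt k; have := HM _ Dt k; rewrite mxE => h.
  by rewrite /a /b -ler_norml; apply: le_trans h _; rewrite ler_norm.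
rewrite lebRn_box ?ltry // => k; rewrite /a /b.
by apply: (@le_trans _ _ 0); rewrite ?oppr_le0.
Qed.

Lemma tame_vintegrable n (D : set 'cV[R]_n) f :
  tame_set D -> tame D f -> vintegrable D f.
Proof.
move=> tD [mf [M HM]]; apply: measurable_bounded_integrable => //.
- by case: tD.
- exact: lebRn_fin.
- exists M; split; first exact: num_real.
  by move=> y My t Dt; apply: le_trans (ltW My); exact: HM.
Qed.

Lemma tame_cst n (D : set 'cV[R]_n) c : tame D (fun _ => c).
Proof. by split; [exact: measurable_cst | exists `|c|]. Qed.

Lemma tameD n (D : set 'cV[R]_n) f g :
  tame D f -> tame D g -> tame D (fun x => f x + g x).
Proof.
move=> [mf [M HM]] [mg [N HN]]; split; first exact: measurable_funD.
by exists (M + N) => x Dx; rewrite (le_trans (ler_normD _ _))// lerD ?HM ?HN.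
Qed.

Lemma tameM n (D : set 'cV[R]_n) f g :
  tame D f -> tame D g -> tame D (fun x => f x * g x).
Proof.
move=> [mf [M HM]] [mg [N HN]]; split; first exact: measurable_funM.
by exists (M * N) => x Dx; rewrite normrM ler_pM ?HM ?HN.
Qed.

Lemma tameZ n (D : set 'cV[R]_n) c f : tame D f -> tame D (fun x => c * f x).
Proof. by move=> tf; apply: tameM => //; exact: tame_cst. Qed.

Lemma tame_ext n (D : set 'cV[R]_n) f g : f =1 g -> tame D f -> tame D g.
Proof. by move=> /funext ->. Qed.

Lemma tame_sum n (D : set 'cV[R]_n) (I : Type) (r : seq I) (P : pred I) f :
  (forall i, P i -> tame D (f i)) -> tame D (fun x => \sum_(i <- r | P i) f i x).
Proof.
move=> tf; elim: r => [|i r IH].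
  by apply: tame_ext (tame_cst D 0) => x; rewrite big_nil.
case Pi : (P i); last by apply: tame_ext IH => x; rewrite big_cons Pi.
by apply: tame_ext (tameD (tf _ Pi) IH) => x; rewrite big_cons Pi.
Qed.

Lemma measurable_colv_coord n (k : 'I_n) :
  measurable_fun setT (fun t => colv t k 0 : R).
Proof.
rewrite (_ : (fun _ => _) = (fun t : n.-tuple R => tnth t k)); first exact: measurable_tnth.
by apply/funext => t; rewrite mxE.
Qed.

Lemma tame_coord n (D : set 'cV[R]_n) k : coord_bounded D -> tame D (fun x => x k 0).
Proof.
move=> [M HM]; split; first exact: measurable_funS (measurable_colv_coord k).
by exists M => x Dx; exact: HM.
Qed.

Definition affine n (c : R) (g x : 'cV[R]_n) : R := c + edot g x.

Lemma edotE n (x y : 'cV[R]_n) : edot x y = \sum_k x k 0 * y k 0.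
Proof. by rewrite /edot mxE; apply: eq_bigr => k _; rewrite mxE. Qed.

Lemma measurable_affine n c (g : 'cV[R]_n) :
  measurable_fun setT (fun t => affine c g (colv t)).
Proof.
apply: measurable_funD; first exact: measurable_cst.
under eq_fun do rewrite edotE.
apply: measurable_sum => k; apply: measurable_funM; first exact: measurable_cst.
exact: measurable_colv_coord.
Qed.

Lemma tame_affine n (D : set 'cV[R]_n) c g : coord_bounded D -> tame D (affine c g).
Proof.
move=> bD; apply: tameD; first exact: tame_cst.
apply: tame_ext (tame_sum _ _) => [x|k _]; first by rewrite edotE.
by apply: tameZ; exact: tame_coord.
Qed.

Lemma measurable_affine_ge0 n c (g : 'cV[R]_n) :
  measurable (@colv R n @^-1` [set x | 0 <= affine c g x]).
Proof.
have := measurable_affine c g measurableT (measurable_itv `[0, +oo[).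
rewrite setTI; congr measurable; apply/seteqP; split=> t /=.
  by rewrite in_itv /= andbT.
by rewrite in_itv /= andbT.
Qed.

Lemma measurable_affine_gt0 n c (g : 'cV[R]_n) :
  measurable (@colv R n @^-1` [set x | 0 < affine c g x]).
Proof.
have := measurable_affine c g measurableT (measurable_itv `]0, +oo[).
rewrite setTI; congr measurable; apply/seteqP; split=> t /=.
  by rewrite in_itv /= andbT.
by rewrite in_itv /= andbT.
Qed.

Lemma eq_vint n (D : set 'cV[R]_n) f g : (forall x, D x -> f x = g x) -> vint D f = vint D g.
Proof. by move=> fg; apply: eq_Rintegral => t; rewrite inE => /fg. Qed.

Lemma vintD n (D : set 'cV[R]_n) f g : tame_set D -> vintegrable D f -> vintegrable D g ->
  vint D (fun x => f x + g x) = vint D f + vint D g.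
Proof. by move=> [mD _] f_ g_; rewrite /vint RintegralD. Qed.

Lemma vintZ n (D : set 'cV[R]_n) c f : tame_set D -> vintegrable D f ->
  vint D (fun x => c * f x) = c * vint D f.
Proof. by move=> [mD _] f_; rewrite /vint RintegralZl. Qed.

Lemma vint0 n (D : set 'cV[R]_n) : vint D (fun _ => 0) = 0.
Proof.
rewrite /vint /Rintegral integral0_eq //.
Qed.

Lemma vint_ge0 n (D : set 'cV[R]_n) f : (forall x, D x -> 0 <= f x) -> 0 <= vint D f.
Proof. by move=> f0; apply: Rintegral_ge0 => t; exact: f0. Qed.

Lemma vint_le n (D : set 'cV[R]_n) f g : tame_set D -> vintegrable D f -> vintegrable D g ->
  (forall x, D x -> f x <= g x) -> vint D f <= vint D g.
Proof. by move=> [mD _] f_ g_ fg; apply: le_Rintegral => // t; exact: fg. Qed.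

Lemma vint_sum n (D : set 'cV[R]_n) (I : Type) (r : seq I) (P : pred I) f :
  tame_set D -> (forall i, P i -> tame D (f i)) ->
  vint D (fun x => \sum_(i <- r | P i) f i x) = \sum_(i <- r | P i) vint D (f i).
Proof.
move=> tD tf; elim: r => [|i r IH].
  by rewrite big_nil -[RHS](vint0 D); apply: eq_vint => x _; rewrite big_nil.
rewrite big_cons -IH; case: ifP => Pi; last by apply: eq_vint => x _; rewrite big_cons Pi.
rewrite -vintD //; first by apply: eq_vint => x _; rewrite big_cons Pi.
  by apply: tame_vintegrable => //; exact: tf.
by apply: tame_vintegrable => //; exact: tame_sum.
Qed.

Lemma vint_cst n (D : set 'cV[R]_n) c : tame_set D -> vint D (fun _ => c) = c * vint D (fun _ => 1).
Proof.
move=> tD; rewrite -vintZ //; first by apply: eq_vint => x _; rewrite mulr1.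
by apply: tame_vintegrable => //; exact: tame_cst.
Qed.

Lemma vint_subset n (D E : set 'cV[R]_n) f : tame_set D -> tame_set E -> D `<=` E ->
  vintegrable E f -> (forall x, E x -> 0 <= f x) -> vint D f <= vint E f.
Proof.
move=> tD tE DE fE f0; rewrite /vint /Rintegral.
have mD := tD.1; have mE := tE.1.
have fD : vintegrable D f by apply: integrableS fE => // t; exact: DE.
apply: fine_le.
- exact: integrable_fin_num.
- exact: integrable_fin_num.
apply: ge0_subset_integral => //.
- by case/integrableP: fE.
- by move=> t Et; rewrite lee_fin; exact: f0.
- by move=> t; exact: DE.
Qed.

Definition cube n (z : 'cV[R]_n) (r : R) : set 'cV[R]_n :=
  [set x | forall k, `|x k 0 - z k 0| <= r].

Lemma tame_set_cube n (z : 'cV[R]_n) r : tame_set (cube z r).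
Proof.
split.
  have := measurable_tuple_box (fun k => z k 0 - r) (fun k => z k 0 + r).
  congr measurable; apply/seteqP; split=> t /= H k; have := H k.
    by rewrite mxE ler_distl.
  by rewrite mxE ler_distl.
exists (\sum_k `|z k 0| + r) => x xz k.
have -> : x k 0 = z k 0 + (x k 0 - z k 0) by rewrite addrC subrK.
rewrite (le_trans (ler_normD _ _)) // lerD //.
by rewrite (bigD1 k) //= lerDl sumr_ge0.
Qed.

Lemma vint_cube n (z : 'cV[R]_n) r : 0 <= r ->
  vint (cube z r) (fun _ => 1) = (2 * r) ^+ n.
Proof.
move=> r0; rewrite /vint Rintegral_cst; last by case: (tame_set_cube z r).
rewrite mul1r.
suff E : lebRn n (@colv R n @^-1` cube z r) = ((2 * r) ^+ n)%:E by exact: (congr1 fine E).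
rewrite (_ : _ @^-1` _ = [set t : n.-tuple R | forall k, z k 0 - r <= tnth t k <= z k 0 + r]).
  rewrite lebRn_box; last by move=> k; rewrite lerBlDr -addrA lerDl addr_ge0.
  rewrite (eq_bigr (fun _ => 2 * r)) ?prodr_const ?card_ord // => k _.
  by ring.
apply/seteqP; split=> t /= H k; have := H k.
  by rewrite mxE ler_distl.
by rewrite mxE ler_distl.
Qed.

End VectorIntegral.

(** * Mass and first moments of the reference simplex *)

Section ReferenceSimplex.
Context {R : realType}.

Lemma integral_deriv_poly (p : {poly R}) (s : R) : 0 <= s ->
  (\int[lebesgue_measure]_(x in `[0%R, s]) (p^`().[x])%:E)%E = (p.[s] - p.[0])%:E.
Proof.
rewrite le_eqVlt => /predU1P[<-|s0].
  by rewrite set_itv1 integral_set1 subrr.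
rewrite (@continuous_FTC2 _ _ (horner p)) //.
- by apply: continuous_subspaceT; exact: continuous_horner.
- split.
  + by move=> x _; exact: derivable_horner.
  + by apply: cvg_at_right_filter; exact: continuous_horner.
  + by apply: cvg_at_left_filter; exact: continuous_horner.
- by move=> x _; rewrite derivE.
Qed.

Lemma deriv_subX_exp (s x : R) n :
  ((s%:P - 'X) ^+ n.+1)^`().[x] = - n.+1%:R * (s - x) ^+ n.
Proof.
by rewrite deriv_exp derivB derivC derivX hornerMn !hornerE -mulr_natl mulN1r mulrN mulNr.
Qed.

(** The section of an [n.+1]-simplex of size [s] at height [x] is an [n]-simplex of size [s - x];
    integrating its volume [(s - x)^n / n!] is the induction step for volumes. *)
Lemma integral_simplex_mass n (s : R) : 0 <= s ->
  (\int[lebesgue_measure]_(x in `[0%R, s]) ((s - x) ^+ n / n`!%:R)%:E)%E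
  = (s ^+ n.+1 / n.+1`!%:R)%:E.
Proof.
move=> s0; pose p : {poly R} := (- n.+1`!%:R^-1)%:P * (s%:P - 'X) ^+ n.+1.
transitivity (\int[lebesgue_measure]_(x in `[0%R, s]) (p^`().[x])%:E)%E.
  apply: eq_integral => x _; congr (_%:E).
  rewrite /p deriv_mulC hornerCM deriv_subX_exp factS natrM.
  have : n.+1%:R != 0 :> R by rewrite pnatr_eq0.
  have : n`!%:R != 0 :> R by rewrite pnatr_eq0 -lt0n fact_gt0.
  move: (n.+1%:R) (n`!%:R) ((s - x) ^+ n) => c e X c0 e0.
  by field; rewrite c0 e0.
rewrite integral_deriv_poly // /p !hornerE subrr expr0n /= mulr0 subr0.
by congr (_%:E); ring.
Qed.

(** Induction step for the moment of the first coordinate. The primitive [p] results from one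
    integration by parts. *)
Lemma integral_simplex_moment n (s : R) : 0 <= s ->
  (\int[lebesgue_measure]_(x in `[0%R, s]) (x * ((s - x) ^+ n / n`!%:R))%:E)%E
  = (s ^+ n.+2 / n.+2`!%:R)%:E.
Proof.
move=> s0; pose p : {poly R} := (- n.+1`!%:R^-1)%:P * ('X * (s%:P - 'X) ^+ n.+1)
  + (- n.+2`!%:R^-1)%:P * (s%:P - 'X) ^+ n.+2.
transitivity (\int[lebesgue_measure]_(x in `[0%R, s]) (p^`().[x])%:E)%E.
  apply: eq_integral => x _; congr (_%:E).
  rewrite /p derivD !deriv_mulC derivM derivX mul1r hornerD !hornerCM hornerD hornerM.
  rewrite !deriv_subX_exp hornerX horner_exp hornerD hornerN hornerX hornerC.
  rewrite !factS !natrM exprS.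
  have : n.+2%:R != 0 :> R by rewrite pnatr_eq0.
  have : n.+1%:R != 0 :> R by rewrite pnatr_eq0.
  have : n`!%:R != 0 :> R by rewrite pnatr_eq0 -lt0n fact_gt0.
  move: (n.+2%:R) (n.+1%:R) (n`!%:R) ((s - x) ^+ n) => b c e X b0 c0 e0.
  by field; rewrite b0 c0 e0.
have z m : 0 ^+ m.+1 = 0 :> R by rewrite expr0n.
rewrite integral_deriv_poly // /p.
rewrite !hornerD !hornerCM !horner_exp !hornerM !horner_exp.
rewrite !(hornerD, hornerN, hornerX, hornerC) subrr subr0 !z; congr (_%:E).
by move: (s ^+ n.+2) (s ^+ n.+1) (n.+1`!%:R^-1) (n.+2`!%:R^-1) => a b c e; ring.
Qed.

(** The size is a parameter because slicing changes it: the section at first coordinate [x] is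
    [tsimplex n (s - x)]. *)
Definition tsimplex n (s : R) : set (n.-tuple R) :=
  [set t | (forall k, 0 <= tnth t k) /\ \sum_k tnth t k <= s].

Arguments tsimplex n s : clear implicits.

Lemma measurable_tsimplex n s : measurable (tsimplex n s).
Proof.
rewrite (_ : tsimplex n s = (\bigcap_(k in [set: 'I_n])
  ((fun t : n.-tuple R => tnth t k) @^-1` `[0, +oo[)) `&`
  ((fun t : n.-tuple R => \sum_k tnth t k) @^-1` `]-oo, s])).
  apply: measurableI.
    apply: fin_bigcap_measurable => // k _.
    rewrite -[X in measurable X]setTI.
    exact: (measurable_tnth k measurableT (measurable_itv `[0, +oo[)).
  rewrite -[X in measurable X]setTI.
  have mf : measurable_fun setT (fun t : n.-tuple R => \sum_k tnth t k).
    by apply: measurable_sum => k; exact: measurable_tnth.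
  exact: (mf measurableT _ (measurable_itv `]-oo, s])).
apply/seteqP; split=> t.
  by case=> H1 H2; split; [move=> k _ /=; rewrite in_itv /= andbT|rewrite /= in_itv].
case=> H1 H2; split; last by move: H2; rewrite /= in_itv.
by move=> k; have := H1 k I; rewrite /= in_itv /= andbT.
Qed.

Lemma integral_lebRnS n (f : n.+1.-tuple R -> \bar R) :
  measurable_fun setT f -> (forall t, 0 <= f t)%E ->
  (\int[lebRn n.+1]_t f t =
   \int[lebesgue_measure]_x \int[lebRn n]_t f (tcons (x, t)))%E.
Proof.
move=> mf f0.
transitivity (\int[pushforward (@lebesgue_measure R \x lebRn n) (@tcons R n)]_t f t)%E.
  by [].
rewrite ge0_integral_pushforward //; last exact: measurable_tcons.
rewrite preimage_setT fubini_tonelli1 //.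
  by apply: measurableT_comp => //; exact: measurable_tcons.
by move=> t; exact: f0.
Qed.

Lemma tcons_tsimplex n s x (t : n.-tuple R) :
  tsimplex n.+1 s (tcons (x, t)) <-> x \in `[0, s] /\ tsimplex n (s - x) t.
Proof.
rewrite /tsimplex /= in_itv /= big_ord_recl /=.
have E0 : tnth (tcons (x, t)) ord0 = x by rewrite (tnth_nth 0).
have E k : tnth (tcons (x, t)) (lift ord0 k) = tnth t k by rewrite tnthS.
rewrite E0 (eq_bigr (fun k => tnth t k)) //; split.
  case=> H1 H2; have x0 : 0 <= x by rewrite -E0.
  have t0 k : 0 <= tnth t k by rewrite -E.
  have st : 0 <= \sum_k tnth t k by apply: sumr_ge0.
  rewrite x0 /=; split; first by apply: le_trans H2; rewrite lerDl.
  by split => //; rewrite lerBrDl.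
case=> /andP[x0 xs] [t0 H]; split; last by rewrite -lerBrDl.
by move=> k; case: (unliftP ord0 k) => [j|] ->; rewrite ?E ?E0.
Qed.

Lemma integral_tsimplexS n s (f : n.+1.-tuple R -> \bar R) :
  measurable_fun setT f -> (forall t, tsimplex n.+1 s t -> 0 <= f t)%E ->
  (\int[lebRn n.+1]_(t in tsimplex n.+1 s) f t =
   \int[lebesgue_measure]_(x in `[0%R, s])
     \int[lebRn n]_(t in tsimplex n (s - x)) f (tcons (x, t)))%E.
Proof.
move=> mf f0; rewrite integral_mkcond integral_lebRnS; last 2 first.
- have mf' : measurable_fun (tsimplex n.+1 s) f by exact: measurable_funTS.
  by apply/(measurable_restrictT _ _).1 => //; exact: measurable_tsimplex.
- by move=> t; rewrite patchE; case: ifPn => // /set_mem; exact: f0.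
rewrite [RHS]integral_mkcond; apply: eq_integral => x _.
rewrite patchE; case: ifPn => [/set_mem xs|/negP xs].
  rewrite [RHS]integral_mkcond; apply: eq_integral => t _; rewrite !patchE.
  congr (if _ then _ else _); apply/idP/idP => /set_mem H; apply/mem_set.
    by case/tcons_tsimplex: H.
  exact/tcons_tsimplex.
apply: integral0_eq => t _; rewrite patchE; case: ifPn => // /set_mem H.
by case: xs; apply/mem_set; case/tcons_tsimplex: H.
Qed.

Lemma tsimplex_mass n s : 0 <= s ->
  (\int[lebRn n]_(t in tsimplex n s) 1%:E)%E = (s ^+ n / n`!%:R)%:E.
Proof.
elim: n s => [|n IH] s s0.
  rewrite (_ : tsimplex 0 s = setT).
    rewrite integral_dirac // diracT mul1e expr0 fact0 divr1 //.
  by apply/seteqP; split => // t _; split; [case|rewrite big_ord0].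
rewrite integral_tsimplexS //.
rewrite -integral_simplex_mass //; apply: eq_integral => x /set_mem /=.
by rewrite in_itv /= => /andP[_ xs]; rewrite IH // subr_ge0.
Qed.

(** By slicing, the moment of the first coordinate is [integral_simplex_moment] applied to the
    masses of the sections; for any other coordinate the sections contribute their own moments. *)
Lemma tsimplex_moment n s k : 0 <= s ->
  (\int[lebRn n]_(t in tsimplex n s) (tnth t k)%:E)%E = (s ^+ n.+1 / n.+1`!%:R)%:E.
Proof.
elim: n s k => [|n IH] s k s0; first by case: k.
rewrite integral_tsimplexS; last 2 first.
- by apply/measurable_EFinP; exact: measurable_tnth.
- by move=> t [H _]; rewrite lee_fin.
case: (unliftP ord0 k) => [j|] ->.
  rewrite -integral_simplex_mass //; apply: eq_integral => x /set_mem /=.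
  rewrite in_itv /= => /andP[_ xs]; rewrite -(IH _ j) ?subr_ge0 //.
  by apply: eq_integral => t _; rewrite tnthS.
rewrite -integral_simplex_moment //; apply: eq_integral => x /set_mem /=.
rewrite in_itv /= => /andP[x0 xs].
transitivity (\int[lebRn n]_(t in tsimplex n (s - x)) (x%:E * 1%:E))%E.
  by apply: eq_integral => t _; rewrite mule1 (tnth_nth 0).
rewrite ge0_integralZl //.
  by rewrite tsimplex_mass ?subr_ge0 // EFinM.
exact: measurable_tsimplex.
Qed.

Lemma ref_simplexE n : @colv R n @^-1` (@ref_simplex R n) = tsimplex n 1.
Proof.
have E (t : n.-tuple R) : \sum_k colv t k 0 = \sum_k tnth t k.
  by apply: eq_bigr => k _; rewrite mxE.
apply/seteqP; split=> t; rewrite /tsimplex /ref_simplex /= E => -[H1 H2]; split=> // k.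
  by have := H1 k; rewrite mxE.
by rewrite mxE.
Qed.

Lemma tame_set_ref n : tame_set (@ref_simplex R n).
Proof.
split; first by rewrite ref_simplexE; exact: measurable_tsimplex.
exists 1 => x [x0 x1] k; rewrite ger0_norm //.
by apply: le_trans x1; rewrite (bigD1 k) //= lerDl sumr_ge0.
Qed.

Lemma vint_ref_mass n : vint (@ref_simplex R n) (fun _ => 1) = n`!%:R^-1.
Proof.
by rewrite /vint /Rintegral ref_simplexE tsimplex_mass //= expr1n mul1r.
Qed.

Lemma vint_ref_moment n k :
  vint (@ref_simplex R n) (fun t => t k 0) = n.+1`!%:R^-1.
Proof.
rewrite /vint /Rintegral ref_simplexE.
under eq_integral do rewrite mxE.
by rewrite tsimplex_moment //= expr1n mul1r.
Qed.

End ReferenceSimplex.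

(** * Barycentric coordinates, facet densities and normals *)

Section Barycentric.
Context {R : realType}.

Lemma det_le n (A : 'M[R]_n) (M : R) : (forall i j, `|A i j| <= M) ->
  `|\det A| <= n`!%:R * M ^+ n.
Proof.
move=> AM; rewrite /determinant (le_trans (ler_norm_sum _ _ _)) //.
have -> : n`!%:R * M ^+ n = \sum_(s : 'S_n) M ^+ n.
  by rewrite sumr_const card_Sn mulr_natl.
apply: ler_sum => s _; rewrite normrM normrX normrN1 expr1n mul1r normr_prod.
have -> : M ^+ n = \prod_(i < n) M by rewrite prodr_const card_ord.
by apply: ler_prod => i _; rewrite normr_ge0 AM.
Qed.

Lemma unitmx_inj n (A : 'M[R]_n) : (forall u : 'rV_n, u *m A = 0 -> u = 0) ->
  A \in unitmx.
Proof.
move=> H; rewrite -row_free_unit -kermx_eq0; apply/rowV0P => u.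
by move/sub_kermxP; exact: H.
Qed.

Context {d : nat} {V : finType} (p : V -> 'cV[R]_d).
Implicit Types (S e : {set V}) (c : V -> R) (g : V -> 'cV[R]_d).

(** A numbering of the [d + 1] vertices; the index type is written [1 + d] so that it splits along
    matrix blocks. *)
Definition labels S (q : 'I_(1 + d) -> V) : Prop :=
  injective q /\ forall i, q i \in S.

(** Homogeneous coordinates of the vertices, in columns. The rows of the inverse are the
    coefficients [(c v, g v)] of the barycentric coordinates, and the determinant is, up to sign,
    [d!] times the volume of the simplex. *)
Definition affmx (q : 'I_(1 + d) -> V) : 'M[R]_(1 + d) :=
  col_mx (const_mx 1) (\matrix_(k, j) p (q j) k 0).

Definition edgemx (q : 'I_(1 + d) -> V) : 'M[R]_d :=
  \matrix_(k, j) (p (q (rshift 1 j)) k 0 - p (q (lshift d 0)) k 0).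

(** Subtracting the column of the first vertex from the others amounts to factoring out a unipotent
    block matrix. *)
Lemma det_affmx q : \det (affmx q) = \det (edgemx q).
Proof.
pose u : 'M[R]_(1, d) := const_mx 1.
pose p0 : 'M[R]_(d, 1) := p (q (lshift d 0)).
have -> : affmx q = block_mx 1%:M 0 p0 (edgemx q) *m block_mx 1%:M u 0 1%:M.
  rewrite mulmx_block !(mul0mx, mulmx0, mul1mx, mulmx1, addr0, add0r).
  apply/matrixP => i j; case: (split_ordP i) => i' ->; case: (split_ordP j) => j' ->.
  - by rewrite block_mxEul col_mxEu !mxE !ord1.
  - by rewrite block_mxEur col_mxEu !mxE.
  - by rewrite block_mxEdl col_mxEd !mxE ord1.
  - by rewrite block_mxEdr col_mxEd !mxE big_ord1 !mxE mulr1 addrC subrK.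
by rewrite det_mulmx det_lblock det_ublock !det1 !mul1r mulr1.
Qed.

Lemma labels_surj S q v : #|S| = d.+1 -> labels S q -> v \in S -> exists i, q i = v.
Proof.
move=> cS [qi qS] vS; have : q @: [set: 'I_(1 + d)]%SET = S.
  apply/eqP; rewrite eqEcard; apply/andP; split.
    by apply/fintype.subsetP => w /imsetP[i _ ->].
  by rewrite card_imset // cardsT card_ord cS.
by move=> E; move: vS; rewrite -E => /imsetP[i _ ->]; exists i.
Qed.

Lemma labels_sum S q (G : nmodType) (F : V -> G) : #|S| = d.+1 -> labels S q ->
  \sum_(v in S) F v = \sum_i F (q i).
Proof.
move=> cS [qi qS]; have <- : q @: [set: 'I_(1 + d)]%SET = S.
  apply/eqP; rewrite eqEcard; apply/andP; split.
    by apply/fintype.subsetP => w /imsetP[i _ ->].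
  by rewrite card_imset // cardsT card_ord cS.
rewrite big_imset /=; last by move=> ? ? _ _; exact: qi.
by apply: eq_bigl => i; rewrite inE.
Qed.

(** Renumbering permutes the columns. Each facet density comes with the numbering that [enum]
    induces on that facet, and this makes the densities of different facets comparable. *)
Lemma labels_det S q q' : #|S| = d.+1 -> labels S q -> labels S q' ->
  `|\det (affmx q)| = `|\det (affmx q')|.
Proof.
move=> cS lq lq'.
have /choice[s Hs] : forall i, exists j, q j = q' i.
  by move=> i; apply: (labels_surj cS lq); case: lq'.
have si : injective s by move=> i j E; apply: lq'.1; rewrite -!Hs E.
have -> : affmx q' = col_perm (perm si) (affmx q).
  apply/matrixP => i j; rewrite [RHS]mxE.
  case: (split_ordP i) => k ->; first by rewrite /affmx !col_mxEu !mxE.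
  by rewrite /affmx !col_mxEd !mxE permE Hs.
by rewrite col_permE det_mulmx det_perm normrM normrX normrN1 expr1n mulr1.
Qed.

(* The functions x |-> c v + g v . x are the barycentric coordinates of the
   nondegenerate simplex with vertex set S. *)
Record is_bary S c g : Prop := IsBary {
  bary_vertex : {in S &, forall v w, affine (c v) (g v) (p w) = (v == w)%:R};
  bary_sumc : \sum_(v in S) c v = 1;
  bary_sumg : forall k, \sum_(v in S) g v k 0 = 0;
  bary_cvtx : forall k, \sum_(v in S) c v * p v k 0 = 0;
  bary_gvtx : forall k l, \sum_(v in S) g v k 0 * p v l 0 = (k == l)%:R }.

Lemma labels_exists S : #|S| = d.+1 -> exists q, labels S q.
Proof.
move=> cS; exists (fun i => enum_val (cast_ord (esym cS) i)); split.
  by move=> i j /enum_val_inj /cast_ord_inj.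
by move=> i; exact: enum_valP.
Qed.

(** Affine independence means that [affmx q] has trivial kernel. With [M] this matrix and [N] its
    inverse, [N M = 1] expresses the vertex values and the blocks of [M N = 1] are the four moment
    identities. *)
Lemma bary_exists S : #|S| = d.+1 -> affindep p S -> exists c g, is_bary S c g.
Proof.
move=> cS aS; have [q lq] := labels_exists cS.
have Mu : affmx q \in unitmx.
  rewrite -unitmx_tr; apply: unitmx_inj => u /matrixP uM.
  pose l v := \sum_(i | q i == v) u 0 i.
  have lE i : l (q i) = u 0 i.
    by rewrite /l (big_pred1 i) // => j /=; rewrite (inj_eq lq.1).
  have H0 : \sum_(v in S) l v = 0.
    rewrite (labels_sum _ cS lq); have := uM 0 (lshift d 0).
    rewrite !mxE => E; rewrite -[RHS]E; apply: eq_bigr => i _.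
    by rewrite lE mxE /affmx col_mxEu mxE mulr1.
  have H1 : \sum_(v in S) l v *: p v = 0.
    rewrite (labels_sum _ cS lq); apply/matrixP => k j; rewrite ord1.
    have := uM 0 (rshift 1 k); rewrite !mxE summxE => E; rewrite -[RHS]E.
    apply: eq_bigr => i _; rewrite lE mxE; congr (_ * _).
    by rewrite mxE /affmx col_mxEd mxE.
  apply/matrixP => i j; rewrite ord1 mxE -lE.
  by apply: aS => //; exact: lq.2.
pose N := invmx (affmx q).
(* As [q] is injective, the sums have at most one term: they carry the rows of [N] from indices to
   vertices. *)
pose c v := \sum_(i | q i == v) N i (lshift d 0).
pose g v : 'cV[R]_d := \col_k \sum_(i | q i == v) N i (rshift 1 k).
have cE i : c (q i) = N i (lshift d 0).
  by rewrite /c (big_pred1 i) // => j /=; rewrite (inj_eq lq.1).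
have gE i k : g (q i) k 0 = N i (rshift 1 k).
  by rewrite mxE (big_pred1 i) // => j /=; rewrite (inj_eq lq.1).
have /matrixP NM := mulVmx Mu; have /matrixP MN := mulmxV Mu.
exists c, g; split.
- move=> v w /(labels_surj cS lq)[i <-] /(labels_surj cS lq)[j <-].
  rewrite (inj_eq lq.1); have := NM i j; rewrite mxE [RHS]mxE => <-.
  rewrite big_split_ord /= big_ord1 col_mxEu mxE mulr1 /affine cE; congr (_ + _).
  by rewrite edotE; apply: eq_bigr => k _; rewrite gE col_mxEd mxE.
- rewrite (labels_sum _ cS lq); have := MN (lshift d 0) (lshift d 0).
  rewrite [RHS]mxE eqxx mulr1n mxE => E; rewrite -[RHS]E; apply: eq_bigr => i _.
  by rewrite cE col_mxEu mxE mul1r.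
- move=> k; rewrite (labels_sum _ cS lq); have := MN (lshift d 0) (rshift 1 k).
  rewrite [RHS]mxE eq_lrshift mulr0n mxE => E; rewrite -[RHS]E; apply: eq_bigr => i _.
  by rewrite gE col_mxEu mxE mul1r.
- move=> k; rewrite (labels_sum _ cS lq); have := MN (rshift 1 k) (lshift d 0).
  rewrite [RHS]mxE eq_rlshift mulr0n mxE => E; rewrite -[RHS]E; apply: eq_bigr => i _.
  by rewrite cE col_mxEd mxE mulrC.
- move=> k l; rewrite (labels_sum _ cS lq); have := MN (rshift 1 l) (rshift 1 k).
  rewrite [RHS]mxE eq_rshift mxE eq_sym => E; rewrite -[RHS]E; apply: eq_bigr => i _.
  by rewrite gE col_mxEd mxE mulrC.
Qed.

End Barycentric.

(** * Simplices, gradients of barycentric coordinates and outer normals *)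

Section SimplexGeometry.
Context {R : realType} {d : nat} {V : finType} (p : V -> 'cV[R]_d).
Implicit Types (S T e : {set V}).

Lemma edotDr n (x y z : 'cV[R]_n) : edot x (y + z) = edot x y + edot x z.
Proof. by rewrite !edotE -big_split; apply: eq_bigr => k _; rewrite mxE mulrDr. Qed.

Lemma edotZr n a (x y : 'cV[R]_n) : edot x (a *: y) = a * edot x y.
Proof. by rewrite !edotE mulr_sumr; apply: eq_bigr => k _; rewrite mxE mulrCA. Qed.

Lemma edotBr n (x y z : 'cV[R]_n) : edot x (y - z) = edot x y - edot x z.
Proof. by rewrite -scaleN1r edotDr edotZr mulN1r. Qed.

Lemma edotC n (x y : 'cV[R]_n) : edot x y = edot y x.
Proof. by rewrite !edotE; apply: eq_bigr => k _; rewrite mulrC. Qed.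

Lemma edotZl n a (x y : 'cV[R]_n) : edot (a *: x) y = a * edot x y.
Proof. by rewrite edotC edotZr edotC. Qed.

Lemma edot_sumr n (I : Type) (r : seq I) (P : pred I) (F : I -> 'cV[R]_n) x :
  edot x (\sum_(i <- r | P i) F i) = \sum_(i <- r | P i) edot x (F i).
Proof.
elim/big_rec2: _ => [|i a b _ <-]; last by rewrite edotDr.
by rewrite edotE big1 // => k _; rewrite mxE mulr0.
Qed.

Lemma edot_ge0 n (x : 'cV[R]_n) : 0 <= edot x x.
Proof. by rewrite edotE sumr_ge0 // => k _; rewrite -expr2 sqr_ge0. Qed.

Lemma edot_eq0 n (x : 'cV[R]_n) : (edot x x == 0) = (x == 0).
Proof.
apply/eqP/eqP => [|->]; last by rewrite edotE big1 // => k _; rewrite mxE mul0r.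
rewrite edotE => /psumr_eq0P H; apply/matrixP => k j; rewrite ord1 mxE.
have /eqP := H (fun i _ => ltac:(rewrite -expr2; exact: sqr_ge0)) k isT.
by rewrite mulf_eq0 orbb => /eqP.
Qed.

Lemma enorm_sqr n (x : 'cV[R]_n) : enorm x ^+ 2 = edot x x.
Proof. by rewrite /enorm sqr_sqrtr // edot_ge0. Qed.

Lemma enormZ n a (x : 'cV[R]_n) : enorm (a *: x) = `|a| * enorm x.
Proof.
by rewrite /enorm edotZl edotZr mulrA -expr2 sqrtrM ?sqr_ge0 // sqrtr_sqr.
Qed.

Lemma coord_le_enorm n (x : 'cV[R]_n) k : `|x k 0| <= enorm x.
Proof.
rewrite -[`|_|]sqrtr_sqr /enorm ler_wsqrtr // edotE (bigD1 k) //= expr2 lerDl.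
by rewrite sumr_ge0 // => j _; rewrite -expr2 sqr_ge0.
Qed.

Lemma enorm_le_coord n (x : 'cV[R]_n) M : (forall k, `|x k 0| <= M) -> enorm x <= n%:R * M.
Proof.
move=> xM; case: n x xM => [|n] x xM.
  by rewrite /enorm edotE big_ord0 sqrtr0 mul0r.
have M0 : 0 <= M by apply: le_trans (xM ord0).
rewrite -(ler_pXn2r (n := 2)) // ?nnegrE ?sqrtr_ge0 ?mulr_ge0 //.
rewrite enorm_sqr edotE (@le_trans _ _ (\sum_(k < n.+1) M ^+ 2)) //.
  apply: ler_sum => k _; rewrite -expr2 -real_normK ?num_real //.
  by rewrite ler_pXn2r // ?nnegrE.
rewrite sumr_const card_ord -[leLHS]mulr_natl exprMn ler_wpM2r ?sqr_ge0 //.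
by rewrite -natrX ler_nat; nia.
Qed.

Section Bary.
Context (S : {set V}) (c : V -> R) (g : V -> 'cV[R]_d).
Hypotheses (cS : #|S| = d.+1) (H : is_bary p S c g).
Local Notation lam v := (affine (c v) (g v)).

Lemma lam_comb (l : V -> R) : \sum_(v in S) l v = 1 ->
  {in S, forall v, lam v (\sum_(w in S) l w *: p w) = l v}.
Proof.
move=> l1 v vS; rewrite /affine edot_sumr -[X in X + _]mulr1 -l1 mulr_sumr -big_split /=.
rewrite (bigD1 v) //= big1 ?addr0.
  have := bary_vertex H vS vS; rewrite /affine eqxx edotZr => E.
  by rewrite mulrC -mulrDr E mulr1.
move=> w /andP[wS wv]; have := bary_vertex H vS wS; rewrite /affine edotZr eq_sym (negbTE wv) => E.
by rewrite mulrC -mulrDr E mulr0.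
Qed.

Lemma sum_lam x : \sum_(v in S) lam v x = 1.
Proof.
rewrite big_split /= (bary_sumc H); under eq_bigr do rewrite edotE.
rewrite exchange_big /= big1 ?addr0 // => k _.
by rewrite -mulr_suml (bary_sumg H) mul0r.
Qed.

Lemma lam_repr x : \sum_(v in S) lam v x *: p v = x.
Proof.
apply/matrixP => k j; rewrite ord1 summxE.
under eq_bigr do rewrite mxE mulrDl edotE mulr_suml.
rewrite big_split /= (bary_cvtx H) add0r exchange_big /=.
rewrite (bigD1 k) //= (eq_bigr (fun v => x k 0 * (g v k 0 * p v k 0))); last first.
  by move=> v _; ring.
rewrite -mulr_sumr (bary_gvtx H) eqxx mulr1 big1 ?addr0 // => i ik.
rewrite (eq_bigr (fun v => x i 0 * (g v i 0 * p v k 0))); last by move=> v _; ring.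
by rewrite -mulr_sumr (bary_gvtx H) (negbTE ik) mulr0.
Qed.

(** Weights on [T], extended by zero to [S], are recovered as barycentric coordinates by
    [lam_comb]. *)
Lemma csimplex_lam T x : T \subset S ->
  csimplex p T x <-> (forall v, v \in T -> 0 <= lam v x) /\
                     (forall v, v \in S -> v \notin T -> lam v x = 0).
Proof.
move=> TS; split.
  case=> l [l0 l1 ->].
  pose l' v := if v \in T then l v else 0.
  have E1 : \sum_(v in S) l' v = 1.
    rewrite -l1 (big_setID T) /= (finset.setIidPr TS) [X in _ + X]big1 ?addr0.
      by apply: eq_bigr => v vT; rewrite /l' vT.
    by move=> v; rewrite !inE /l' => /andP[/negbTE ->].
  have -> : \sum_(v in T) l v *: p v = \sum_(v in S) l' v *: p v.
    rewrite [RHS](big_setID T) /= (finset.setIidPr TS) [X in _ + X]big1 ?addr0.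
      by apply: eq_bigr => v vT; rewrite /l' vT.
    by move=> v; rewrite !inE /l' => /andP[/negbTE ->]; rewrite scale0r.
  split=> [v vT|v vS vT].
    by rewrite lam_comb // /l' ?vT ?l0 //; exact: (fintype.subsetP TS).
  by rewrite lam_comb // /l' (negbTE vT).
case=> H1 H2; exists (fun v => lam v x); split => //.
  rewrite -(sum_lam x) [RHS](big_setID T) /= (finset.setIidPr TS) [X in _ + X]big1 ?addr0 //.
  by move=> v; rewrite !inE => /andP[vT vS]; rewrite H2.
rewrite -[LHS]lam_repr (big_setID T) /= (finset.setIidPr TS) [X in _ + X]big1 ?addr0 //.
by move=> v; rewrite !inE => /andP[vT vS]; rewrite H2 // scale0r.
Qed.

Lemma csimplex_full x : csimplex p S x <-> (forall v, v \in S -> 0 <= lam v x).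
Proof.
rewrite csimplex_lam //; split=> [[]|] // ?; split => // v vS.
by rewrite vS.
Qed.

Lemma osimplex_lam x : osimplex p S x <-> (forall v, v \in S -> 0 < lam v x).
Proof.
split; first by case=> l [l0 l1 ->] v vS; rewrite lam_comb // l0.
by move=> h; exists (fun v => lam v x); split => //; [exact: sum_lam|rewrite lam_repr].
Qed.

Lemma csimplex_vtx T v : v \in T -> csimplex p T (p v).
Proof.
move=> vT; exists (fun w => (w == v)%:R); split => [w _||]; first by rewrite ler0n.
  by rewrite (bigD1 v) //= eqxx big1 ?addr0 // => w /andP[_ /negbTE ->].
rewrite (bigD1 v) //= eqxx scale1r big1 ?addr0 // => w /andP[_ /negbTE ->].
by rewrite scale0r.
Qed.

Lemma grad_vtx v w : v \in S -> w \in S -> v != w -> edot (g v) (p v - p w) = 1.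
Proof.
move=> vS wS vw; have := bary_vertex H vS vS; have := bary_vertex H vS wS.
rewrite (negbTE vw) eqxx /affine edotBr mulr1n mulr0n; lra.
Qed.

Lemma exists_other v : (0 < d)%N -> v \in S -> exists2 w, w \in S & v != w.
Proof.
move=> d0 vS; have : (0 < #|S :\ v|)%N.
  by move: (cardsD1 v S); rewrite vS cS add1n => -[<-].
by case/card_gt0P => w; rewrite !inE => /andP[wv wS]; exists w; rewrite // eq_sym.
Qed.

Lemma enorm_grad_gt0 v : (0 < d)%N -> v \in S -> 0 < enorm (g v).
Proof.
move=> d0 vS; rewrite sqrtr_gt0 lt0r edot_ge0 andbT edot_eq0.
have [w wS vw] := exists_other d0 vS; apply/eqP => g0.
have := grad_vtx vS wS vw; rewrite g0 edotE big1 => [/esym/eqP|k _].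
  by rewrite oner_eq0.
by rewrite mxE mul0r.
Qed.

(** [bary_gvtx] gives [nu = \sum_u (nu . p u) g u]. The numbers [nu . p u] agree for all [u] in the
    facet, and since the [g u] sum to zero only the difference at [v] survives. *)
Lemma facet_normal_dir v nu : v \in S -> enorm nu = 1 ->
  (forall x y, csimplex p (S :\ v) x -> csimplex p (S :\ v) y -> edot nu (x - y) = 0) ->
  forall w, w \in S :\ v ->
  nu = edot nu (p v - p w) *: g v /\ `|edot nu (p v - p w)| * enorm (g v) = 1.
Proof.
move=> vS nu1 nuo w we; set t := edot nu _.
have nuE : nu = t *: g v.
  apply/matrixP => k j; rewrite ord1 mxE.
  transitivity (\sum_(u in S) g u k 0 * edot nu (p u)).
    transitivity (\sum_l nu l 0 * (\sum_(u in S) g u k 0 * p u l 0)).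
      rewrite (bigD1 k) //= (bary_gvtx H) eqxx mulr1 big1 ?addr0 // => l lk.
      by rewrite (bary_gvtx H) eq_sym (negbTE lk) mulr0.
    under eq_bigr do rewrite mulr_sumr.
    rewrite exchange_big /=; apply: eq_bigr => u uS.
    by rewrite edotE mulr_sumr; apply: eq_bigr => l _; ring.
  rewrite (bigD1 v) //= (eq_bigr (fun u => g u k 0 * edot nu (p w))); last first.
    move=> u /andP[uS uv]; congr (_ * _).
    have ue : u \in S :\ v by rewrite !inE uv.
    by apply/eqP; rewrite -subr_eq0 -edotBr nuo //; exact: csimplex_vtx.
  rewrite -mulr_suml.
  have := bary_sumg H k; rewrite (bigD1 v) //= => /eqP.
  by rewrite addr_eq0 => /eqP E; rewrite /t edotBr E; ring.
split => //; by move: nu1; rewrite nuE enormZ.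
Qed.

(** The coordinate of [v] vanishes on the facet and is nonnegative on the simplex, so its gradient
    points inwards. *)
Lemma is_onormal_grad v : (0 < d)%N -> v \in S ->
  is_onormal p S (S :\ v) (- (enorm (g v))^-1 *: g v).
Proof.
move=> d0 vS; have gv := enorm_grad_gt0 d0 vS.
have TS : S :\ v \subset S by rewrite subD1set.
have lam0 x : csimplex p (S :\ v) x -> lam v x = 0.
  by move/(csimplex_lam _ TS) => [_]; apply => //; rewrite !inE eqxx.
split.
- by rewrite enormZ normrN gtr0_norm ?invr_gt0 // mulVf // gt_eqF.
- move=> x y /lam0 x0 /lam0 y0; move: x0 y0; rewrite /affine edotZl edotBr => x0 y0.
  by rewrite -[edot _ x](addrK (c v)) -[edot _ y](addrK (c v)) ![_ + c v]addrC x0 y0 subrr mulr0.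
- move=> x y /csimplex_full /(_ v vS) x0 /lam0 y0; move: x0 y0.
  rewrite /affine edotZl edotBr mulNr oppr_le0 => x0 y0.
  by rewrite mulr_ge0 ?invr_ge0 ?(ltW gv) // subr_ge0 -(lerD2l (c v)) y0.
Qed.

(** [onormal] is a chosen element and is computed through uniqueness: [facet_normal_dir] leaves two
    multiples of [g v], and the sign condition discards one. *)
Lemma onormalE v : (0 < d)%N -> v \in S ->
  onormal p S (S :\ v) = - (enorm (g v))^-1 *: g v.
Proof.
move=> d0 vS; have gv := enorm_grad_gt0 d0 vS.
have [w wS vw] := exists_other d0 vS.
have we : w \in S :\ v by rewrite !inE eq_sym vw.
rewrite /onormal; apply: xget_unique; first exact: is_onormal_grad.
move=> nu [nu1 nu2 nu3]; have [E1 E2] := facet_normal_dir vS nu1 nu2 we.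
have tle := nu3 _ _ (csimplex_vtx vS) (csimplex_vtx we).
rewrite E1; congr (_ *: _); move: E2; rewrite ler0_norm // => E2.
by apply: oppr_inj; rewrite opprK -[LHS]mulr1 -(@mulfV _ (enorm (g v))) ?gt_eqF // mulrA E2 mul1r.
Qed.

Lemma onormalP v : (0 < d)%N -> v \in S ->
  is_onormal p S (S :\ v) (onormal p S (S :\ v)).
Proof. by move=> d0 vS; rewrite onormalE //; exact: is_onormal_grad. Qed.

End Bary.
End SimplexGeometry.

(** * Facet densities as multiples of gradient norms *)

Section FacetDensity.
Context {R : realType} {n : nat} {V : finType} (p : V -> 'cV[R]_n.+1).
Context (S : {set V}) (c : V -> R) (g : V -> 'cV[R]_n.+1).
Hypotheses (cS : #|S| = n.+2) (H : is_bary p S c g).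

Definition gradmx (q : 'I_(1 + n.+1) -> V) : 'M[R]_n.+1 :=
  \matrix_(j, k) g (q (rshift 1 j)) k 0.

Lemma mul_gradmx q : labels S q -> gradmx q *m edgemx p q = 1%:M.
Proof.
move=> lq; apply/matrixP => j l; rewrite mxE [RHS]mxE.
transitivity (edot (g (q (rshift 1 j))) (p (q (rshift 1 l)) - p (q (lshift n.+1 0)))).
  by rewrite edotE; apply: eq_bigr => k _; rewrite !mxE.
have := bary_vertex H (lq.2 (rshift 1 j)) (lq.2 (rshift 1 l)).
have := bary_vertex H (lq.2 (rshift 1 j)) (lq.2 (lshift n.+1 0)).
rewrite !(inj_eq lq.1) eq_rlshift eq_rshift /affine edotBr mulr0n.
by move: (c _) (edot _ _) (edot _ _) ((j == l)%:R) => a b e f E1 E2; rewrite -E2; lra.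
Qed.

(* Cramer's rule for [(J^T J)^-1 = G G^T]: its last diagonal entry is the
   complementary minor of [J^T J] divided by the determinant. *)
Lemma det_gram_col' (J G : 'M[R]_n.+1) : G *m J = 1%:M ->
  \det ((col' ord_max J)^T *m col' ord_max J) =
  \det J ^+ 2 * \sum_k G ord_max k ^+ 2.
Proof.
move=> GJ; pose A := J^T *m J.
have JG := mulmx1C GJ.
have adjE : \adj A = \det A *: (G *m G^T).
  have : (G *m G^T) *m A = 1%:M.
    by rewrite /A mulmxA -(mulmxA G) -trmx_mul JG trmx1 mulmx1.
  move=> E; have : (G *m G^T) *m (A *m \adj A) = \adj A by rewrite mulmxA E mul1mx.
  by rewrite mul_mx_adj mul_mx_scalar => <-.
have /matrixP/(_ ord_max ord_max) := adjE.
rewrite mxE /cofactor -signr_odd addnn odd_double expr0 mul1r => E.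
have -> : (col' ord_max J)^T *m col' ord_max J = row' ord_max (col' ord_max A).
  apply/matrixP => i j; rewrite !mxE; apply: eq_bigr => k _; by rewrite !mxE.
rewrite E mxE /A det_mulmx det_tr -expr2; congr (_ * _).
by rewrite mxE; apply: eq_bigr => k _; rewrite mxE expr2.
Qed.

(* The default value of [nth] makes [v] the last label. *)
Lemma labels_facet v : v \in S -> labels S (fun i : 'I_(1 + n.+1) => nth v (enum (S :\ v)) i).
Proof.
move=> vS; have sz : size (enum (S :\ v)) = n.+1.
  by rewrite -cardE; have := cardsD1 v S; rewrite vS cS add1n => -[].
split=> [i j|i].
  rewrite -!(nth_rcons_default v (enum (S :\ v))) => /eqP.
  rewrite nth_uniq ?size_rcons ?sz ?ltn_ord //.
    by move/eqP/val_inj.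
  by rewrite rcons_uniq mem_enum !inE eqxx enum_uniq.
case: (ltnP i n.+1) => [lt|ge]; last by rewrite nth_default ?sz.
have : nth v (enum (S :\ v)) i \in enum (S :\ v) by rewrite mem_nth ?sz.
by rewrite mem_enum !inE => /andP[].
Qed.

(** With [v] as last label, [fjac] is [edgemx] without its last column, and [g v] is the last row of
    the inverse [gradmx]; the Gram determinant then factors by [det_gram_col']. *)
Lemma fdensity_facet v : v \in S ->
  fdensity p (S :\ v) =
  `|\det (affmx p (fun i => nth v (enum (S :\ v)) i))| * enorm (g v).
Proof.
move=> vS; have lq := labels_facet vS; set q := fun i => _ in lq *.
have sz : size (enum (S :\ v)) = n.+1.
  by rewrite -cardE; have := cardsD1 v S; rewrite vS cS add1n => -[].
have cE k : (k < n.+1)%N -> corner p (S :\ v) k = p (nth v (enum (S :\ v)) k).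
  by move=> kn; rewrite /corner (nth_map v) ?sz.
have -> : fdensity p (S :\ v) =
    Num.sqrt (\det ((col' ord_max (edgemx p q))^T *m col' ord_max (edgemx p q))).
  have E : fjac p (S :\ v) = col' ord_max (edgemx p q).
    apply/matrixP => i k; rewrite !mxE !cE ?ltnS // /q /= /bump leqNgt ltn_ord add0n.
    by rewrite add1n.
  by rewrite /fdensity E.
rewrite (det_gram_col' (mul_gradmx lq)) sqrtrM ?sqr_ge0 // sqrtr_sqr det_affmx.
congr (_ * _); rewrite /enorm edotE; congr Num.sqrt; apply: eq_bigr => k _.
rewrite mxE -expr2 (_ : q _ = v) // /q /= nth_default // sz add1n.
exact: leqnn.
Qed.

(* [D] is [n.+1`!] times the volume of the simplex, a fact that is never needed. *)
Lemma simplex_det : exists D : R, [/\ 0 < D,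
  {in S, forall v, fdensity p (S :\ v) = D * enorm (g v)},
  forall h : R, {in S &, forall v w, forall k, `|p v k 0 - p w k 0| <= h} ->
    D <= n.+1`!%:R * h ^+ n.+1 &
  forall G : R, {in S, forall v k, `|g v k 0| <= G} ->
    1 <= D * (n.+1`!%:R * G ^+ n.+1)].
Proof.
have [q lq] := labels_exists cS.
have GJ := mul_gradmx lq.
have dGJ : \det (gradmx q) * \det (edgemx p q) = 1 by rewrite -det_mulmx GJ det1.
exists `|\det (affmx p q)|; split.
- rewrite normr_gt0 det_affmx; apply/eqP => E; move: dGJ; rewrite E mulr0 => /esym/eqP.
  by rewrite oner_eq0.
- by move=> v vS; rewrite fdensity_facet // (labels_det p cS lq (labels_facet vS)).
- move=> h hh; rewrite det_affmx; apply: det_le => i j.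
  by rewrite mxE; apply: hh; exact: lq.2.
(* The determinant of the gradients is the inverse of that of the edges, so an upper bound for it
   bounds [D] from below. *)
- move=> G hG; rewrite det_affmx -[leLHS]normr1 -{1}dGJ normrM mulrC ler_wpM2l //.
  by apply: det_le => i j; rewrite mxE; apply: hG; exact: lq.2.
Qed.

End FacetDensity.

(** * Opposite normals on a common facet *)

Section Neighbours.
Context {R : realType} {d : nat} {V : finType} (p : V -> 'cV[R]_d).

(* Were the normals equal, both simplices would lie on the same side of their
   common facet, and moving its barycentre slightly towards [v'] would give a
   common point outside the facet. *)
Lemma onormal_opp (S S' : {set V}) c g c' g' v v' : (1 < d)%N ->
  #|S| = d.+1 -> #|S'| = d.+1 -> is_bary p S c g -> is_bary p S' c' g' ->
  v \in S -> v' \in S' -> S :\ v = S' :\ v' ->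
  csimplex p S `&` csimplex p S' = csimplex p (S :\ v) ->
  onormal p S' (S :\ v) = - onormal p S (S :\ v).
Proof.
move=> d1 cS cS' H H' vS v'S' eE IE.
have d0 : (0 < d)%N by exact: ltnW.
have TS : S :\ v \subset S by rewrite subD1set.
have [w wS vw] := exists_other cS d0 vS.
have we : w \in S :\ v by rewrite !inE eq_sym vw.
have wS' : w \in S' by move: we; rewrite eE !inE => /andP[].
have v'w : v' != w by move: we; rewrite eE !inE eq_sym => /andP[].
have gv := enorm_grad_gt0 cS H d0 vS; have gv' := enorm_grad_gt0 cS' H' d0 v'S'.
have [n1 n2 n3] := onormalP cS' H' d0 v'S'; rewrite -eE in n1 n2 n3.
have [E1 E2] := facet_normal_dir H vS n1 n2 we.
set t := edot _ _ in E1 E2.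
rewrite (onormalE cS H d0 vS) {1}E1 scaleNr opprK; congr (_ *: _).
have [t0|t0] := leP 0 t.
  move: E2; rewrite ger0_norm // => E2.
  by rewrite -[LHS]mulr1 -(@mulfV _ (enorm (g v))) ?gt_eqF // mulrA E2 mul1r.
(* For [t < 0] the vertex [p v'] lies strictly on the side of the facet occupied by [S], that is,
   its coordinate with respect to [v] is positive. *)
exfalso.
have nu' : edot (onormal p S' (S :\ v)) (p v' - p w) < 0.
  rewrite eE (onormalE cS' H' d0 v'S') edotZl (grad_vtx H' v'S' wS' v'w) mulr1.
  by rewrite oppr_lt0 invr_gt0.
have lv : 0 < affine (c v) (g v) (p v').
  have := bary_vertex H vS wS; rewrite (negbTE vw) mulr0n.
  move: nu'; rewrite E1 edotZl nmulr_rlt0 // edotBr subr_gt0 /affine => lt E.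
  by rewrite -E ltrD2l.
(* [m] dominates the coordinates of [p v'] in [S], some of which may be negative. Weights [s] at
   [v'] and [s * m] at each of the [d] vertices of the facet sum to 1 and give a point of [S'] whose
   coordinates in [S] are all nonnegative. *)
pose m := \sum_(u in S) `|affine (c u) (g u) (p v')|.
have m0 : 0 <= m by apply: sumr_ge0.
have dm : 0 < 1 + d%:R * m by rewrite ltr_wpDr // mulr_ge0.
pose s := (1 + d%:R * m)^-1; have s0 : 0 < s by rewrite invr_gt0.
have ce : #|S :\ v| = d by have := cardsD1 v S; rewrite vS cS add1n => -[].
pose l u := if u == v' then s else s * m.
pose x := \sum_(u in S') l u *: p u.
have v'e u : u \in S :\ v -> (u == v') = false.
  by rewrite eE !inE => /andP[/negbTE].
have l1 : \sum_(u in S') l u = 1.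
  rewrite (big_setD1 v') //= /l eqxx -eE (eq_bigr (fun=> s * m)); last first.
    by move=> u /v'e ->.
  have E : s * (1 + d%:R * m) = 1 by rewrite mulVf // gt_eqF.
  by rewrite sumr_const ce -[_ *+ d]mulr_natl -[RHS]E; ring.
have xS' : csimplex p S' x.
  exists l; split => // u _; rewrite /l; case: ifP => _; first exact: ltW.
  by rewrite mulr_ge0 // ltW.
have lamx u : affine (c u) (g u) x =
    s * affine (c u) (g u) (p v') + \sum_(y in S :\ v) s * m * affine (c u) (g u) (p y).
  rewrite /affine /x edot_sumr -[X in X + _]mulr1 -l1 mulr_sumr -big_split /=.
  rewrite (big_setD1 v') //= -eE {1 2}/l eqxx edotZr; congr (_ + _); first ring.
  by apply: eq_bigr => y /v'e E; rewrite /l E edotZr; ring.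
have lamv : 0 < affine (c v) (g v) x.
  rewrite lamx big1 ?addr0; first exact: mulr_gt0.
  move=> y; rewrite !inE => /andP[yv yS].
  by rewrite (bary_vertex H) // eq_sym (negbTE yv) mulr0.
have xS : csimplex p S x.
  apply/(csimplex_full H x) => u uS; have [->|uv] := eqVneq u v; first exact: ltW.
  rewrite lamx (bigD1 u) /=; last by rewrite !inE uv.
  rewrite big1 ?addr0; last first.
    move=> y /andP[]; rewrite !inE => /andP[yv yS] yu.
    by rewrite (bary_vertex H) // eq_sym (negbTE yu) mulr0.
  rewrite (bary_vertex H uS uS) eqxx mulr1 -mulrDr mulr_ge0 ?(ltW s0) //.
  rewrite -lerBlDl sub0r; apply: (@le_trans _ _ `|affine (c u) (g u) (p v')|).
    by rewrite -normrN ler_norm.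
  by rewrite /m (bigD1 u) //= lerDl sumr_ge0.
have : csimplex p (S :\ v) x by rewrite -IE.
move/(csimplex_lam H _ TS) => [_ /(_ v vS)]; rewrite !inE eqxx => /(_ isT) E.
by rewrite E ltxx in lamv.
Qed.

End Neighbours.

(** * Complex affine fields and Green's formula on a simplex *)

Section ComplexFields.
Context {R : realType}.
Local Notation C := R[i].

Definition rdot m n (F G : 'M[C]_(m, n)) : R := complex.Re (hdot F G).

Lemma hdotDl m n (F F' G : 'M[C]_(m, n)) : hdot (F + F') G = hdot F G + hdot F' G.
Proof.
rewrite /hdot -big_split; apply: eq_bigr => i _; rewrite -big_split.
by apply: eq_bigr => j _; rewrite mxE mulrDl.
Qed.

Lemma hdotZl m n a (F G : 'M[C]_(m, n)) : hdot (a *: F) G = a * hdot F G.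
Proof.
rewrite /hdot mulr_sumr; apply: eq_bigr => i _; rewrite mulr_sumr.
by apply: eq_bigr => j _; rewrite mxE mulrA.
Qed.

Lemma hdotC m n (F G : 'M[C]_(m, n)) : hdot F G = (hdot G F)^*.
Proof.
rewrite /hdot rmorph_sum; apply: eq_bigr => i _; rewrite rmorph_sum.
by apply: eq_bigr => j _; rewrite rmorphM /= conjcK mulrC.
Qed.

Lemma hdot_tr m n (F : 'M[C]_(m, n)) (G : 'M[C]_(n, m)) : hdot F^T G = hdot F G^T.
Proof.
rewrite /hdot exchange_big; apply: eq_bigr => i _; apply: eq_bigr => j _.
by rewrite !mxE.
Qed.

Lemma ReC (a : R) (z : C) : complex.Re (a%:C * z) = a * complex.Re z.
Proof. by case: z => x y /=; rewrite mul0r subr0. Qed.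

Lemma Re_conjc (z : C) : complex.Re z^* = complex.Re z. Proof. by case: z. Qed.

Lemma Im_conjc (z : C) : complex.Im z^* = - complex.Im z. Proof. by case: z. Qed.

Lemma ReD (z w : C) : complex.Re (z + w) = complex.Re z + complex.Re w.
Proof. by case: z w => a b []. Qed.

Lemma ImD (z w : C) : complex.Im (z + w) = complex.Im z + complex.Im w.
Proof. by case: z w => a b []. Qed.

Lemma ReN (z : C) : complex.Re (- z) = - complex.Re z. Proof. by case: z. Qed.
Lemma ImN (z : C) : complex.Im (- z) = - complex.Im z. Proof. by case: z. Qed.

Lemma Re_sum (I : Type) (r : seq I) (P : pred I) (F : I -> C) :
  complex.Re (\sum_(i <- r | P i) F i) = \sum_(i <- r | P i) complex.Re (F i).
Proof. by elim/big_rec2: _ => // i a b _ <-; rewrite ReD. Qed.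

Lemma Im_sum (I : Type) (r : seq I) (P : pred I) (F : I -> C) :
  complex.Im (\sum_(i <- r | P i) F i) = \sum_(i <- r | P i) complex.Im (F i).
Proof. by elim/big_rec2: _ => // i a b _ <-; rewrite ImD. Qed.

Lemma rdotC m n (F G : 'M[C]_(m, n)) : rdot F G = rdot G F.
Proof. by rewrite /rdot hdotC Re_conjc. Qed.

Lemma rdotDl m n (F F' G : 'M[C]_(m, n)) : rdot (F + F') G = rdot F G + rdot F' G.
Proof. by rewrite /rdot hdotDl ReD. Qed.

Lemma rdotZl m n (a : R) (F G : 'M[C]_(m, n)) : rdot (a%:C *: F) G = a * rdot F G.
Proof. by rewrite /rdot hdotZl ReC. Qed.

Lemma rdotNl m n (F G : 'M[C]_(m, n)) : rdot (- F) G = - rdot F G.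
Proof.
have -> : - F = (- 1 : R)%:C *: F by rewrite rmorphN rmorph1 scaleN1r.
by rewrite rdotZl mulN1r.
Qed.

Lemma rdotDr m n (F G G' : 'M[C]_(m, n)) : rdot F (G + G') = rdot F G + rdot F G'.
Proof. by rewrite rdotC rdotDl ![rdot _ F]rdotC. Qed.

Lemma rdotNr m n (F G : 'M[C]_(m, n)) : rdot F (- G) = - rdot F G.
Proof. by rewrite rdotC rdotNl rdotC. Qed.

Lemma rdotZr m n (a : R) (F G : 'M[C]_(m, n)) : rdot F (a%:C *: G) = a * rdot F G.
Proof. by rewrite rdotC rdotZl rdotC. Qed.

Lemma rdotE m n (F G : 'M[C]_(m, n)) : rdot F G =
  \sum_i \sum_j (complex.Re (F i j) * complex.Re (G i j) +
                 complex.Im (F i j) * complex.Im (G i j)).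
Proof.
rewrite /rdot /hdot Re_sum; apply: eq_bigr => i _; rewrite Re_sum.
apply: eq_bigr => j _; case: (F i j) => a b; case: (G i j) => c e /=.
by rewrite mulrN opprK.
Qed.

Lemma ImhdotE m n (F G : 'M[C]_(m, n)) : complex.Im (hdot F G) =
  \sum_i \sum_j (complex.Im (F i j) * complex.Re (G i j) -
                 complex.Re (F i j) * complex.Im (G i j)).
Proof.
rewrite /hdot Im_sum; apply: eq_bigr => i _; rewrite Im_sum.
apply: eq_bigr => j _; case: (F i j) => a b; case: (G i j) => c e /=.
by rewrite mulrN addrC.
Qed.

Lemma sqnormE m n (F : 'M[C]_(m, n)) : sqnorm F = rdot F F.
Proof.
by rewrite rdotE; apply: eq_bigr => i _; apply: eq_bigr => j _; rewrite /sqabs !expr2.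
Qed.

Lemma sqabs_ge0 (z : C) : 0 <= sqabs z.
Proof. by rewrite addr_ge0 ?sqr_ge0. Qed.

Lemma sqnorm_ge0 m n (F : 'M[C]_(m, n)) : 0 <= sqnorm F.
Proof. by apply: sumr_ge0 => i _; apply: sumr_ge0 => j _; exact: sqabs_ge0. Qed.

Lemma Im_hdot_diag m n (F : 'M[C]_(m, n)) : complex.Im (hdot F F) = 0.
Proof.
rewrite ImhdotE big1 // => i _; rewrite big1 // => j _.
by rewrite mulrC subrr.
Qed.

Lemma Re_mul_conj (z : C) : complex.Re (z * z^*) = sqabs z.
Proof. by case: z => a b; rewrite /sqabs /= mulrN opprK !expr2. Qed.

Lemma Im_mul_conj (z : C) : complex.Im (z * z^*) = 0.
Proof. by case: z => a b; rewrite /= mulrN addrC [b * a]mulrC subrr. Qed.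

Lemma young (s x y : R) : 0 < s -> 2 * (x * y) <= s * x ^+ 2 + y ^+ 2 / s.
Proof.
move=> s0; have s0' : s != 0 by rewrite gt_eqF.
have -> : s * x ^+ 2 + y ^+ 2 / s = 2 * (x * y) + s * (x - y / s) ^+ 2 by field.
by rewrite lerDl mulr_ge0 ?sqr_ge0 // ltW.
Qed.

Lemma Re_hdot_young m n (F G : 'M[C]_(m, n)) (s : R) : 0 < s ->
  2 * rdot F G <= s * sqnorm F + sqnorm G / s.
Proof.
move=> s0; rewrite rdotE /sqnorm !mulr_sumr !mulr_suml -big_split.
apply: ler_sum => i _; rewrite !mulr_sumr !mulr_suml -big_split.
apply: ler_sum => j _; rewrite /sqabs /=.
have := young (complex.Re (F i j)) (complex.Re (G i j)) s0.
have := young (complex.Im (F i j)) (complex.Im (G i j)) s0.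
by move=> h1 h2; lra.
Qed.

Lemma Im_hdot_young m n (F G : 'M[C]_(m, n)) (s : R) : 0 < s ->
  2 * complex.Im (hdot F G) <= s * sqnorm F + sqnorm G / s.
Proof.
move=> s0; rewrite ImhdotE /sqnorm !mulr_sumr !mulr_suml -big_split.
apply: ler_sum => i _; rewrite !mulr_sumr !mulr_suml -big_split.
apply: ler_sum => j _; rewrite /sqabs /=.
have := young (complex.Im (F i j)) (complex.Re (G i j)) s0.
have := young (complex.Re (F i j)) (- complex.Im (G i j)) s0.
rewrite sqrrN mulrN => h1 h2.
by lra.
Qed.

Lemma sqnormN m n (F : 'M[C]_(m, n)) : sqnorm (- F) = sqnorm F.
Proof. by rewrite !sqnormE rdotNl rdotC rdotNl opprK. Qed.

Lemma sqnormZ m n (a : R) (F : 'M[C]_(m, n)) : sqnorm (a%:C *: F) = a ^+ 2 * sqnorm F.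
Proof. by rewrite !sqnormE rdotZl rdotZr mulrA expr2. Qed.

Lemma sqnormD_le m n (F G : 'M[C]_(m, n)) : sqnorm (F + G) <= 2 * (sqnorm F + sqnorm G).
Proof.
have := Re_hdot_young F G ltr01; rewrite divr1 mul1r !sqnormE rdotDl !rdotDr.
by rewrite [rdot G F]rdotC => h; lra.
Qed.

Lemma sqnorm_half_le m n (F G : 'M[C]_(m, n)) : sqnorm (2^-1 *: (F + G)) <= sqnorm F + sqnorm G.
Proof.
have -> : (2^-1 : C) = (2^-1 : R)%:C by rewrite fmorphV rmorph_nat.
rewrite sqnormZ; have := sqnormD_le F G => h.
by rewrite expr2; have := sqnorm_ge0 F; have := sqnorm_ge0 G; lra.
Qed.

Lemma cplxmxE m n (B : 'M[R]_(m, n)) i j : cplxmx B i j = (B i j)%:C.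
Proof. by rewrite mxE. Qed.

End ComplexFields.

(** * Affine vector fields and their gradients *)

Section AffineFields.
Context {R : realType}.
Local Notation C := R[i].

(** Unlike in [is_P1], the dimensions of source and target are independent, so that pull-backs along
    [fparam], which live on the reference simplex of dimension [d - 1], are included. *)
Definition affine_field m n (v : 'cV[R]_m -> 'cV[C]_n) : Prop :=
  exists (b : 'cV[C]_n) (B : 'M[C]_(n, m)), forall x, v x = b + B *m cplxmx x.

Lemma Re_affine_field m n (v : 'cV[R]_m -> 'cV[C]_n) b B k x :
  (forall x, v x = b + B *m cplxmx x) ->
  complex.Re (v x k 0) = affine (complex.Re (b k 0)) (\col_j complex.Re (B k j)) x.
Proof.
move=> ->; rewrite mxE ReD /affine edotE; congr (_ + _); rewrite mxE Re_sum.
apply: eq_bigr => j _; rewrite !mxE; case: (B k j) => a c /=.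
by rewrite mulr0 subr0.
Qed.

Lemma Im_affine_field m n (v : 'cV[R]_m -> 'cV[C]_n) b B k x :
  (forall x, v x = b + B *m cplxmx x) ->
  complex.Im (v x k 0) = affine (complex.Im (b k 0)) (\col_j complex.Im (B k j)) x.
Proof.
move=> ->; rewrite mxE ImD /affine edotE; congr (_ + _); rewrite mxE Im_sum.
apply: eq_bigr => j _; rewrite !mxE; case: (B k j) => a c /=.
by rewrite mulr0 add0r.
Qed.

Definition vtame m n (D : set 'cV[R]_m) (F : 'cV[R]_m -> 'cV[C]_n) : Prop :=
  forall k, tame D (fun x => complex.Re (F x k 0)) /\
            tame D (fun x => complex.Im (F x k 0)).

Lemma vtame_aff m n (D : set 'cV[R]_m) (v : 'cV[R]_m -> 'cV[C]_n) :
  coord_bounded D -> affine_field v -> vtame D v.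
Proof.
move=> bD [b [B vE]] k; split.
  apply: tame_ext (tame_affine _ _ bD) => x; exact/esym/(Re_affine_field k x vE).
apply: tame_ext (tame_affine _ _ bD) => x; exact/esym/(Im_affine_field k x vE).
Qed.

Lemma tame_rdot m n (D : set 'cV[R]_m) (F G : 'cV[R]_m -> 'cV[C]_n) :
  vtame D F -> vtame D G -> tame D (fun x => rdot (F x) (G x)).
Proof.
move=> tF tG.
have T : tame D (fun x => \sum_k (complex.Re (F x k 0) * complex.Re (G x k 0) +
    complex.Im (F x k 0) * complex.Im (G x k 0))).
  by apply: tame_sum => k _; apply: tameD; apply: tameM;
    [exact: (tF k).1|exact: (tG k).1|exact: (tF k).2|exact: (tG k).2].
by apply: tame_ext T => x; rewrite rdotE; apply: eq_bigr => k _; rewrite big_ord1.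
Qed.

Lemma tame_sqnorm m n (D : set 'cV[R]_m) (F : 'cV[R]_m -> 'cV[C]_n) :
  vtame D F -> tame D (fun x => sqnorm (F x)).
Proof. by move=> tF; apply: tame_ext (tame_rdot tF tF) => x; rewrite sqnormE. Qed.

Lemma affine_field_cst m n (b : 'cV[C]_n) : affine_field (fun _ : 'cV[R]_m => b).
Proof. by exists b, 0 => x; rewrite mul0mx addr0. Qed.

Lemma affine_fieldD m n (u v : 'cV[R]_m -> 'cV[C]_n) :
  affine_field u -> affine_field v -> affine_field (fun x => u x + v x).
Proof.
move=> [b [B uE]] [b' [B' vE]]; exists (b + b'), (B + B') => x.
by rewrite uE vE mulmxDl addrACA.
Qed.

Lemma affine_field_mul m n l (A : 'M[C]_(l, n)) (u : 'cV[R]_m -> 'cV[C]_n) :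
  affine_field u -> affine_field (fun x => A *m u x).
Proof.
by move=> [b [B uE]]; exists (A *m b), (A *m B) => x; rewrite uE mulmxDr mulmxA.
Qed.

Lemma affine_fieldZ m n a (u : 'cV[R]_m -> 'cV[C]_n) :
  affine_field u -> affine_field (fun x => a *: u x).
Proof.
move=> [b [B uE]]; exists (a *: b), (a *: B) => x.
by rewrite uE scalerDr scalemxAl.
Qed.

Lemma affine_fieldB m n (u v : 'cV[R]_m -> 'cV[C]_n) :
  affine_field u -> affine_field v -> affine_field (fun x => u x - v x).
Proof.
move=> au av; apply: affine_fieldD => //.
have [b [B E]] := affine_fieldZ (-1) av; exists b, B => x.
by rewrite -E scaleN1r.
Qed.

Lemma derive_affine n c (a x v : 'cV[R]_n) : 'D_v (affine c a) x = edot a v.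
Proof.
rewrite /derive; apply: lim_near_cst => //.
near=> h; have h0 : h != 0 by near: h; exact: nbhs_dnbhs_neq.
rewrite /affine /= edotDr edotZr.
have -> : c + (h * edot a v + edot a x) - (c + edot a x) = h * edot a v by ring.
by rewrite /GRing.scale /= mulrA mulVf // mul1r.
Unshelve. all: by end_near.
Qed.

Lemma grad_P1 d (v : 'cV[R]_d -> 'cV[C]_d) b B : (forall x, v x = b + B *m cplxmx x) ->
  forall x, grad v x = B.
Proof.
move=> vE x; apply/matrixP => k j; rewrite mxE.
have -> : (fun y => complex.Re (v y k 0)) =
    affine (complex.Re (b k 0)) (\col_j complex.Re (B k j)).
  by apply/funext => y; exact: Re_affine_field vE.
have -> : (fun y => complex.Im (v y k 0)) =
    affine (complex.Im (b k 0)) (\col_j complex.Im (B k j)).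
  by apply/funext => y; exact: Im_affine_field vE.
rewrite !derive_affine !edotE (bigD1 j) //= big1 => [|l lj]; last first.
  by rewrite !mxE (negbTE lj) mulr0.
rewrite (bigD1 j) //= big1 => [|l lj]; last by rewrite !mxE (negbTE lj) mulr0.
by rewrite !mxE !eqxx !mulr1 !addr0; case: (B k j).
Qed.

End AffineFields.

(** * Integrals over facets *)

Section FaceIntegrals.
Context {R : realType} {d : nat} {V : finType} (p : V -> 'cV[R]_d).
Local Notation C := R[i].
Implicit Types (e : {set V}).

Lemma fparamE e t : fparam p e t = corner p e 0 + fjac p e *m t.
Proof.
rewrite /fparam; congr (_ + _); apply/matrixP => i j; rewrite ord1 summxE mxE.
by apply: eq_bigr => k _; rewrite !mxE mulrC.
Qed.

Lemma affine_field_fparam n e (v : 'cV[R]_d -> 'cV[C]_n) :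
  affine_field v -> affine_field (v \o fparam p e).
Proof.
move=> [b [B vE]]; exists (v (corner p e 0)), (B *m cplxmx (fjac p e)) => t.
rewrite /= !vE fparamE -addrA; congr (_ + _).
by rewrite /cplxmx map_mxD map_mxM mulmxDr mulmxA.
Qed.

Definition stame e (f : 'cV[R]_d -> R) : Prop :=
  tame (@ref_simplex R d.-1) (f \o fparam p e).

Definition svtame n e (F : 'cV[R]_d -> 'cV[C]_n) : Prop :=
  vtame (@ref_simplex R d.-1) (F \o fparam p e).

Lemma svtame_aff n e (F : 'cV[R]_d -> 'cV[C]_n) : affine_field F -> svtame e F.
Proof.
move=> aF; apply: vtame_aff; last exact: affine_field_fparam.
by case: (@tame_set_ref R d.-1).
Qed.

Lemma fdensity_ge0 e : 0 <= fdensity p e.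
Proof. exact: sqrtr_ge0. Qed.

Definition sintegrable e (f : 'cV[R]_d -> R) : Prop :=
  vintegrable (@ref_simplex R d.-1) (f \o fparam p e).

Lemma stame_sintegrable e f : stame e f -> sintegrable e f.
Proof. by move=> tf; apply: tame_vintegrable => //; exact: tame_set_ref. Qed.

Lemma sintD e f g : sintegrable e f -> sintegrable e g ->
  sint p e (fun x => f x + g x) = sint p e f + sint p e g.
Proof.
by move=> tf tg; rewrite /sint -mulrDr -(vintD (@tame_set_ref R d.-1) tf tg).
Qed.

Lemma sintZ e a f : sintegrable e f -> sint p e (fun x => a * f x) = a * sint p e f.
Proof.
by move=> tf; rewrite /sint mulrCA -(vintZ a (@tame_set_ref R d.-1) tf).
Qed.

Lemma sintN e f : sintegrable e f -> sint p e (fun x => - f x) = - sint p e f.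
Proof.
move=> tf; rewrite -mulN1r -sintZ //; congr (sint p e _).
by apply/funext => x; rewrite mulN1r.
Qed.

Lemma sint_le e f g : sintegrable e f -> sintegrable e g ->
  (forall t, @ref_simplex R d.-1 t -> f (fparam p e t) <= g (fparam p e t)) ->
  sint p e f <= sint p e g.
Proof.
move=> tf tg fg; rewrite /sint ler_wpM2l ?fdensity_ge0 //.
exact: (vint_le (@tame_set_ref R d.-1) tf tg fg).
Qed.

Lemma sint_ge0 e f : (forall x, 0 <= f x) -> 0 <= sint p e f.
Proof.
move=> f0; rewrite /sint mulr_ge0 ?fdensity_ge0 //.
by apply: vint_ge0 => x _; exact: f0.
Qed.

Lemma sint_cst e a : sint p e (fun _ => a) = fdensity p e * a / d.-1`!%:R.
Proof.
by rewrite /sint -mulrA -(@vint_ref_mass R d.-1) -(vint_cst a (@tame_set_ref R d.-1)).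
Qed.

Lemma fparam_csimplex e t : #|e| = d -> (0 < d)%N ->
  @ref_simplex R d.-1 t -> csimplex p e (fparam p e t).
Proof.
move=> ce d0 [t0 t1]; have sz : size (enum e) = d by rewrite -cardE.
have [v0 v0e] : exists v0, v0 \in e by apply/card_gt0P; rewrite ce; exact: d0.
(* Barycentric weights of [fparam e t], indexed by the position of the vertex in [enum e]:
   [1 - \sum_i t_i] at corner 0 and [t_k] at corner [k + 1]. *)
pose w k := if k is k'.+1 then (if insub k' is Some i then t i 0 else 0)
  else 1 - \sum_i t i 0 : R.
have w0 k : 0 <= w k.
  case: k => [|k] /=; first by rewrite subr_ge0.
  by case: insubP.
pose l v := w (index v (enum e)).
(* Stated in any module because it serves twice: with scalars for the sum of the weights, with
   vectors for the point itself. *)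
have S (G : lmodType R) (F : V -> G) :
    \sum_(v in e) l v *: F v = (1 - \sum_i t i 0) *: F (nth v0 (enum e) 0) +
      \sum_(i < d.-1) t i 0 *: F (nth v0 (enum e) i.+1).
  rewrite -big_enum (big_nth v0) sz /= big_mkord.
  case: d d0 t t0 t1 ce sz @w @l w0 => // d' _ t t0 t1 ce sz w l w0.
  rewrite big_ord_recl /l index_uniq ?enum_uniq ?sz //=; congr (_ + _).
  apply: eq_bigr => i _; rewrite index_uniq ?enum_uniq ?sz //=.
  rewrite /bump /= add1n /=; case: insubP => [j _ ji|]; last by rewrite ltn_ord.
  by have -> : j = i by exact: val_inj.
  by rewrite /bump /= add1n ltnS ltn_ord.
exists l; split => [v _||]; first exact: w0.
  have := S _ (fun _ => 1 : R^o); rewrite -!scaler_suml /GRing.scale /= !mulr1 => ->.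
  by rewrite subrK.
have cE k : (k < d)%N -> corner p e k = p (nth v0 (enum e) k).
  by move=> kd; rewrite /corner (nth_map v0) ?sz.
rewrite S /fparam cE // scalerBl scale1r -addrA; congr (_ + _).
rewrite scaler_suml -sumrN -big_split; apply: eq_bigr => i _ /=.
rewrite cE ?scalerBr 1?addrC //.
by have := ltn_ord i; rewrite -ltnS prednK.
Qed.

End FaceIntegrals.

Section MeshSinner.
Context {R : realType} {d : nat} (m : mesh R d).

Lemma Re_sinner (e : {set 'I_(nvert m)}) F G :
  complex.Re (sinner e F G) = sint (vtx m) e (fun x => rdot (F x) (G x)).
Proof. by []. Qed.

Lemma Im_sinner (e : {set 'I_(nvert m)}) F G :
  complex.Im (sinner e F G) = sint (vtx m) e (fun x => complex.Im (hdot (F x) (G x))).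
Proof. by []. Qed.

End MeshSinner.

(** * Green's formula for constant stresses, and the elastic energy density *)

Section Green.
Context {R : realType} {n : nat} {V : finType} (p : V -> 'cV[R]_n.+1).
Local Notation C := R[i].

Lemma affine_fparam (e : {set V}) c a t : affine c a (fparam p e t) =
  affine c a (corner p e 0) +
  \sum_k t k 0 * (affine c a (corner p e k.+1) - affine c a (corner p e 0)).
Proof.
rewrite /affine /fparam edotDr edot_sumr -addrA; congr (_ + (_ + _)).
by apply: eq_bigr => k _; rewrite edotZr edotBr; congr (_ * _); ring.
Qed.

(** The vertex quadrature rule, exact on affine functions: the facet has measure [fdensity p e / n!]
    and [n + 1] vertices. *)
Lemma sint_affine (e : {set V}) c a : #|e| = n.+1 ->
  sint p e (affine c a) = fdensity p e / n.+1`!%:R * \sum_(w in e) affine c a (p w).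
Proof.
move=> ce; have sz : size (enum e) = n.+1 by rewrite -cardE.
have tr := @tame_set_ref R n.
pose f k := affine c a (corner p e k).
have -> : \sum_(w in e) affine c a (p w) = f 0%N + \sum_(k < n) f k.+1.
  have [v0 _] : exists v0, v0 \in e by apply/card_gt0P; rewrite ce.
  rewrite -big_enum (big_nth v0) sz /= big_mkord big_ord_recl /f; congr (_ + _).
    by rewrite /corner (nth_map v0) ?sz.
  apply: eq_bigr => k _; rewrite /corner (nth_map v0) ?sz ?lift0 //.
  by rewrite ltnS ltn_ord.
rewrite /sint -mulrA; congr (_ * _).
transitivity (vint (@ref_simplex R n) (fun t => f 0%N + \sum_(k < n) (f k.+1 - f 0%N) * t k 0)).
  apply: eq_vint => t _; rewrite /= affine_fparam; congr (_ + _).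
  by apply: eq_bigr => k _; rewrite mulrC.
have tc k : tame (@ref_simplex R n) (fun t => t k 0) by apply: tame_coord; case: tr.
have ts : tame (@ref_simplex R n) (fun t => \sum_(k < n) (f k.+1 - f 0%N) * t k 0).
  by apply: tame_sum => k _; exact: tameZ.
rewrite vintD //; last 2 first.
- by apply: tame_vintegrable => //; exact: tame_cst.
- exact: tame_vintegrable.
rewrite vint_cst // vint_ref_mass vint_sum //; last by move=> k _; exact: tameZ.
rewrite (eq_bigr (fun k : 'I_n => (f k.+1 - f 0%N) * n.+1`!%:R^-1)); last first.
  by move=> k _; rewrite vintZ ?vint_ref_moment //; exact: tame_vintegrable.
rewrite -mulr_suml big_split /= sumr_const card_ord factS natrM -[_ *+ n]mulr_natl.
have n0 : n.+1%:R != 0 :> R by rewrite pnatr_eq0.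
have f0 : n`!%:R != 0 :> R by rewrite pnatr_eq0 -lt0n fact_gt0.
move: n0; rewrite -natr1; move: (\sum_(k < n) _) (n%:R) (n`!%:R) f0 (f 0%N) => s N F F0 z N0.
by field; rewrite N0 F0.
Qed.

Lemma conj_mulC (z : C) (x : R) : (z * x%:C)^* = z^* * x%:C.
Proof. by rewrite rmorphM; congr (_ * _); exact: conjc_real. Qed.

(** The constant part [b] drops out because the [g v] sum to zero, and [bary_gvtx], the identity
    [\sum_v g v (p v)^T = 1], turns the linear part into the product with [B]. *)
Lemma rdot_mul_cplx (sg : 'M[C]_n.+1) (b : 'cV[C]_n.+1) (B : 'M[C]_n.+1)
    (S : {set V}) (g : V -> 'cV[R]_n.+1) c : is_bary p S c g ->
  \sum_(v in S) rdot (sg *m cplxmx (g v)) (b + B *m cplxmx (p v)) = rdot sg B.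
Proof.
move=> H; rewrite /rdot -Re_sum; congr complex.Re.
have E1 i j : \sum_(v in S) (sg i j * (g v j 0)%:C) * (b i 0)^* = 0.
  rewrite -mulr_suml -mulr_sumr -rmorph_sum (bary_sumg H) rmorph0 mulr0 mul0r //.
have E2 i j k : \sum_(v in S) (sg i j * (g v j 0)%:C) * (B i k * (p v k 0)%:C)^* =
    sg i j * (B i k)^* * (j == k)%:R.
  rewrite -(rmorph_nat (real_complex R)) -(bary_gvtx H) rmorph_sum mulr_sumr.
  apply: eq_bigr => v _; rewrite [X in _ * X](conj_mulC (B i k) (p v k 0)) rmorphM /=; ring.
rewrite /hdot exchange_big /=; apply: eq_bigr => i _.
transitivity (\sum_(v in S) (\sum_j (sg i j * (g v j 0)%:C) * (b i 0)^* +
    \sum_j \sum_k (sg i j * (g v j 0)%:C) * (B i k * (p v k 0)%:C)^*)).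
  apply: eq_bigr => v _; rewrite big_ord1 !mxE -mulr_suml rmorphD mulrDr /=.
  congr (_ * _ + _); first by apply: eq_bigr => j _; rewrite cplxmxE.
  rewrite rmorph_sum mulr_suml; apply: eq_bigr => j _; rewrite mulr_sumr.
  by apply: eq_bigr => k _; rewrite !cplxmxE.
rewrite big_split /= exchange_big big1 ?add0r /=; last by move=> j _; exact: E1.
rewrite exchange_big; apply: eq_bigr => j _; rewrite exchange_big /= (bigD1 j) //=.
rewrite E2 eqxx mulr1 big1 ?addr0 // => k kj.
by rewrite E2 eq_sym (negbTE kj) mulr0.
Qed.

Lemma rdot_affine (sg b : 'cV[C]_n.+1) (B : 'M[C]_n.+1) :
  exists c a, forall x, rdot sg (b + B *m cplxmx x) = affine c a x.
Proof.
pose f x := rdot sg (b + B *m cplxmx x).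
have fE x : f x = rdot sg b + \sum_k (\sum_i (complex.Re (sg i 0) * complex.Re (B i k)
      + complex.Im (sg i 0) * complex.Im (B i k))) * x k 0.
  rewrite /f rdotDr; congr (_ + _); rewrite rdotE.
  under [RHS]eq_bigr do rewrite mulr_suml.
  rewrite [RHS]exchange_big /=; apply: eq_bigr => i _; rewrite big_ord1 mxE Re_sum Im_sum.
  rewrite !mulr_sumr -big_split; apply: eq_bigr => k _; rewrite cplxmxE.
  by case: (B i k) => y z /=; ring.
exists (rdot sg b), (\col_k \sum_i (complex.Re (sg i 0) * complex.Re (B i k)
      + complex.Im (sg i 0) * complex.Im (B i k))) => x.
by rewrite -/(f x) fE /affine edotE; congr (_ + _); apply: eq_bigr => k _; rewrite mxE.
Qed.

(* As [n = - g v / |g v|] on the facet opposite to [v], whose measure is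
   proportional to [|g v|], the sum is a linear combination of the vertex values
   [f v (p w)], [w != v], where the [f v] sum to zero because the [g v] do. *)
Lemma green (S : {set V}) c g (D : R) (sg : 'M[C]_n.+1) b (B : 'M[C]_n.+1) u :
  #|S| = n.+2 -> is_bary p S c g ->
  {in S, forall v, fdensity p (S :\ v) = D * enorm (g v)} ->
  (forall x, u x = b + B *m cplxmx x) ->
  \sum_(v in S) sint p (S :\ v)
     (fun x => rdot (sg *m cplxmx (onormal p S (S :\ v))) (u x)) =
  D / n.+1`!%:R * rdot sg B.
Proof.
move=> cS H fD uE.
pose f v x := rdot (sg *m cplxmx (g v)) (u x).
have f0 x : \sum_(v in S) f v x = 0.
  have E k : \sum_(v in S) (sg *m cplxmx (g v)) k 0 = 0.
    transitivity (\sum_j sg k j * (\sum_(v in S) g v j 0)%:C).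
      under [RHS]eq_bigr do rewrite rmorph_sum mulr_sumr.
      rewrite exchange_big; apply: eq_bigr => v _; rewrite mxE.
      by apply: eq_bigr => j _; rewrite cplxmxE.
    by rewrite big1 // => j _; rewrite (bary_sumg H) rmorph0 mulr0.
  rewrite /f /rdot -Re_sum /hdot exchange_big big1 //= => i _.
  rewrite exchange_big big1 //= => j _.
  by rewrite -mulr_suml ord1 E mul0r.
have step v : v \in S -> sint p (S :\ v)
    (fun x => rdot (sg *m cplxmx (onormal p S (S :\ v))) (u x)) =
    - (D / n.+1`!%:R) * \sum_(w in S :\ v) f v (p w).
  move=> vS; have gv := enorm_grad_gt0 cS H (ltn0Sn _) vS.
  have ce : #|S :\ v| = n.+1 by have := cardsD1 v S; rewrite vS cS add1n => -[].
  have [c0 [a E]] := rdot_affine (sg *m cplxmx (g v)) b B.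
  have fE x : f v x = affine c0 a x by rewrite /f uE E.
  have -> : (fun x => rdot (sg *m cplxmx (onormal p S (S :\ v))) (u x)) =
      (fun x => - (enorm (g v))^-1 * affine c0 a x).
    apply/funext => x; rewrite (onormalE cS H) // -fE /f -rdotZl; congr (rdot _ _).
    by rewrite scalemxAr /cplxmx map_mxZ.
  rewrite sintZ; last first.
    apply: stame_sintegrable.
    apply: (@tame_ext _ _ _ (fun t => affine c0 a (corner p (S :\ v) 0) +
      \sum_(k < n) (affine c0 a (corner p (S :\ v) k.+1) - affine c0 a (corner p (S :\ v) 0)) * t k 0)).
      move=> t; rewrite /= affine_fparam; congr (_ + _).
      by apply: eq_bigr => k _; rewrite mulrC.
    apply: tameD; first exact: tame_cst.
    apply: tame_sum => k _; apply: tameZ; apply: tame_coord.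
    by case: (@tame_set_ref R n).
  rewrite sint_affine // fD //.
  rewrite (eq_bigr (f v \o p)); last by move=> w _ /=; rewrite fE.
  move: (\sum_(w in _) _) => s; have f1 : n.+1`!%:R != 0 :> R.
    by rewrite pnatr_eq0 -lt0n fact_gt0.
  move: (n.+1`!%:R) f1 (enorm (g v)) (gt_eqF gv) => F F0 e e0.
  by field; rewrite F0 e0.
rewrite (eq_bigr _ step) -mulr_sumr mulNr -mulrN; congr (_ * _).
rewrite -(rdot_mul_cplx sg b B H).
(* Completing the inner sums by [w = v] gives a double sum that vanishes because [\sum_v f v x = 0];
   what remains is [- \sum_v f v (p v)]. *)
have -> : \sum_(v in S) \sum_(w in S :\ v) f v (p w) =
    \sum_(v in S) (\sum_(w in S) f v (p w) - f v (p v)).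
  by apply: eq_bigr => v vS; rewrite (big_setD1 v vS) /= addrC addrK.
rewrite big_split /= exchange_big big1 ?add0r; last by move=> w _; exact: f0.
by rewrite sumrN opprK; apply: eq_bigr => v _; rewrite /f uE.
Qed.

Definition eps_of (B : 'M[C]_n.+1) : 'M[C]_n.+1 := 2^-1 *: (B + B^T).

Definition sig_of (lam mu : R) (B : 'M[C]_n.+1) : 'M[C]_n.+1 :=
  (2 * mu%:C) *: eps_of B + (lam%:C * \tr B)%:M.

Definition energy (lam mu : R) (B : 'M[C]_n.+1) : R :=
  lam * sqabs (\tr B) + 2 * mu * sqnorm (eps_of B).

(** The strain is symmetric, so pairing it with the gradient [B] is pairing it with the symmetric
    part of [B]. *)
Lemma rdot_sig lam mu B : rdot (sig_of lam mu B) B = energy lam mu B.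
Proof.
have two : (2 * mu%:C : C) = (2 * mu)%:C by rewrite rmorphM rmorph_nat.
have half : (2^-1 : C) = (2^-1 : R)%:C by rewrite fmorphV rmorph_nat.
have epsT : (eps_of B)^T = eps_of B by rewrite /eps_of linearZ /= linearD /= trmxK addrC.
rewrite /sig_of rdotDl two rdotZl /energy addrC; congr (_ + _).
  transitivity (lam * complex.Re (\tr B * (\tr B)^*)); last by rewrite Re_mul_conj.
  rewrite -ReC /rdot; congr complex.Re; rewrite /hdot.
  transitivity (\sum_i (lam%:C * \tr B) * (B i i)^*); last first.
    by rewrite -mulr_sumr -rmorph_sum mulrA.
  apply: eq_bigr => i _.
  rewrite (bigD1 i) //= mxE eqxx mulr1n big1 ?addr0 // => j ji.
  by rewrite mxE eq_sym (negbTE ji) mulr0n mul0r.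
congr (_ * _); rewrite sqnormE {3}/eps_of half rdotZr rdotDr.
have -> : rdot (eps_of B) B^T = rdot (eps_of B) B by rewrite /rdot -hdot_tr epsT.
by lra.
Qed.

Lemma energy_ge0 lam mu B : 0 <= lam -> 0 <= mu -> 0 <= energy lam mu B.
Proof. by move=> l m; rewrite addr_ge0 // !mulr_ge0 ?sqabs_ge0 ?sqnorm_ge0. Qed.

Lemma sqnorm_sig_le lam mu B : 0 <= lam -> 0 <= mu ->
  sqnorm (sig_of lam mu B) <= (4 * mu + 2 * n.+1%:R * lam) * energy lam mu B.
Proof.
move=> l0 m0; rewrite /sig_of /energy.
have two : (2 * mu%:C : C) = (2 * mu)%:C by rewrite rmorphM rmorph_nat.
rewrite (le_trans (sqnormD_le _ _)) // two sqnormZ.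
have -> : sqnorm ((lam%:C * \tr B)%:M : 'M[C]_n.+1) = n.+1%:R * (lam ^+ 2 * sqabs (\tr B)).
  rewrite /sqnorm (eq_bigr (fun _ => lam ^+ 2 * sqabs (\tr B))).
    by rewrite sumr_const card_ord mulr_natl.
  move=> i _; rewrite (bigD1 i) //= mxE eqxx mulr1n big1 ?addr0.
    by case: (\tr B) => x y; rewrite /sqabs /= !mul0r subr0 addr0; ring.
  by move=> j ji; rewrite mxE eq_sym (negbTE ji) mulr0n /sqabs /= !expr0n addr0.
have e0 := sqnorm_ge0 (eps_of B); have t0 := sqabs_ge0 (\tr B).
move: (sqnorm _) e0 (sqabs _) t0 (n.+1%:R : R) (ler0n R n.+1) => e e0 t t0 N N0.
have h1 : 0 <= mu * lam * t by rewrite !mulr_ge0.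
have h2 : 0 <= N * lam * mu * e by rewrite !mulr_ge0.
(* The product of the two sums exceeds the squares by mixed terms, which are nonnegative. *)
have -> : (4 * mu + 2 * N * lam) * (lam * t + 2 * mu * e) =
  2 * ((2 * mu) ^+ 2 * e + N * (lam ^+ 2 * t)) + 4 * (mu * lam * t) + 4 * (N * lam * mu * e).
  by ring.
by rewrite -addrA lerDl addr_ge0 // mulr_ge0.
Qed.

(** Cauchy-Schwarz on each row, separately for real and imaginary parts; [cs] expands
    [\sum_k (a k - s nu_k)^2 >= 0]. *)
Lemma sqnorm_mul_unit (sg : 'M[C]_n.+1) (nu : 'cV[R]_n.+1) : enorm nu = 1 ->
  sqnorm (sg *m cplxmx nu) <= sqnorm sg.
Proof.
move=> nu1; rewrite /sqnorm; apply: ler_sum => i _; rewrite big_ord1.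
have nu2 : \sum_k nu k 0 ^+ 2 = 1.
  by have := enorm_sqr nu; rewrite nu1 expr1n edotE => ->; apply: eq_bigr => k _; rewrite expr2.
have cs (a : 'I_n.+1 -> R) : (\sum_k a k * nu k 0) ^+ 2 <= \sum_k a k ^+ 2.
  set s := \sum_k a k * nu k 0.
  have : 0 <= \sum_k (a k - s * nu k 0) ^+ 2 by apply: sumr_ge0 => k _; exact: sqr_ge0.
  rewrite (eq_bigr (fun k => a k ^+ 2 - 2 * s * (a k * nu k 0) + s ^+ 2 * nu k 0 ^+ 2)); last first.
    by move=> k _; ring.
  rewrite !big_split /= sumrN -!mulr_sumr -/s nu2 => h.
  by move: h; move: (\sum_k a k ^+ 2) => t h; rewrite expr2 in h *; lra.
rewrite /sqabs mxE Re_sum Im_sum big_split /=; apply: lerD.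
  rewrite (le_trans _ (cs (fun j => complex.Re (sg i j)))) //.
  rewrite le_eqVlt; apply/orP; left; apply/eqP; congr (_ ^+ 2); apply: eq_bigr => j _.
  by rewrite cplxmxE; case: (sg i j) => x y /=; rewrite mulr0 subr0.
rewrite (le_trans _ (cs (fun j => complex.Im (sg i j)))) //.
rewrite le_eqVlt; apply/orP; left; apply/eqP; congr (_ ^+ 2); apply: eq_bigr => j _.
by rewrite cplxmxE; case: (sg i j) => x y /=; rewrite mulr0 add0r.
Qed.

End Green.

(** * Trace inequalities *)

Section Cells.
Context {R : realType} {n : nat} {V : finType} (p : V -> 'cV[R]_n.+1).
Local Notation C := R[i].
Local Notation d := n.+1.

Lemma affine_comb (T : {set V}) c (a : 'cV[R]_d) (l : V -> R) : \sum_(v in T) l v = 1 ->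
  affine c a (\sum_(v in T) l v *: p v) = \sum_(v in T) l v * affine c a (p v).
Proof.
move=> l1; rewrite /affine edot_sumr -[X in X + _]mulr1 -l1 mulr_sumr -big_split /=.
by apply: eq_bigr => v _; rewrite edotZr; ring.
Qed.

Lemma affine_conv c (a x y : 'cV[R]_d) s :
  affine c a (x + s *: (y - x)) = (1 - s) * affine c a x + s * affine c a y.
Proof. by rewrite /affine edotDr edotZr edotBr; ring. Qed.

(** Nonnegativity of the variance under the weights [l], after which these weights are bounded by
    1. *)
Lemma jensen_sqr (T : {set V}) (l w : V -> R) : (forall v, v \in T -> 0 <= l v) ->
  \sum_(v in T) l v = 1 ->
  (\sum_(v in T) l v * w v) ^+ 2 <= \sum_(v in T) w v ^+ 2.
Proof.
move=> l0 l1; set s := \sum_(v in T) _.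
have l_le1 v : v \in T -> l v <= 1.
  move=> vT; rewrite -l1 (bigD1 v) //= lerDl sumr_ge0 // => u /andP[uT _].
  exact: l0.
apply: (@le_trans _ _ (\sum_(v in T) l v * w v ^+ 2)); last first.
  by apply: ler_sum => v vT; rewrite ler_piMl ?sqr_ge0 ?l_le1.
have : 0 <= \sum_(v in T) l v * (w v - s) ^+ 2.
  by apply: sumr_ge0 => v vT; rewrite mulr_ge0 ?sqr_ge0 ?l0.
rewrite (eq_bigr (fun v => l v * w v ^+ 2 + (- (2 * s) * (l v * w v) + s ^+ 2 * l v))); last first.
  by move=> v _; ring.
rewrite !big_split /= -!mulr_sumr -/s l1 => h.
by rewrite -subr_ge0; apply: le_trans h _; rewrite le_eqVlt; apply/orP; left; apply/eqP; ring.
Qed.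

Lemma sqnorm_colE (z : 'cV[C]_d) :
  sqnorm z = \sum_k (complex.Re (z k 0) ^+ 2 + complex.Im (z k 0) ^+ 2).
Proof. by rewrite /sqnorm; apply: eq_bigr => k _; rewrite big_ord1. Qed.

Lemma sqnorm_csimplex (T : {set V}) (u : 'cV[R]_d -> 'cV[C]_d) x : affine_field u -> csimplex p T x ->
  sqnorm (u x) <= \sum_(v in T) sqnorm (u (p v)).
Proof.
move=> [b [B uE]] [l [l0 l1 ->]].
rewrite sqnorm_colE; under [leRHS]eq_bigr do rewrite sqnorm_colE.
rewrite exchange_big /=; apply: ler_sum => k _; rewrite big_split /=; apply: lerD.
  rewrite (Re_affine_field k _ uE) affine_comb //.
  under [leRHS]eq_bigr do rewrite (Re_affine_field k _ uE).
  exact: jensen_sqr.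
rewrite (Im_affine_field k _ uE) affine_comb //.
under [leRHS]eq_bigr do rewrite (Im_affine_field k _ uE).
exact: jensen_sqr.
Qed.

Lemma coord_bounded_csimplex (T : {set V}) : coord_bounded (csimplex p T).
Proof.
exists (\sum_v \sum_k `|p v k 0|) => x [l [l0 l1 ->]] k.
rewrite summxE (le_trans (ler_norm_sum _ _ _)) //.
rewrite [leRHS](bigID (mem T)) /= ler_wpDr //.
  by apply: sumr_ge0 => v _; apply: sumr_ge0.
apply: ler_sum => v vT; rewrite mxE normrM ger0_norm ?l0 //.
apply: (@le_trans _ _ `|p v k 0|); last by rewrite (bigD1 k) //= lerDl sumr_ge0.
rewrite ler_piMl // -l1 (bigD1 v) //= lerDl sumr_ge0 // => u /andP[uT _].
exact: l0.
Qed.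

Lemma osimplex_sub (T : {set V}) : osimplex p T `<=` csimplex p T.
Proof. by move=> x [l [l0 l1 ->]]; exists l; split => // v vT; exact/ltW/l0. Qed.

Lemma coord_bounded_sub (D E : set 'cV[R]_d) : D `<=` E -> coord_bounded E -> coord_bounded D.
Proof. by move=> DE [M HM]; exists M => x /DE; exact: HM. Qed.

Lemma dist_csimplex_bounded (T : {set V}) : exists M : R,
  forall x y, csimplex p T x -> csimplex p T y -> enorm (x - y) <= M.
Proof.
have [M HM] := coord_bounded_csimplex T; exists (d%:R * (M + M)) => x y Tx Ty.
by apply: enorm_le_coord => k; rewrite !mxE (le_trans (ler_normB _ _)) // lerD ?HM.
Qed.

Lemma dist_le_diam (T : {set V}) x y : csimplex p T x -> csimplex p T y ->
  enorm (x - y) <= diam (csimplex p T).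
Proof.
move=> Tx Ty; have [M HM] := dist_csimplex_bounded T.
rewrite /diam; apply: ub_le_sup; last by exists x, y.
by exists M => _ [x' [y' [Tx' Ty' ->]]]; exact: HM.
Qed.

Lemma diam_subset (T T' : {set V}) : csimplex p T !=set0 ->
  csimplex p T `<=` csimplex p T' -> diam (csimplex p T) <= diam (csimplex p T').
Proof.
move=> [x0 Tx0] TT'; rewrite {1}/diam; apply: ge_sup.
  by exists (enorm (x0 - x0)), x0, x0.
by move=> _ [x [y [Tx Ty ->]]]; apply: dist_le_diam; exact: TT'.
Qed.

Lemma csimplex_subset (T T' : {set V}) : T \subset T' -> csimplex p T `<=` csimplex p T'.
Proof.
move=> TT' x [l [l0 l1 ->]]; pose l' v := if v \in T then l v else 0.
have S (G : lmodType R) (F : V -> G) :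
    \sum_(v in T') l' v *: F v = \sum_(v in T) l v *: F v.
  rewrite (big_setID T) /= (finset.setIidPr TT') [X in _ + X]big1 ?addr0.
    by apply: eq_bigr => v vT; rewrite /l' vT.
  by move=> v; rewrite !inE /l' => /andP[/negbTE -> _]; rewrite scale0r.
exists l'; split; last by rewrite S.
  by move=> v _; rewrite /l'; case: ifPn => // /l0.
have := S _ (fun=> 1 : R^o); rewrite -!scaler_suml /GRing.scale /= !mulr1 => ->.
exact: l1.
Qed.

(** Some admissible diameter [2 * r] exceeds half the supremum, hence the factor 4. If the diameters
    had no supremum, [sup] would take its default value 0. *)
Lemma ball_of_indiam (Q : set 'cV[R]_d) : 0 < indiam Q ->
  exists x r, [/\ 0 < r, indiam Q <= 4 * r &
    forall y, enorm (y - x) <= r -> Q y].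
Proof.
move=> Q0; pose E := [set s : R | exists x r,
  [/\ 0 <= r, forall y : 'cV[R]_d, enorm (y - x) <= r -> Q y & s = 2 * r]].
have hE : has_sup E.
  by apply: contrapT => /sup_out E0; move: Q0; rewrite /indiam -/E E0 ltxx.
have e0 : 0 < indiam Q / 2 by rewrite divr_gt0.
have [_ [x [r [r0 rQ ->]]]] := sup_adherent e0 hE.
rewrite -/(indiam Q) => lt; exists x, r; split => //; lra.
Qed.

Local Notation lam c g v := (affine (c v) (g v)).

(** A face is cut out by the equations [lam_v = 0] at the remaining vertices, each written as two
    opposite half-spaces. *)
Lemma measurable_csimplex (S : {set V}) c g (H : is_bary p S c g) (T : {set V}) : T \subset S ->
  measurable (@colv R d @^-1` csimplex p T).
Proof.
move=> TS; rewrite (_ : _ @^-1` _ = \bigcap_(v in [set v | v \in S])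
    ((@colv R d @^-1` [set x | 0 <= lam c g v x]) `&`
     (if v \in T then setT else @colv R d @^-1` [set x | 0 <= affine (- c v) (- g v) x]))).
  apply: fin_bigcap_measurable => // v _; apply: measurableI.
    exact: measurable_affine_ge0.
  by case: ifP => _ //; exact: measurable_affine_ge0.
have aN v x : affine (- c v) (- g v) x = - lam c g v x.
  by rewrite /affine -[- g v]scaleN1r edotZl; ring.
apply/seteqP; split=> t.
  move/(csimplex_lam H _ TS) => [h1 h2] v /= vS; split.
    by case: (boolP (v \in T)) => [/h1|/(h2 _ vS) ->].
  by case: ifPn => // vT; rewrite /= aN h2 // oppr0.
move=> h; apply/(csimplex_lam H _ TS); split=> v.
  by move=> vT; have [] := h v (fintype.subsetP TS _ vT).
move=> vS vT; have [/= h1] := h v vS; rewrite (negbTE vT) /= aN oppr_ge0 => h2.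
by apply/eqP; rewrite eq_le h1 h2.
Qed.

Lemma tame_set_osimplex (S : {set V}) c g (H : is_bary p S c g) : tame_set (osimplex p S).
Proof.
split; last exact: coord_bounded_sub (@osimplex_sub S) (coord_bounded_csimplex S).
rewrite (_ : _ @^-1` _ = \bigcap_(v in [set v | v \in S])
    (@colv R d @^-1` [set x | 0 < lam c g v x])).
  by apply: fin_bigcap_measurable => // v _; exact: measurable_affine_gt0.
apply/seteqP; split=> t; first by move/(osimplex_lam H) => h v vS; exact: h.
by move=> h; apply/(osimplex_lam H) => v vS; exact: h.
Qed.

Lemma vol_cell_le (S : {set V}) c g (cS : #|S| = d.+1) (H : is_bary p S c g) h : (forall x y, csimplex p S x -> csimplex p S y ->
    forall k, `|x k 0 - y k 0| <= h) ->
  vint (osimplex p S) (fun _ => 1) <= (2 * h) ^+ d.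
Proof.
move=> hh; have [v vS] : exists v, v \in S by apply/card_gt0P; rewrite cS.
have h0 : 0 <= h by rewrite (le_trans _ (hh _ _ (csimplex_vtx _ vS) (csimplex_vtx _ vS) ord0)).
rewrite -(vint_cube (p v) h0); apply: vint_subset => //.
- exact: tame_set_osimplex H.
- exact: tame_set_cube.
- by move=> x /osimplex_sub Sx k; apply: hh => //; exact: csimplex_vtx.
- by apply: tame_vintegrable; [exact: tame_set_cube|exact: tame_cst].
Qed.

(** Moving from the centre by the distance [r] along [g v], or against it, stays in the simplex,
    where every coordinate is between 0 and 1. *)
Lemma ball_lam (S : {set V}) c g (cS : #|S| = d.+1) (H : is_bary p S c g) x0 (r : R)
  (r0 : 0 < r) (rS : forall y, enorm (y - x0) <= r -> csimplex p S y) v : v \in S ->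
  r * enorm (g v) <= lam c g v x0 /\ lam c g v x0 + r * enorm (g v) <= 1.
Proof.
move=> vS; have gv := enorm_grad_gt0 cS H (ltn0Sn _) vS.
pose w := (r / enorm (g v)) *: g v.
have wn : enorm w = r.
  by rewrite enormZ ger0_norm ?divr_ge0 ?(ltW r0) ?(ltW gv) // divfK // gt_eqF.
have gw : edot (g v) w = r * enorm (g v).
  by rewrite edotZr -enorm_sqr expr2 mulrA divfK // gt_eqF.
have y1 : csimplex p S (x0 - w).
  by apply: rS; rewrite addrC addKr -scaleN1r enormZ normrN normr1 mul1r wn.
have y2 : csimplex p S (x0 + w) by apply: rS; rewrite addrC addKr wn.
split.
  move/(csimplex_full H)/(_ v vS): y1; rewrite /affine edotBr gw => h.
  by rewrite -subr_ge0 -addrA.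
rewrite /affine -addrA -gw -edotDr -/(lam c g v (x0 + w)).
rewrite -(sum_lam H (x0 + w)) (bigD1 v) //= lerDl; apply: sumr_ge0 => u /andP[uS _].
exact: (csimplex_full H _).1 y2 _ uS.
Qed.

Lemma grad_le (S : {set V}) c g (cS : #|S| = d.+1) (H : is_bary p S c g) x0 (r : R)
  (r0 : 0 < r) (rS : forall y, enorm (y - x0) <= r -> csimplex p S y) v : v \in S -> 2 * r * enorm (g v) <= 1.
Proof.
move=> vS; have [h1 h2] := ball_lam cS H r0 rS vS.
by rewrite -mulrA mulr_natl mulr2n; apply: le_trans h2; rewrite lerD2r.
Qed.

(** The displacement changes each coordinate by less than [r |g v|], which [ball_lam] leaves
    available at the centre. The inequality is strict because cells are open simplices. *)
Lemma cube_osimplex (S : {set V}) c g (cS : #|S| = d.+1) (H : is_bary p S c g) x0 (r : R)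
  (r0 : 0 < r) (rS : forall y, enorm (y - x0) <= r -> csimplex p S y) (y : 'cV[R]_d) : (forall k, d%:R * `|y k 0 - x0 k 0| < r) -> osimplex p S y.
Proof.
move=> hy; apply/(osimplex_lam H) => v vS.
have gv := enorm_grad_gt0 cS H (ltn0Sn _) vS.
have [h1 _] := ball_lam cS H r0 rS vS.
have -> : lam c g v y = lam c g v x0 + edot (g v) (y - x0) by rewrite /affine edotBr; ring.
suff : - edot (g v) (y - x0) < r * enorm (g v).
  by move: h1; move: (lam c g v x0) (edot _ _) (r * _) => a e b; lra.
apply: (@le_lt_trans _ _ (\sum_k enorm (g v) * `|y k 0 - x0 k 0|)).
  rewrite edotE -sumrN; apply: ler_sum => k _; rewrite !mxE.
  apply: le_trans (ler_norm _) _; rewrite normrN normrM ler_wpM2r //.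
  exact: coord_le_enorm.
rewrite mulrC -mulr_sumr ltr_pM2l //.
have d0 : 0 < d%:R :> R by rewrite ltr0n.
have -> : r = \sum_(k < d) r / d%:R.
  by rewrite sumr_const card_ord -mulrnAl -mulr_natr mulfK ?gt_eqF.
apply: ltr_sum; last by move=> k _; rewrite ltr_pdivlMr // mulrC.
by apply/hasP; exists ord0; rewrite ?mem_index_enum.
Qed.

(** The homothety of ratio [1/4] centred at [v0] contracts a cube around [x0] that lies in the
    simplex; [y'] is the preimage of [y]. A contracted point keeps the weight [3/4] at [v0]. The
    half-side [r / (8 d)] becomes [r / (2 d)] before contraction, which is below the bound [r / d]
    of [cube_osimplex]. *)
Lemma cube_near_vertex (S : {set V}) c g (cS : #|S| = d.+1) (H : is_bary p S c g) x0 (r : R)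
  (r0 : 0 < r) (rS : forall y, enorm (y - x0) <= r -> csimplex p S y) v0 (y : 'cV[R]_d) : v0 \in S ->
  cube (p v0 + 4^-1 *: (x0 - p v0)) (r / (8 * d%:R)) y ->
  osimplex p S y /\ 3 / 4 <= lam c g v0 y.
Proof.
move=> v0S yc; have d0 : 0 < d%:R :> R by rewrite ltr0n.
have aux (D z t : R) : 0 < t -> 0 < D -> 0 <= z -> z * (8 * D) <= t -> D * (4 * z) < t.
  by move=> t0 D0 z0 h; have := mulr_ge0 (ltW D0) z0; lra.
pose y' := p v0 + 4 *: (y - p v0).
have yE : y = p v0 + 4^-1 *: (y' - p v0).
  by rewrite /y' [X in _ *: X]addrC addKr scalerA mulVf ?pnatr_eq0 // scale1r addrC subrK.
have y'S : osimplex p S y'.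
  apply: (cube_osimplex cS H r0 rS) => k; have := yc k; rewrite !mxE => h.
  have -> : p v0 k 0 + 4 * (y k 0 - p v0 k 0) - x0 k 0 =
     4 * (y k 0 - (p v0 k 0 + 4^-1 * (x0 k 0 - p v0 k 0))) by field.
  rewrite normrM ger0_norm //; move: h; rewrite ler_pdivlMr ?mulr_gt0 // => h.
  exact: (aux _ _ _ r0 d0 (normr_ge0 _) h).
have ly v : v \in S -> lam c g v y = (1 - 4^-1) * (v == v0)%:R + 4^-1 * lam c g v y'.
  by move=> vS; rewrite {1}yE affine_conv (bary_vertex H).
have l' v : v \in S -> 0 < lam c g v y' by apply: (osimplex_lam H _).1.
split.
  apply/(osimplex_lam H) => v vS; rewrite ly //; have := l' v vS; have := ler0n R (v == v0).
  by move: (lam c g v y') ((v == v0)%:R) => a b; lra.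
by rewrite ly // eqxx mulr1n; have := l' v0 v0S; move: (lam c g v0 y') => a; lra.
Qed.

(** The vertex [v0] contributes at least [3/4 m] in modulus and all others together at most [1/4 m],
    which leaves [m / 2]. *)
Lemma affine_near_vertex (S : {set V}) c g (H : is_bary p S c g) v0 y a w m : v0 \in S -> osimplex p S y -> 3 / 4 <= lam c g v0 y ->
  {in S, forall v, `|affine a w (p v)| <= m} -> `|affine a w (p v0)| = m ->
  m ^+ 2 / 4 <= affine a w y ^+ 2.
Proof.
have aux (L t M : R) : 0 <= M -> 3 / 4 <= L -> t <= (1 - L) * M -> M / 2 <= L * M - t.
  by nra.
move=> v0S yS hy hm hm0.
have m0 : 0 <= m by rewrite -hm0.
have l0 v : v \in S -> 0 < lam c g v y by apply: (osimplex_lam H _).1.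
pose s := \sum_(v in S | v != v0) lam c g v y * affine a w (p v).
have E : affine a w y = lam c g v0 y * affine a w (p v0) + s.
  by rewrite -{1}(lam_repr H y) affine_comb ?(sum_lam H) // (bigD1 v0).
have sle : `|s| <= (1 - lam c g v0 y) * m.
  rewrite (le_trans (ler_norm_sum _ _ _)) //.
  have -> : 1 - lam c g v0 y = \sum_(v in S | v != v0) lam c g v y.
    by rewrite -(sum_lam H y) (bigD1 v0) //= addrAC subrr add0r.
  rewrite mulr_suml; apply: ler_sum => v /andP[vS _].
  by rewrite normrM gtr0_norm ?l0 // ler_wpM2l ?hm // ltW ?l0.
suff h : m / 2 <= `|affine a w y|.
  rewrite -(real_normK (num_real (affine a w y))).
  have -> : m ^+ 2 / 4 = (m / 2) ^+ 2 by field.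
  by rewrite ler_pXn2r // nnegrE ?divr_ge0.
rewrite E; have := lerB_normD (lam c g v0 y * affine a w (p v0)) s.
rewrite normrM hm0 gtr0_norm ?l0 // => h.
apply: le_trans h; exact: aux.
Qed.

(** The integral is restricted to the cube next to the vertex of largest modulus [m], with side
    [2 r / (8 d) = r / (4 d)]. There the square is at least [m^2 / 4], and [m^2] is at least the
    mean of the [d + 1] squared vertex values. *)
Lemma vint_affine_sqr_ge (S : {set V}) c g (cS : #|S| = d.+1) (H : is_bary p S c g) x0 (r : R)
  (r0 : 0 < r) (rS : forall y, enorm (y - x0) <= r -> csimplex p S y) a w :
  (r / (4 * d%:R)) ^+ d / (4 * d.+1%:R) * \sum_(v in S) affine a w (p v) ^+ 2
  <= vint (osimplex p S) (fun x => affine a w x ^+ 2).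
Proof.
have d0 : 0 < d%:R :> R by rewrite ltr0n.
have [v1 v1S] : exists v, v \in S by apply/card_gt0P; rewrite cS.
have [v0 v0S hmax] : exists2 v0, v0 \in S &
    {in S, forall v, `|affine a w (p v)| <= `|affine a w (p v0)|}.
  case: (@arg_maxP _ _ _ v1 (mem S) (fun v => `|affine a w (p v)|) v1S) => v0 v0S hv.
  by exists v0 => // v vS; exact: hv.
set m := `|affine a w (p v0)| in hmax.
pose z := p v0 + 4^-1 *: (x0 - p v0); pose dl := r / (8 * d%:R).
have dl0 : 0 <= dl by rewrite divr_ge0 ?(ltW r0) // mulr_ge0.
have tO := tame_set_osimplex H.
have tw : tame (osimplex p S) (fun x => affine a w x ^+ 2).
  apply: tame_ext (tameM _ _) => [x||]; last 2 first.
  - by apply: (tame_affine a w); case: tO.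
  - by apply: (tame_affine a w); case: tO.
  by rewrite expr2.
have cO : cube z dl `<=` osimplex p S by move=> y /(cube_near_vertex cS H r0 rS v0S)[].
apply: (@le_trans _ _ (vint (cube z dl) (fun _ => m ^+ 2 / 4))).
  rewrite vint_cst; last exact: tame_set_cube.
  rewrite vint_cube //.
  have -> : 2 * dl = r / (4 * d%:R) by rewrite /dl; field; rewrite gt_eqF.
  set P := _ ^+ d.
  have P0 : 0 <= P by rewrite exprn_ge0 // divr_ge0 ?(ltW r0) // mulr_ge0.
  have : \sum_(v in S) affine a w (p v) ^+ 2 <= d.+1%:R * m ^+ 2.
    rewrite -cS mulr_natl -sumr_const; apply: ler_sum => v vS.
    by rewrite -(real_normK (num_real (affine a w (p v)))) ler_pXn2r ?nnegrE ?normr_ge0 // hmax.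
  have D0 : 0 < d.+1%:R :> R by rewrite ltr0n.
  move: (\sum_(v in S) _) (d.+1%:R : R) D0 (m ^+ 2) => s D D0 M h.
  rewrite [leRHS]mulrC -mulrA ler_wpM2l // mulrC ler_pdivrMr ?mulr_gt0 //.
  by move: h; lra.
apply: (@le_trans _ _ (vint (cube z dl) (fun x => affine a w x ^+ 2))).
  apply: vint_le; first exact: tame_set_cube.
  - by apply: tame_vintegrable; [exact: tame_set_cube|exact: tame_cst].
  - apply: tame_vintegrable; first exact: tame_set_cube.
    apply: tame_ext (tameM _ _) => [x||]; last 2 first.
    + by apply: (tame_affine a w); case: (tame_set_cube z dl).
    + by apply: (tame_affine a w); case: (tame_set_cube z dl).
    by rewrite expr2.
  - move=> y /(cube_near_vertex cS H r0 rS v0S)[yS hy]; exact: (affine_near_vertex H v0S yS hy).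
apply: vint_subset => //.
- exact: tame_set_cube.
- exact: tame_vintegrable.
- by move=> x _; exact: sqr_ge0.
Qed.

Lemma vint_sqnorm_ge (S : {set V}) c g (cS : #|S| = d.+1) (H : is_bary p S c g) x0 (r : R)
  (r0 : 0 < r) (rS : forall y, enorm (y - x0) <= r -> csimplex p S y) (u : 'cV[R]_d -> 'cV[C]_d) : affine_field u ->
  (r / (4 * d%:R)) ^+ d / (4 * d.+1%:R) * \sum_(v in S) sqnorm (u (p v))
  <= vint (osimplex p S) (fun x => sqnorm (u x)).
Proof.
move=> [b [B uE]]; have tO := tame_set_osimplex H.
have bO : coord_bounded (osimplex p S) by case: tO.
pose wr k := affine (complex.Re (b k 0)) (\col_j complex.Re (B k j)).
pose wi k := affine (complex.Im (b k 0)) (\col_j complex.Im (B k j)).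
have sE x : sqnorm (u x) = \sum_k (wr k x ^+ 2 + wi k x ^+ 2).
  rewrite sqnorm_colE; apply: eq_bigr => k _.
  by rewrite (Re_affine_field k x uE) (Im_affine_field k x uE).
have tsq a w : tame (osimplex p S) (fun x => affine a w x ^+ 2).
  apply: tame_ext (tameM _ _) => [x||]; last 2 first.
  - exact: (tame_affine a w).
  - exact: (tame_affine a w).
  by rewrite expr2.
rewrite (eq_vint (fun x _ => sE x)) vint_sum //; last by move=> k _; apply: tameD; exact: tsq.
rewrite (eq_bigr _ (fun v _ => sE (p v))) exchange_big mulr_sumr.
apply: ler_sum => k _; rewrite vintD //; last 2 first.
- by apply: tame_vintegrable => //; exact: tsq.
- by apply: tame_vintegrable => //; exact: tsq.
by rewrite big_split /= mulrDr lerD // (vint_affine_sqr_ge cS H r0 rS).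
Qed.

Lemma vol_cell_ge (S : {set V}) c g (cS : #|S| = d.+1) (H : is_bary p S c g) x0 (r : R)
  (r0 : 0 < r) (rS : forall y, enorm (y - x0) <= r -> csimplex p S y) : (r / (4 * d%:R)) ^+ d / 4 <= vint (osimplex p S) (fun _ => 1).
Proof.
have := vint_affine_sqr_ge cS H r0 rS 1 0.
have E x : affine 1 (0 : 'cV[R]_d) x ^+ 2 = 1.
  by rewrite /affine edotE big1 ?addr0 ?expr1n // => k _; rewrite mxE mul0r.
rewrite (eq_vint (fun x _ => E x)) (eq_bigr _ (fun v _ => E (p v))) sumr_const cS.
have D0 : d.+1%:R != 0 :> R by rewrite pnatr_eq0.
move: (_ ^+ d) (d.+1%:R : R) D0 => P D D0.
by rewrite invfM mulrA divfK.
Qed.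

End Cells.

(** * Bounds on one element, uniform under shape regularity *)

Section ElementBounds.
Context {R : realType} {n : nat}.
Local Notation C := R[i].
Local Notation d := n.+1.

Lemma edot_le_enorm (x y : 'cV[R]_d) : edot x y <= d%:R * (enorm x * enorm y).
Proof.
rewrite edotE; apply: (@le_trans _ _ (\sum_(k < d) enorm x * enorm y)); last first.
  by rewrite sumr_const card_ord mulr_natl.
apply: ler_sum => k _; apply: le_trans (ler_norm _) _.
by rewrite normrM ler_pM // coord_le_enorm.
Qed.

(** The chain [h <= Cstar * diam <= Cstar * kappa * indiam <= 4 * kappa * Cstar * r] bounds the
    radius from below, and [grad_le] then bounds the gradients. *)
Lemma element_geometry {V : finType} (p : V -> 'cV[R]_d) (S : {set V}) c g
    (kappa Cstar h : R) : #|S| = d.+1 -> is_bary p S c g ->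
  0 < kappa -> 0 < Cstar -> 0 < h ->
  diam (csimplex p S) <= h -> h <= Cstar * diam (csimplex p S) ->
  diam (csimplex p S) <= kappa * indiam (csimplex p S) ->
  exists x r, [/\ 0 < r, h <= 4 * kappa * Cstar * r,
    forall y, enorm (y - x) <= r -> csimplex p S y &
    {in S, forall v, enorm (g v) <= 2 * kappa * Cstar / h}].
Proof.
move=> cS H k0 C0 h0 dh hd dk.
have D0 : 0 < diam (csimplex p S) by rewrite -(pmulr_rgt0 _ C0) (lt_le_trans h0).
have I0 : 0 < indiam (csimplex p S) by rewrite -(pmulr_rgt0 _ k0) (lt_le_trans D0).
have [x [r [r0 Ir rS]]] := ball_of_indiam I0.
have hr : h <= 4 * kappa * Cstar * r.
  have h1 : Cstar * diam (csimplex p S) <= Cstar * (kappa * indiam (csimplex p S)).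
    by rewrite ler_pM2l.
  have h2 : Cstar * (kappa * indiam (csimplex p S)) <= Cstar * (kappa * (4 * r)).
    by rewrite !ler_pM2l.
  apply: le_trans (le_trans hd (le_trans h1 h2)) _.
  by rewrite le_eqVlt; apply/orP; left; apply/eqP; ring.
exists x, r; split => // v vS; rewrite ler_pdivlMr //.
have gr := grad_le cS H r0 rS vS.
have g0 : 0 <= enorm (g v) by exact: sqrtr_ge0.
apply: (@le_trans _ _ (enorm (g v) * (4 * kappa * Cstar * r))); first by rewrite ler_wpM2l.
have -> : enorm (g v) * (4 * kappa * Cstar * r) = (2 * kappa * Cstar) * (2 * r * enorm (g v)).
  by ring.
by rewrite ler_piMr // !mulr_ge0 // ltW.
Qed.

(** All that is used about a single simplex, with [K] chosen before it. [D] plays the part of the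
    volume: Green's formula holds with [D], and the comparison with the integral of 1 turns
    [D * energy] into a bound for the energy of the element. The other clauses are trace
    inequalities for the field and for its constant stress. *)
Lemma element_bounds (kappa Cstar lam mu : R) :
  0 < kappa -> 0 < Cstar -> 0 < lam -> 0 < mu -> exists2 K : R, 0 < K &
  forall (V : finType) (p : V -> 'cV[R]_d) (S : {set V}) c g (h : R),
  #|S| = d.+1 -> is_bary p S c g -> 0 < h ->
  diam (csimplex p S) <= h -> h <= Cstar * diam (csimplex p S) ->
  diam (csimplex p S) <= kappa * indiam (csimplex p S) ->
  exists D : R, [/\ 0 < D, vint (osimplex p S) (fun=> 1) <= K * D,
    {in S, forall v, diam (csimplex p (S :\ v)) <= h /\
      ((1 < d)%N -> h <= K * diam (csimplex p (S :\ v)))} &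
  forall (u : 'cV[R]_d -> 'cV[C]_d) b B, (forall x, u x = b + B *m cplxmx x) ->
  [/\ \sum_(v in S) sint p (S :\ v)
        (fun x => rdot (sig_of lam mu B *m cplxmx (onormal p S (S :\ v))) (u x)) =
      D * energy lam mu B,
    {in S, forall v, sint p (S :\ v) (fun x => sqnorm (u x)) <=
       K / h * vint (osimplex p S) (fun x => sqnorm (u x))} &
    {in S, forall v nu, enorm nu = 1 ->
       sint p (S :\ v) (fun=> sqnorm (sig_of lam mu B *m cplxmx nu)) <=
       K / h * (vint (osimplex p S) (fun=> 1) * energy lam mu B)}]].
Proof.
move=> k0 C0 l0 m0.
(* [h <= beta * r] and [|g v| <= beta / (2 h)] are the two consequences of shape regularity; [W]
   bounds [h^d] by the volume of the cube of side [r / (4 d)]. *)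
pose beta := 4 * kappa * Cstar; have b0 : 0 < beta by rewrite !mulr_gt0.
pose F : R := d`!%:R; have F0 : 0 < F by rewrite ltr0n fact_gt0.
pose W := (4 * d%:R * beta) ^+ d; have W0 : 0 < W by rewrite exprn_gt0 // !mulr_gt0 // ltr0n.
pose Cs := 4 * mu + 2 * d%:R * lam.
have Cs0 : 0 < Cs by rewrite addr_gt0 ?mulr_gt0 // ltr0n.
(* [K1] compares the volume with [D / F], [K2] and [K3] are the trace constants for the field and
   for the stress, [K4] compares [h] with the diameter of a facet. *)
pose K1 := F * F * beta ^+ d.
pose K2 := F * beta / 2 * W * (4 * d.+1%:R).
pose K3 := F * beta / 2 * W * 4 * Cs.
pose K4 := d%:R * beta / 2.
have K10 : 0 < K1 by rewrite !mulr_gt0 // exprn_gt0.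
have K20 : 0 < K2 by rewrite !mulr_gt0 // ?invr_gt0 ?ltr0n //.
have K30 : 0 < K3 by rewrite !mulr_gt0 // ?invr_gt0 ?ltr0n //.
have K40 : 0 < K4 by rewrite !mulr_gt0 // ?invr_gt0 ?ltr0n //.
exists (K1 + K2 + K3 + K4); first by rewrite !addr_gt0.
have [K1K K2K K3K K4K] : [/\ K1 <= K1 + K2 + K3 + K4, K2 <= K1 + K2 + K3 + K4,
    K3 <= K1 + K2 + K3 + K4 & K4 <= K1 + K2 + K3 + K4].
  by move: K1 K2 K3 K4 K10 K20 K30 K40 => *; split; lra.
move: (K1 + K2 + K3 + K4) K1K K2K K3K K4K => K K1K K2K K3K K4K.
move=> V p S c g h cS H h0 dh hd dk.
have [x [r [r0 hr rS gle]]] := element_geometry cS H k0 C0 h0 dh hd dk.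
have gle' v : v \in S -> enorm (g v) <= beta / 2 / h.
  by move/gle; rewrite (_ : 2 * kappa * Cstar = beta / 2) // /beta; field.
have [D [D0 fD Dle Dge]] := simplex_det cS H.
have coordh y z : csimplex p S y -> csimplex p S z -> forall k, `|y k 0 - z k 0| <= h.
  move=> Sy Sz k; apply: le_trans dh; apply: le_trans (dist_le_diam Sy Sz).
  by have := coord_le_enorm (y - z) k; rewrite !mxE.
have DF : D <= F * h ^+ d.
  by apply: Dle => v w vS wS k; apply: coordh; exact: csimplex_vtx.
have FD : h ^+ d <= D * (F * (beta / 2) ^+ d).
  have /Dge : {in S, forall v k, `|g v k 0| <= beta / 2 / h}.
    by move=> v vS k; apply: le_trans (gle' v vS); exact: coord_le_enorm.
  by rewrite expr_div_n !mulrA ler_pdivlMr ?exprn_gt0 // mul1r.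
pose vol := vint (osimplex p S) (fun=> 1).
have hW : h ^+ d <= W * (r / (4 * d%:R)) ^+ d.
  rewrite /W -exprMn ler_pXn2r // ?nnegrE; last 2 first.
  - exact: ltW.
  - by rewrite !mulr_ge0 ?invr_ge0 ?mulr_ge0 // ltW.
  rewrite (_ : 4 * d%:R * beta * (r / (4 * d%:R)) = beta * r); first exact: hr.
  have : (d%:R : R) != 0 by rewrite pnatr_eq0.
  by move: (d%:R : R) => D' D'0; field.
have volge : h ^+ d <= 4 * W * vol.
  have := vol_cell_ge cS H r0 rS; rewrite ler_pdivrMr // -/vol => hv.
  apply: le_trans hW _; rewrite (_ : 4 * W * vol = W * (vol * 4)); last ring.
  by rewrite ler_pM2l.
have fdle v : v \in S -> fdensity p (S :\ v) <= F * beta / 2 / h * h ^+ d.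
  move=> vS; rewrite fD //; apply: (@le_trans _ _ (F * h ^+ d * (beta / 2 / h))).
    by rewrite ler_pM ?(ltW D0) ?sqrtr_ge0 ?gle'.
  by rewrite le_eqVlt; apply/orP; left; apply/eqP; field; rewrite gt_eqF.
have nf : 1 <= n`!%:R :> R by rewrite ler1n fact_gt0.
exists (D / F); split; first by rewrite divr_gt0.
- apply: (@le_trans _ _ (K1 * (D / F))); last by rewrite ler_wpM2r // divr_ge0 // ltW.
  have := vol_cell_le cS H coordh; rewrite -/vol => vle; apply: le_trans vle _.
  rewrite exprMn; apply: (@le_trans _ _ (2 ^+ d * (D * (F * (beta / 2) ^+ d)))).
    by rewrite ler_wpM2l // exprn_ge0.
  rewrite /K1 expr_div_n le_eqVlt; apply/orP; left; apply/eqP.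
  have : 2 ^+ d != 0 :> R by rewrite expf_neq0.
  move: (2 ^+ d) (beta ^+ d) (lt0r_neq0 F0) => T Z G0 T0.
  by field; rewrite T0 G0.
- move=> v vS; have [w wS vw] := exists_other cS (ltn0Sn _) vS.
  have we : w \in S :\ v by rewrite !inE eq_sym vw.
  split.
    apply: le_trans dh; apply: diam_subset; first by exists (p w); exact: csimplex_vtx.
    by apply: csimplex_subset; exact: subD1set.
  (* For [1 < d] the facet has two vertices [w] and [w'], and [g w . (p w - p w') = 1] bounds their
     distance from below because [g w] is at most of order [1 / h]. *)
  move=> d1; have [w' w'e ww'] : exists2 w', w' \in S :\ v & w != w'.
    have : (0 < #|S :\ v :\ w|)%N.
      have := cardsD1 v S; rewrite vS cS add1n => -[E].
      by have := cardsD1 w (S :\ v); rewrite we -E add1n => -[E']; rewrite -ltnS -E'.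
    by case/card_gt0P => w'; rewrite !inE => /andP[w'w w'S]; exists w'; rewrite ?inE // eq_sym.
  have w'S : w' \in S by move: w'e; rewrite !inE => /andP[].
  have g1 := grad_vtx H wS w'S ww'.
  have := edot_le_enorm (g w) (p w - p w'); rewrite g1 => h1.
  have h2 := dist_le_diam (csimplex_vtx p we) (csimplex_vtx p w'e).
  set dm := diam _ in h2 *; have dm0 : 0 <= dm by apply: le_trans h2; exact: sqrtr_ge0.
  apply: (@le_trans _ _ (K4 * dm)); last by rewrite ler_wpM2r.
  have h3 : 1 <= d%:R * (beta / 2 / h * dm).
    apply: le_trans h1 _; rewrite ler_wpM2l //.
    by rewrite ler_pM ?sqrtr_ge0 ?gle'.
  have : h * 1 <= h * (d%:R * (beta / 2 / h * dm)) by rewrite ler_wpM2l // ltW.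
  rewrite mulr1 => h4; apply: le_trans h4 _; rewrite le_eqVlt; apply/orP; left; apply/eqP.
  by rewrite /K4; field; rewrite gt_eqF.
move=> u b B uE; have au : affine_field u by exists b, B.
split.
- by rewrite (green (sig_of lam mu B) cS H fD uE) rdot_sig.
(* On the facet [|u|^2] is at most the sum [V2] over the vertices. The density is of order
   [h^(d-1)], and [vint_sqnorm_ge] bounds [h^d * V2] by the integral over the cell. *)
- move=> v vS; pose V2 := \sum_(w in S) sqnorm (u (p w)).
  have V20 : 0 <= V2 by apply: sumr_ge0 => w _; exact: sqnorm_ge0.
  have ce : #|S :\ v| = d by have := cardsD1 v S; rewrite vS cS add1n => -[].
  have st : sint p (S :\ v) (fun x => sqnorm (u x)) <= fdensity p (S :\ v) * V2.
    apply: (@le_trans _ _ (sint p (S :\ v) (fun=> V2))).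
      apply: sint_le.
      - by apply: stame_sintegrable; apply: tame_sqnorm; exact: svtame_aff.
      - by apply: stame_sintegrable; exact: tame_cst.
      - move=> t rt; apply: sqnorm_csimplex => //.
        apply: (csimplex_subset (subD1set S v)).
        exact: fparam_csimplex.
    rewrite sint_cst ler_pdivrMr ?ltr0n ?fact_gt0 // ler_peMr //.
    by rewrite mulr_ge0 ?fdensity_ge0.
  have N := vint_sqnorm_ge cS H r0 rS au; rewrite -/V2 in N.
  set NI := vint _ _ in N *.
  have NI0 : 0 <= NI by apply: vint_ge0 => y _; exact: sqnorm_ge0.
  apply: (@le_trans _ _ (K2 / h * NI)); last first.
    by rewrite ler_wpM2r // ler_wpM2r ?invr_ge0 // ltW.
  apply: le_trans st _.
  apply: (@le_trans _ _ (F * beta / 2 / h * (h ^+ d * V2))).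
    by rewrite mulrA ler_wpM2r // fdle.
  have -> : K2 / h * NI = F * beta / 2 / h * (W * (4 * d.+1%:R) * NI).
    by rewrite /K2; move: (h) (gt_eqF h0) => h' h'0; field; rewrite h'0.
  rewrite ler_wpM2l //; first by rewrite !mulr_ge0 ?invr_ge0 // ltW.
  apply: (@le_trans _ _ (W * (r / (4 * d%:R)) ^+ d * V2)); first by rewrite ler_wpM2r.
  rewrite -!mulrA ler_wpM2l ?(ltW W0) //.
  move: N; rewrite mulrAC ler_pdivrMr ?mulr_gt0 ?ltr0n //.
  move=> N'; apply: le_trans N' _; rewrite le_eqVlt; apply/orP; left; apply/eqP.
  by ring.
- move=> v vS nu nu1; have e0 : 0 <= energy lam mu B by apply: energy_ge0; exact: ltW.
  rewrite sint_cst.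
  have s0 := sqnorm_ge0 (sig_of lam mu B *m cplxmx nu).
  apply: (@le_trans _ _ (fdensity p (S :\ v) * sqnorm (sig_of lam mu B *m cplxmx nu))).
    rewrite ler_pdivrMr ?ltr0n ?fact_gt0 // ler_peMr // mulr_ge0 ?fdensity_ge0 //.
  have s1 : sqnorm (sig_of lam mu B *m cplxmx nu) <= Cs * energy lam mu B.
    by apply: le_trans (sqnorm_mul_unit _ nu1) _; apply: sqnorm_sig_le; exact: ltW.
  apply: (@le_trans _ _ (F * beta / 2 / h * h ^+ d * (Cs * energy lam mu B))).
    by rewrite ler_pM ?fdensity_ge0 ?fdle.
  have v0 : 0 <= vol by apply: vint_ge0 => y _; exact: ler01.
  apply: (@le_trans _ _ (K3 / h * (vol * energy lam mu B))); last first.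
    by rewrite ler_wpM2r ?mulr_ge0 // ler_wpM2r ?invr_ge0 // ltW.
  apply: (@le_trans _ _ (F * beta / 2 / h * (4 * W * vol) * (Cs * energy lam mu B))).
    rewrite ler_wpM2r ?mulr_ge0 ?(ltW Cs0) // ler_wpM2l // !mulr_ge0 ?invr_ge0 // ltW //.
  rewrite le_eqVlt; apply/orP; left; apply/eqP; rewrite /K3.
  by move: (h) (gt_eqF h0) => h' h'0; field; rewrite h'0.
Qed.

End ElementBounds.

(** * Facets and cells of a triangulation *)

Section MeshFacets.
Context {R : realType} {n : nat} (T : mesh R n.+1) (Omega : set 'cV[R]_n.+1).
Local Notation d := n.+1.
Local Notation face := {set 'I_(nvert T)}.
Local Notation label := 'I_(nelem T).
Local Notation ifacet := (@Defs.ifacet R d T).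
Local Notation bfacet := (@Defs.bfacet R d T).
Local Notation cell := (@Defs.cell R d T).
Hypothesis HT : triangulation T Omega.
Hypothesis d_gt1 : (1 < d)%N.

Lemma elt_inj : injective (elt T). Proof. by case: HT => -[]. Qed.

Lemma card_elt i : #|elt T i| = d.+1. Proof. by case: HT => -[_ /(_ i)[]]. Qed.

Lemma elt_bary i : exists c g, is_bary (vtx T) (elt T i) c g.
Proof. by case: HT => -[_ /(_ i)[c a]] _ _ _; exact: bary_exists. Qed.

Lemma csimplexI i j : csimplex (vtx T) (elt T i) `&` csimplex (vtx T) (elt T j) =
  csimplex (vtx T) (elt T i :&: elt T j).
Proof. by case: HT. Qed.

Lemma facet_vertex (S e : face) : #|S| = d.+1 -> e \subset S -> #|e| = d ->
  exists2 v, v \in S & e = S :\ v.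
Proof.
move=> cS eS ce; have : #|S :\: e| = 1%N.
  by rewrite cardsD (finset.setIidPr eS) cS ce subSnn.
move=> /eqP/cards1P[v vE]; have : v \in S :\: e by rewrite vE inE.
rewrite inE => /andP[ve vS]; exists v => //.
apply/eqP; rewrite eqEcard; apply/andP; split.
  apply/fintype.subsetP => w we; rewrite !inE (fintype.subsetP eS) // andbT.
  by apply: contraNneq ve => <-.
by have := cardsD1 v S; rewrite vS cS add1n ce => -[<-].
Qed.

Lemma card_facet i v : v \in elt T i -> #|elt T i :\ v| = d.
Proof. by move=> vi; have := cardsD1 v (elt T i); rewrite vi card_elt add1n => -[]. Qed.

(** Distinct elements share at most [d] vertices, since [elt] is injective. *)
Lemma eltI_facet i j (e : face) : i != j -> e \subset elt T i -> e \subset elt T j ->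
  #|e| = d -> elt T i :&: elt T j = e.
Proof.
move=> ij ei ej ce; apply/esym/eqP; rewrite eqEcard finset.subsetI ei ej ce /=.
rewrite leqNgt; apply/negP => lt; move/eqP: ij; apply; apply: elt_inj.
have Ei : elt T i :&: elt T j = elt T i.
  by apply/eqP; rewrite eqEcard finset.subsetIl card_elt.
apply/eqP; rewrite eqEcard !card_elt leqnn andbT.
by rewrite -Ei finset.subsetIr.
Qed.

Lemma ifacet_sym i j : ifacet i j = ifacet j i.
Proof. by rewrite /ifacet eq_sym finset.setIC. Qed.

Lemma onormal_neighbour i j (e : face) : ifacet i j -> e = elt T i :&: elt T j ->
  onormal (vtx T) (elt T j) e = - onormal (vtx T) (elt T i) e.
Proof.
move=> /andP[ij /eqP ce] eE.
have [c [g H]] := elt_bary i; have [c' [g' H']] := elt_bary j.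
have [v vi ei] := facet_vertex (card_elt i) (finset.subsetIl _ _) ce.
have [v' vj ej] := facet_vertex (card_elt j) (finset.subsetIr _ _) ce.
rewrite eE ei; apply: (onormal_opp d_gt1 (card_elt i) (card_elt j) H H' vi vj).
  by rewrite -ei.
by rewrite csimplexI ei.
Qed.

(** If three elements shared a facet, each two of their outer normals would be opposite, which
    forces a unit vector to be its own opposite. *)
Lemma neighbour_unique i j k : ifacet i j -> ifacet i k ->
  elt T i :&: elt T j = elt T i :&: elt T k -> j = k.
Proof.
move=> fij fik E; apply/eqP; apply: contraT => jk.
have /andP[_ /eqP ce] := fij.
have ej : elt T i :&: elt T j \subset elt T j by exact: finset.subsetIr.
have ek : elt T i :&: elt T j \subset elt T k by rewrite E finset.subsetIr.
have jkE := eltI_facet jk ej ek ce.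
have fjk : ifacet j k by rewrite /ifacet jk jkE ce eqxx.
have N1 := onormal_neighbour fij erefl.
have N2 := onormal_neighbour fik E.
have N3 := onormal_neighbour fjk (esym jkE).
have [c [g H]] := elt_bary i.
have [v vi ei] := facet_vertex (card_elt i) (finset.subsetIl _ (elt T j)) ce.
have [nu1 _ _] := onormalP (card_elt i) H (ltn0Sn _) vi.
move: N3 nu1; rewrite N1 N2 opprK -ei => /eqP; rewrite eq_sym -addr_eq0 => /eqP N3.
have -> : onormal (vtx T) (elt T i) (elt T i :&: elt T j) = 0.
  by apply/matrixP => a b; have /matrixP/(_ a b) := N3; rewrite !mxE; lra.
rewrite /enorm edotE big1 ?sqrtr0 => [/esym/eqP|? _]; first by rewrite oner_eq0.
by rewrite mxE mul0r.
Qed.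

Definition risum (F : label -> label -> face -> R) : R :=
  \sum_(i : label) \sum_(j : label | (j < i)%N && ifacet i j)
    F i j (elt T i :&: elt T j).

(** A facet of an element that is not on the boundary belongs to exactly one neighbour: existence is
    the negation of [bfacet], uniqueness is [neighbour_unique]. Summing over elements thus visits a
    boundary facet once and an interior facet from both sides; exchanging [i] and [j] brings the
    second visit into the order [j < i]. *)
Lemma sum_facets (F : label -> face -> R) :
  \sum_i \sum_(v in elt T i) F i (elt T i :\ v) =
  bsum (m := T) F + risum (fun i j e => F i e + F j e).
Proof.
have sumv i : \sum_(v in elt T i) F i (elt T i :\ v) =
    \sum_(e : face | (e \subset elt T i) && (#|e| == d)) F i e.
  rewrite -(big_imset (F i)) /=; last first.
    move=> v w vi wi /setP/(_ v); rewrite !inE eqxx vi andbT /=.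
    by case: eqP.
  apply: eq_bigl => e; apply/imsetP/andP => [[v vi ->]|[ei /eqP ce]].
    by rewrite subD1set card_facet.
  by have [v vi ->] := facet_vertex (card_elt i) ei ce; exists v.
under eq_bigr do rewrite sumv.
have splitb i : \sum_(e : face | (e \subset elt T i) && (#|e| == d)) F i e =
    \sum_(e : face | bfacet i e) F i e +
    \sum_(j | ifacet i j) F i (elt T i :&: elt T j).
  rewrite (bigID (bfacet i)) /=; congr (_ + _).
    apply: eq_bigl => e; rewrite /bfacet; case: (e \subset _) => //=.
    by case: (#|e| == d).
  rewrite -(big_imset (F i) (h := fun j => elt T i :&: elt T j) (A := ifacet i)) /=; last first.
    by move=> j k; rewrite !unfold_in; exact: neighbour_unique.
  apply: eq_bigl => e; apply/andP/imsetP.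
    case=> /andP[ei ce]; rewrite /bfacet ei ce /= => /forallPn[j].
    rewrite negb_imply negbK => /andP[ji ej]; exists j.
      by rewrite unfold_in /ifacet eq_sym ji (eltI_facet _ ei ej (eqP ce)) // eq_sym.
    by rewrite (eltI_facet _ ei ej (eqP ce)) // eq_sym.
  move=> [j]; rewrite unfold_in => /andP[ij ce] ->; rewrite ce finset.subsetIl; split => //.
  apply/negP => /and3P[_ _ /forallP/(_ j)].
  by rewrite eq_sym ij finset.subsetIr.
under eq_bigr do rewrite splitb.
rewrite big_split /=; congr (_ + _).
rewrite /risum; under [RHS]eq_bigr do rewrite big_split /=.
rewrite big_split /=.
have -> : \sum_(i : label) \sum_(j : label | (j < i)%N && ifacet i j)
    F j (elt T i :&: elt T j) =
    \sum_(i : label) \sum_(j : label | (i < j)%N && ifacet i j) F i (elt T i :&: elt T j).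
  rewrite (exchange_big_dep xpredT) //=; apply: eq_bigr => i _; apply: eq_big => [j|j _].
    by rewrite ifacet_sym.
  by rewrite finset.setIC.
rewrite -big_split; apply: eq_bigr => i _ /=.
rewrite (bigID (fun j : label => (j < i)%N)) /=; congr (_ + _).
  by apply: eq_bigl => j; rewrite andbC.
apply: eq_bigl => j; rewrite -leqNgt leq_eqVlt.
have [->|ij] := eqVneq i j; first by rewrite /Defs.ifacet eqxx /= andbF.
have -> : (val i == val j) = false by rewrite (inj_eq val_inj) (negbTE ij).
by rewrite /= andbC.
Qed.

(** In the open cell all barycentric coordinates are positive, whereas on a proper face one of them
    vanishes. *)
Lemma cell_csimplex i (e : face) x : cell i x -> csimplex (vtx T) e x ->
  e \subset elt T i -> e = elt T i.
Proof.
move=> ci ex ei; have [c [g H]] := elt_bary i.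
apply/eqP; rewrite finset.eqEsubset ei /=; apply/fintype.subsetP => v vi.
apply: contraT => ve; have := (osimplex_lam H _).1 ci v vi.
by have [_ /(_ v vi ve) ->] := (csimplex_lam H _ ei).1 ex; rewrite ltxx.
Qed.

Lemma cell_disjoint i j x : cell i x -> cell j x -> i = j.
Proof.
move=> ci cj; apply: elt_inj.
have xI : csimplex (vtx T) (elt T i :&: elt T j) x.
  by rewrite -csimplexI; split; exact: osimplex_sub.
rewrite -(cell_csimplex ci xI) ?finset.subsetIl //.
by rewrite -{2}(cell_csimplex cj xI) ?finset.subsetIr.
Qed.

(** A point of a cell lies in the closure of [Omega]; outside [Omega] it would be on the frontier,
    hence on a boundary facet, which an open cell does not meet. *)
Lemma cell_sub_Omega i : cell i `<=` Omega.
Proof.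
move=> x ci; apply: contrapT => nO; case: HT => _ _ HC HF.
have cx : csimplex (vtx T) (elt T i) x by exact: osimplex_sub.
have : frontier Omega x.
  split; last by apply: subset_closure.
  by rewrite HC; exists i.
rewrite HF => -[[j e] /= /and3P[ej /eqP ce _] ex].
have xj : csimplex (vtx T) (elt T j) x by exact: csimplex_subset ex.
have xI : csimplex (vtx T) (elt T i :&: elt T j) x by rewrite -csimplexI.
have ij : i = j.
  apply: elt_inj; apply/eqP; rewrite eqEcard !card_elt leqnn andbT.
  by rewrite -(cell_csimplex ci xI) ?finset.subsetIl // finset.subsetIr.
rewrite -ij in ej; have E := cell_csimplex ci ex ej.
by move: ce; rewrite E card_elt => /eqP; rewrite -addn1 -[X in _ == X]addn0 eqn_add2l.
Qed.

Lemma tame_set_cell i : tame_set (cell i).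
Proof. by have [c [g H]] := elt_bary i; exact: tame_set_osimplex H. Qed.

(** An open set is its closure minus its frontier, and a triangulation presents both as finite
    unions of closed simplices. *)
Lemma measurable_Omega : open Omega -> measurable (@colv R d @^-1` Omega).
Proof.
move=> oO; case: HT => _ _ HC HF.
have -> : Omega = closure Omega `\` frontier Omega.
  apply/seteqP; split=> x.
    move=> Ox; split; first exact: subset_closure.
    move=> [_]; rewrite -(proj1 (closure_id _)); last exact: open_closedC.
    by apply.
  by case=> cx nf; apply: contrapT => nO; apply: nf; split => //; exact: subset_closure.
rewrite HC HF; set A := \bigcup_i _; set B := \bigcup_(_ in _) _.
apply: (@measurableD _ _ (@colv R d @^-1` A) (@colv R d @^-1` B)).
  rewrite /A preimage_bigcup; apply: fin_bigcup_measurable => // i _.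
  by have [c [g H]] := elt_bary i; exact: (measurable_csimplex H).
rewrite /B preimage_bigcup; apply: fin_bigcup_measurable => // -[i e] /= /and3P[ei _ _].
by have [c [g H]] := elt_bary i; exact: (measurable_csimplex H).
Qed.

End MeshFacets.

(** * Square-integrable fields and weighted Young inequalities *)

Section SquareIntegrable.
Context {R : realType}.
Local Notation C := R[i].

(** Common ground for the data, which are only in L2, and for the discrete fields, which are
    bounded. *)
Definition square_integrable m n (D : set 'cV[R]_m) (F : 'cV[R]_m -> 'cV[C]_n) : Prop :=
  (forall k,
     measurable_fun (@colv R m @^-1` D) (fun t => complex.Re (F (colv t) k 0)) /\
     measurable_fun (@colv R m @^-1` D) (fun t => complex.Im (F (colv t) k 0))) /\
  vintegrable D (fun x => sqnorm (F x)).

Lemma measurable_Re_hdot m n (D : set 'cV[R]_m) (F G : 'cV[R]_m -> 'cV[C]_n) :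
  square_integrable D F -> square_integrable D G ->
  measurable_fun (@colv R m @^-1` D) (fun t => rdot (F (colv t)) (G (colv t))).
Proof.
move=> [mF _] [mG _]; under eq_fun do rewrite rdotE.
apply: measurable_sum => k; under eq_fun do rewrite big_ord1.
apply: measurable_funD; apply: measurable_funM;
  [exact: (mF k).1|exact: (mG k).1|exact: (mF k).2|exact: (mG k).2].
Qed.

Lemma measurable_Im_hdot m n (D : set 'cV[R]_m) (F G : 'cV[R]_m -> 'cV[C]_n) :
  square_integrable D F -> square_integrable D G ->
  measurable_fun (@colv R m @^-1` D) (fun t => complex.Im (hdot (F (colv t)) (G (colv t)))).
Proof.
move=> [mF _] [mG _]; under eq_fun do rewrite ImhdotE.
apply: measurable_sum => k; under eq_fun do rewrite big_ord1.
apply: measurable_funB; apply: measurable_funM;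
  [exact: (mF k).2|exact: (mG k).1|exact: (mF k).1|exact: (mG k).2].
Qed.

Lemma vtame_square_integrable m n (D : set 'cV[R]_m) (F : 'cV[R]_m -> 'cV[C]_n) :
  tame_set D -> vtame D F -> square_integrable D F.
Proof.
move=> tD tF; split.
  by move=> k; split; [exact: (tF k).1.1|exact: (tF k).2.1].
by apply: tame_vintegrable => //; exact: tame_sqnorm.
Qed.

Lemma inL2_square_integrable n p (D : set 'cV[R]_n) (F : 'cV[R]_n -> 'cV[C]_p) :
  tame_set D -> inL2 D F -> square_integrable D F.
Proof.
move=> tD [mF fF]; split => //; apply/integrableP; split.
  apply/measurable_EFinP.
  have E : (fun t => sqnorm (F (colv t))) = (fun t => \sum_k
      (complex.Re (F (colv t) k 0) * complex.Re (F (colv t) k 0) +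
       complex.Im (F (colv t) k 0) * complex.Im (F (colv t) k 0))).
    apply/funext => t; rewrite /sqnorm; apply: eq_bigr => k _.
    by rewrite big_ord1 /sqabs !expr2.
  rewrite /comp E; apply: measurable_sum => k.
  apply: measurable_funD; apply: measurable_funM;
    [exact: (mF k).1|exact: (mF k).1|exact: (mF k).2|exact: (mF k).2].
apply: le_lt_trans fF; rewrite le_eqVlt; apply/orP; left; apply/eqP.
apply: eq_integral => t _; rewrite /= ger0_norm //; exact: sqnorm_ge0.
Qed.

(** Domination by [a + b]; meant for pairings of L2 fields, which need not be bounded. *)
Lemma young_integrable m (D : set 'cV[R]_m) (f a b : 'cV[R]_m -> R) : tame_set D ->
  measurable_fun (@colv R m @^-1` D) (fun t => f (colv t)) ->
  vintegrable D a -> vintegrable D b ->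
  (forall x, 0 <= a x) -> (forall x, 0 <= b x) ->
  (forall x, 2 * `|f x| <= a x + b x) -> vintegrable D f.
Proof.
move=> [mD _] mf ia ib a0 b0 h.
have iab : vintegrable D (fun x => a x + b x) by exact: (integrableD mD ia ib).
apply: (le_integrable mD _ _ iab); first exact/measurable_EFinP.
move=> t _ /=; rewrite lee_fin [leRHS]ger0_norm ?addr_ge0 //.
have := h (colv t); have := normr_ge0 (f (colv t)); lra.
Qed.

Lemma Re_hdot_young_abs m n (F G : 'M[C]_(m, n)) (s : R) : 0 < s ->
  2 * `|rdot F G| <= s * sqnorm F + sqnorm G / s.
Proof.
move=> s0; case: (ger0P (rdot F G)) => _; first exact: Re_hdot_young.
by rewrite -rdotNl -(sqnormN F); exact: Re_hdot_young.
Qed.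

Lemma Im_hdot_young_abs m n (F G : 'M[C]_(m, n)) (s : R) : 0 < s ->
  2 * `|complex.Im (hdot F G)| <= s * sqnorm F + sqnorm G / s.
Proof.
move=> s0; case: (ger0P (complex.Im (hdot F G))) => _; first exact: Im_hdot_young.
have -> : - complex.Im (hdot F G) = complex.Im (hdot (- F) G).
  by rewrite -ImN -[- F]scaleN1r hdotZl mulN1r.
by rewrite -(sqnormN F); exact: Im_hdot_young.
Qed.

Lemma rdot_integrable m n (D : set 'cV[R]_m) (F G : 'cV[R]_m -> 'cV[C]_n) : tame_set D ->
  square_integrable D F -> square_integrable D G ->
  vintegrable D (fun x => rdot (F x) (G x)).
Proof.
move=> tD sF sG.
apply: (young_integrable tD (measurable_Re_hdot sF sG) sF.2 sG.2) => x; try exact: sqnorm_ge0.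
by have := Re_hdot_young_abs (F x) (G x) ltr01; rewrite mul1r divr1.
Qed.

Lemma Imhdot_integrable m n (D : set 'cV[R]_m) (F G : 'cV[R]_m -> 'cV[C]_n) : tame_set D ->
  square_integrable D F -> square_integrable D G ->
  vintegrable D (fun x => complex.Im (hdot (F x) (G x))).
Proof.
move=> tD sF sG.
apply: (young_integrable tD (measurable_Im_hdot sF sG) sF.2 sG.2) => x; try exact: sqnorm_ge0.
by have := Im_hdot_young_abs (F x) (G x) ltr01; rewrite mul1r divr1.
Qed.

(** The pointwise inequality is integrated for both signs. It keeps a weight [s], unlike
    Cauchy-Schwarz, so that the weights can be chosen at the end. *)
Lemma vint_abs_le m (D : set 'cV[R]_m) (f a b : 'cV[R]_m -> R) (s : R) : tame_set D ->
  vintegrable D f -> vintegrable D a -> vintegrable D b ->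
  (forall x, 2 * `|f x| <= s * a x + b x / s) ->
  2 * `|vint D f| <= s * vint D a + vint D b / s.
Proof.
move=> tD jf ja jb h; have [mD _] := tD.
have isa : vintegrable D (fun x => s * a x) by exact: (integrableZl mD s ja).
have isb : vintegrable D (fun x => s^-1 * b x) by exact: (integrableZl mD s^-1 jb).
have jf2 : vintegrable D (fun x => 2 * f x) by exact: (integrableZl mD 2 jf).
have jf2n : vintegrable D (fun x => -2 * f x) by exact: (integrableZl mD (-2) jf).
have iab : vintegrable D (fun x => s * a x + s^-1 * b x) by exact: (integrableD mD isa isb).
have -> : s * vint D a + vint D b / s = vint D (fun x => s * a x + s^-1 * b x).
  by rewrite vintD // !vintZ // [vint D b / s]mulrC.
have h1 x : - (s * a x + s^-1 * b x) <= 2 * f x <= s * a x + s^-1 * b x.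
  rewrite -ler_norml normrM ger0_norm // [s^-1 * _]mulrC; exact: h.
have u1 : 2 * vint D f <= vint D (fun x => s * a x + s^-1 * b x).
  rewrite -vintZ //; apply: vint_le => // x _; by case/andP: (h1 x).
have u2 : -2 * vint D f <= vint D (fun x => s * a x + s^-1 * b x).
  rewrite -vintZ //; apply: vint_le => // x _; rewrite mulNr lerNl; by case/andP: (h1 x).
by case: (ger0P (vint D f)) => _ //; rewrite mulrN -mulNr.
Qed.

Lemma vint_rdot_young m n (D : set 'cV[R]_m) (F G : 'cV[R]_m -> 'cV[C]_n) (s : R) :
  tame_set D -> square_integrable D F -> square_integrable D G -> 0 < s ->
  2 * `|vint D (fun x => rdot (F x) (G x))| <=
  s * vint D (fun x => sqnorm (F x)) + vint D (fun x => sqnorm (G x)) / s.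
Proof.
move=> tD sF sG s0; apply: vint_abs_le sF.2 sG.2 _ => //; first exact: rdot_integrable.
by move=> x; exact: Re_hdot_young_abs.
Qed.

Lemma vint_Imhdot_young m n (D : set 'cV[R]_m) (F G : 'cV[R]_m -> 'cV[C]_n) (s : R) :
  tame_set D -> square_integrable D F -> square_integrable D G -> 0 < s ->
  2 * `|vint D (fun x => complex.Im (hdot (F x) (G x)))| <=
  s * vint D (fun x => sqnorm (F x)) + vint D (fun x => sqnorm (G x)) / s.
Proof.
move=> tD sF sG s0; apply: vint_abs_le sF.2 sG.2 _ => //; first exact: Imhdot_integrable.
by move=> x; exact: Im_hdot_young_abs.
Qed.

Section Face.
Context {d : nat} {V : finType} (p : V -> 'cV[R]_d).

Definition face_square_integrable (e : {set V}) n (F : 'cV[R]_d -> 'cV[C]_n) : Prop :=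
  square_integrable (@ref_simplex R d.-1) (F \o fparam p e).

Lemma affine_face_square_integrable e n (F : 'cV[R]_d -> 'cV[C]_n) :
  affine_field F -> face_square_integrable e F.
Proof.
move=> aF; apply: vtame_square_integrable; first exact: tame_set_ref.
exact: svtame_aff.
Qed.

Lemma sint_rdot_young e n (F G : 'cV[R]_d -> 'cV[C]_n) (s : R) :
  face_square_integrable e F -> face_square_integrable e G -> 0 < s ->
  2 * `|sint p e (fun x => rdot (F x) (G x))| <=
  s * sint p e (fun x => sqnorm (F x)) + sint p e (fun x => sqnorm (G x)) / s.
Proof.
move=> sF sG s0; have := vint_rdot_young (@tame_set_ref R d.-1) sF sG s0.
move/(ler_wpM2l (fdensity_ge0 p e)).
have R3 (a b c f : R) : 2 * (f * a) = f * (2 * a) /\ s * (f * b) + f * c / s = f * (s * b + c / s).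
  by split; ring.
rewrite /sint normrM (ger0_norm (fdensity_ge0 p e)) (R3 _ 0 0 _).1 (R3 0 _ _ _).2.
by apply.
Qed.

Lemma sint_Imhdot_young e n (F G : 'cV[R]_d -> 'cV[C]_n) (s : R) :
  face_square_integrable e F -> face_square_integrable e G -> 0 < s ->
  2 * `|sint p e (fun x => complex.Im (hdot (F x) (G x)))| <=
  s * sint p e (fun x => sqnorm (F x)) + sint p e (fun x => sqnorm (G x)) / s.
Proof.
move=> sF sG s0; have := vint_Imhdot_young (@tame_set_ref R d.-1) sF sG s0.
move/(ler_wpM2l (fdensity_ge0 p e)).
have R3 (a b c f : R) : 2 * (f * a) = f * (2 * a) /\ s * (f * b) + f * c / s = f * (s * b + c / s).
  by split; ring.
rewrite /sint normrM (ger0_norm (fdensity_ge0 p e)) (R3 _ 0 0 _).1 (R3 0 _ _ _).2.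
by apply.
Qed.

End Face.
End SquareIntegrable.

(** * Discrete fields as functions on the domain *)

Section BrokenFields.
Context {R : realType} {n : nat} (T : mesh R n.+1) (Omega : set 'cV[R]_n.+1).
Local Notation d := n.+1.
Local Notation C := R[i].
Local Notation label := 'I_(nelem T).
Local Notation cell := (@Defs.cell R d T).
Hypotheses (HT : triangulation T Omega) (oO : open Omega).

Lemma tame_set_Omega : tame_set Omega.
Proof.
split; first exact: measurable_Omega HT oO.
have /choice[M HM] : forall i : label, exists M : R,
    forall x, csimplex (vtx T) (elt T i) x -> forall k, `|x k 0| <= M.
  by move=> i; exact: coord_bounded_csimplex.
exists (\sum_i `|M i|) => x Ox k.
case: HT => _ _ HC _; have : closure Omega x by exact: subset_closure.
rewrite HC => -[i _ xi]; apply: le_trans (HM i x xi k) _.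
by rewrite (bigD1 i) //= ler_wpDr ?sumr_ge0 // ler_norm.
Qed.

(** [broken_fun] sums over an index set that depends on the point; with indicators of the cells it
    becomes a fixed finite sum of tame functions. *)
Definition cell_ind (i : label) (x : 'cV[R]_d) : R := (`[< cell i x >])%:R.

Lemma tame_cell_ind i : tame Omega (cell_ind i).
Proof.
split.
  apply: measurable_funTS.
  have -> : cell_ind i \o @colv R d = \1_(@colv R d @^-1` cell i).
    apply/funext => t; rewrite /cell_ind /= indicE.
    by case: asboolP => ci; [rewrite mem_set | rewrite memNset].
  by apply: measurable_indic; case: (tame_set_cell HT i).
by exists 1 => x _; rewrite /cell_ind; case: asboolP => _; rewrite ?normr1 ?normr0.
Qed.

Implicit Types (u : broken T).

Lemma broken_funE u i x : cell i x -> broken_fun u x = u i x.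
Proof.
move=> ci; rewrite /broken_fun (big_pred1 i) // => j /=.
by apply/asboolP/eqP => [cj|->//]; exact: (cell_disjoint HT cj ci).
Qed.

Lemma broken_fun0 u x : (forall i, ~ cell i x) -> broken_fun u x = 0.
Proof. by move=> nc; rewrite /broken_fun big_pred0 // => i; apply/asboolP; exact: nc. Qed.

Lemma sum_cell_ind (F : label -> R) i x : cell i x -> \sum_j cell_ind j x * F j = F i.
Proof.
move=> ci; rewrite (bigD1 i) //= /cell_ind asboolT // mul1r big1 ?addr0 // => j ji.
rewrite asboolF ?mul0r // => cj; move/eqP: ji; apply; exact: (cell_disjoint HT cj ci).
Qed.

Lemma sum_cell_ind0 (F : label -> R) x : (forall i, ~ cell i x) ->
  \sum_j cell_ind j x * F j = 0.
Proof. by move=> nc; rewrite big1 // => j _; rewrite /cell_ind asboolF ?mul0r. Qed.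

Lemma vtame_broken u : inVh u -> vtame Omega (broken_fun u).
Proof.
move=> uV k; have tO := tame_set_Omega.
have tu i := vtame_aff tO.2 (uV i).
split.
  apply: (@tame_ext _ _ _ (fun x => \sum_i cell_ind i x * complex.Re (u i x k 0))).
    move=> x; have [[i ci]|nc] := pselect (exists i, cell i x).
      by rewrite (sum_cell_ind _ ci) (broken_funE u ci).
    have nc' i : ~ cell i x by move=> ci; apply: nc; exists i.
    by rewrite sum_cell_ind0 // broken_fun0 // mxE.
  by apply: tame_sum => i _; apply: tameM; [exact: tame_cell_ind|exact: (tu i k).1].
apply: (@tame_ext _ _ _ (fun x => \sum_i cell_ind i x * complex.Im (u i x k 0))).
  move=> x; have [[i ci]|nc] := pselect (exists i, cell i x).
    by rewrite (sum_cell_ind _ ci) (broken_funE u ci).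
  have nc' i : ~ cell i x by move=> ci; apply: nc; exists i.
  by rewrite sum_cell_ind0 // broken_fun0 // mxE.
by apply: tame_sum => i _; apply: tameM; [exact: tame_cell_ind|exact: (tu i k).2].
Qed.

(** Off the cells [broken_fun] is zero by definition, so on [Omega] its square equals the sum of the
    squares cut off by [cell_ind]. Each summand can only grow when its domain is enlarged from the
    cell to [Omega]. *)
Lemma sum_cells_le u : inVh u ->
  \sum_i vint (cell i) (fun x => sqnorm (u i x)) <= normsq_Omega Omega (broken_fun u).
Proof.
move=> uV; have tO := tame_set_Omega.
have tu i : tame Omega (fun x => cell_ind i x * sqnorm (u i x)).
  apply: tameM; first exact: tame_cell_ind.
  by apply: tame_sqnorm; exact: (vtame_aff tO.2 (uV i)).
have -> : normsq_Omega Omega (broken_fun u) =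
    vint Omega (fun x => \sum_i cell_ind i x * sqnorm (u i x)).
  apply: eq_vint => x _; have [[i ci]|nc] := pselect (exists i, cell i x).
    by rewrite (sum_cell_ind _ ci) (broken_funE u ci).
  have nc' i : ~ cell i x by move=> ci; apply: nc; exists i.
  rewrite sum_cell_ind0 // broken_fun0 //.
  by rewrite /sqnorm big1 // => k _; rewrite big1 // => l _; rewrite mxE /sqabs /= !expr0n addr0.
rewrite vint_sum //; apply: ler_sum => i _.
have -> : vint (cell i) (fun x => sqnorm (u i x)) =
    vint (cell i) (fun x => cell_ind i x * sqnorm (u i x)).
  by apply: eq_vint => x ci; rewrite /cell_ind asboolT // mul1r.
apply: vint_subset => //.
- exact: tame_set_cell HT i.
- by move=> x; exact: (cell_sub_Omega HT).
- exact: tame_vintegrable.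
- by move=> x _; rewrite mulr_ge0 ?sqnorm_ge0 // /cell_ind ler0n.
Qed.

End BrokenFields.

(** * Energy identities and stability *)

Section EnergyIdentities.
Context {R : realType} {n : nat} (T : mesh R n.+1) (Omega : set 'cV[R]_n.+1).
Local Notation d := n.+1.
Local Notation C := R[i].
Local Notation label := 'I_(nelem T).
Local Notation face := {set 'I_(nvert T)}.
Local Notation cell := (@Defs.cell R d T).
Local Notation ifacet := (@Defs.ifacet R d T).
Local Notation bfacet := (@Defs.bfacet R d T).

Lemma ReIm_ext (z w : C) : complex.Re z = complex.Re w -> complex.Im z = complex.Im w -> z = w.
Proof. by case: z w => a b [c e] /= -> ->. Qed.

Lemma ImC (a : R) (z : C) : complex.Im (a%:C * z) = a * complex.Im z.
Proof. by case: z => x y /=; rewrite mul0r addr0. Qed.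

Lemma Re_mulic (z : C) : complex.Re ('i * z) = - complex.Im z.
Proof. by case: z => x y /=; rewrite mul0r mul1r sub0r. Qed.

Lemma Im_mulic (z : C) : complex.Im ('i * z) = complex.Re z.
Proof. by case: z => x y /=; rewrite mul0r mul1r add0r. Qed.

Lemma Re_isum (F : label -> label -> face -> C) :
  complex.Re (isum F) = risum (T := T) (fun i j e => complex.Re (F i j e)).
Proof. by rewrite /isum Re_sum; apply: eq_bigr => i _; rewrite Re_sum. Qed.

Lemma Im_isum (F : label -> label -> face -> C) :
  complex.Im (isum F) = risum (T := T) (fun i j e => complex.Im (F i j e)).
Proof. by rewrite /isum Im_sum; apply: eq_bigr => i _; rewrite Im_sum. Qed.

Lemma Re_bsum (F : label -> face -> C) :
  complex.Re (bsum F) = bsum (m := T) (fun i e => complex.Re (F i e)).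
Proof. by rewrite /bsum Re_sum; apply: eq_bigr => i _; rewrite Re_sum. Qed.

Lemma Im_bsum (F : label -> face -> C) :
  complex.Im (bsum F) = bsum (m := T) (fun i e => complex.Im (F i e)).
Proof. by rewrite /bsum Im_sum; apply: eq_bigr => i _; rewrite Im_sum. Qed.

Lemma risumD (F G : label -> label -> face -> R) :
  risum (T := T) (fun i j e => F i j e + G i j e) = risum F + risum G.
Proof. by rewrite /risum -big_split; apply: eq_bigr => i _; rewrite -big_split. Qed.

Lemma risumZ a (F : label -> label -> face -> R) :
  risum (T := T) (fun i j e => a * F i j e) = a * risum F.
Proof. by rewrite /risum mulr_sumr; apply: eq_bigr => i _; rewrite mulr_sumr. Qed.

Lemma risum_le (F G : label -> label -> face -> R) :
  (forall i j e, ifacet i j -> e = elt T i :&: elt T j -> F i j e <= G i j e) ->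
  risum (T := T) F <= risum G.
Proof.
move=> h; apply: ler_sum => i _; apply: ler_sum => j /andP[_ ij]; exact: h.
Qed.

Lemma eq_risum (F G : label -> label -> face -> R) :
  (forall i j e, ifacet i j -> e = elt T i :&: elt T j -> F i j e = G i j e) ->
  risum (T := T) F = risum G.
Proof.
by move=> h; apply: eq_bigr => i _; apply: eq_bigr => j /andP[_ ij]; exact: h.
Qed.

Lemma risum_ge0 (F : label -> label -> face -> R) :
  (forall i j e, ifacet i j -> e = elt T i :&: elt T j -> 0 <= F i j e) ->
  0 <= risum (T := T) F.
Proof.
by move=> h; apply: sumr_ge0 => i _; apply: sumr_ge0 => j /andP[_ ij]; exact: h.
Qed.

Lemma bsumD (F G : label -> face -> R) :
  bsum (m := T) (fun i e => F i e + G i e) = bsum F + bsum G.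
Proof. by rewrite /bsum -big_split; apply: eq_bigr => i _; rewrite -big_split. Qed.

Lemma bsumZ a (F : label -> face -> R) :
  bsum (m := T) (fun i e => a * F i e) = a * bsum F.
Proof. by rewrite /bsum mulr_sumr; apply: eq_bigr => i _; rewrite mulr_sumr. Qed.

Lemma bsum_le (F G : label -> face -> R) :
  (forall i e, bfacet i e -> F i e <= G i e) -> bsum (m := T) F <= bsum G.
Proof. by move=> h; apply: ler_sum => i _; apply: ler_sum => e ie; exact: h. Qed.

Lemma bsum_ge0 (F : label -> face -> R) :
  (forall i e, bfacet i e -> 0 <= F i e) -> 0 <= bsum (m := T) F.
Proof. by move=> h; apply: sumr_ge0 => i _; apply: sumr_ge0 => e ie; exact: h. Qed.

Variables (u : broken T) (b : label -> 'cV[C]_d) (B : label -> 'M[C]_d).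
Hypothesis uE : forall i x, u i x = b i + B i *m cplxmx x.

Lemma u_affine i : affine_field (u i).
Proof. by exists (b i), (B i). Qed.

Section Stress.
Variables (lam mu : R).

(** The stress is constant on an element, so the traction is a constant vector. The normal is that
    of [i] even when the stress is that of a neighbour [k], as jumps and averages require. *)
Definition tr_vec (i k : label) (e : face) : 'cV[C]_d :=
  sig_of lam mu (B k) *m cplxmx (onormal (vtx T) (elt T i) e).

Lemma divg_u i x : divg (u i) x = \tr (B i).
Proof. by rewrite /divg (grad_P1 (uE i)). Qed.

Lemma strain_u i x : strain (u i) x = eps_of (B i).
Proof. by rewrite /strain (grad_P1 (uE i)). Qed.

Lemma traction_u e i k x : traction lam mu e i u k x = tr_vec i k e.
Proof. by rewrite /traction /stress strain_u divg_u. Qed.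

Definition elt_energy (i : label) : R :=
  vint (cell i) (fun=> 1) * energy lam mu (B i).

Lemma semi1h_sqE : triangulation T Omega -> semi1h_sq lam mu u = \sum_i elt_energy i.
Proof.
move=> HT; apply: eq_bigr => i _; have tC := tame_set_cell HT i.
under [X in lam * vint _ X]eq_fun do rewrite divg_u.
under [X in 2 * mu * vint _ X]eq_fun do rewrite strain_u.
rewrite vint_cst // [vint _ (fun=> sqnorm _)]vint_cst // /elt_energy /energy.
by move: (vint _ _) => w; ring.
Qed.

(** [flux_jump] is the consistency term of [bh], whereas [jumpflux_avg] and [flux_trace] arise only
    from Green's formula. *)
Definition flux_jump i j e : R :=
  sint (vtx T) e (fun x => rdot (2^-1 *: (tr_vec i i e + tr_vec i j e)) (u i x - u j x)).

Definition jumpflux_avg i j e : R :=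
  sint (vtx T) e (fun x => rdot (tr_vec i i e - tr_vec i j e) (2^-1 *: (u i x + u j x))).

Definition flux_trace i e : R :=
  sint (vtx T) e (fun x => rdot (tr_vec i i e) (u i x)).

Definition jump_sq i j e : R := sint (vtx T) e (fun x => sqnorm (u i x - u j x)).

Definition jumpflux_sq i j e : R :=
  sint (vtx T) e (fun=> sqnorm (tr_vec i i e - tr_vec i j e)).

Lemma face_si_cst e (w : 'cV[C]_d) : face_square_integrable (vtx T) e (fun=> w).
Proof. by apply: affine_face_square_integrable; exact: affine_field_cst. Qed.

Lemma face_si_u e i : face_square_integrable (vtx T) e (u i).
Proof. by apply: affine_face_square_integrable; exact: u_affine. Qed.

Lemma face_si_jump e i j : face_square_integrable (vtx T) e (fun x => u i x - u j x).
Proof. by apply: affine_face_square_integrable; apply: affine_fieldB; exact: u_affine. Qed.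

Lemma face_si_avg e i j : face_square_integrable (vtx T) e (fun x => 2^-1 *: (u i x + u j x)).
Proof.
apply: affine_face_square_integrable; apply: affine_fieldZ.
by apply: affine_fieldD; exact: u_affine.
Qed.

Lemma sint_rdot_integrable e m (F G : 'cV[R]_d -> 'cV[C]_m) :
  face_square_integrable (vtx T) e F -> face_square_integrable (vtx T) e G ->
  sintegrable (vtx T) e (fun x => rdot (F x) (G x)).
Proof. by move=> sF sG; apply: (rdot_integrable _ sF sG); exact: tame_set_ref. Qed.

Lemma Im_sinner_sym e (F G : 'cV[R]_d -> 'cV[C]_d) :
  face_square_integrable (vtx T) e F -> face_square_integrable (vtx T) e G ->
  complex.Im (sinner (m := T) e F G) + complex.Im (sinner (m := T) e G F) = 0.
Proof.
move=> sF sG; rewrite !Im_sinner.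
have -> : (fun x => complex.Im (hdot (G x) (F x))) = (fun x => - complex.Im (hdot (F x) (G x))).
  by apply/funext => x; rewrite hdotC Im_conjc.
rewrite sintN ?addrN //.
by apply: (Imhdot_integrable _ sF sG); exact: tame_set_ref.
Qed.

Lemma Re_sinner_diag e (F : 'cV[R]_d -> 'cV[C]_d) :
  complex.Re (sinner (m := T) e F F) = sint (vtx T) e (fun x => sqnorm (F x)).
Proof. by rewrite Re_sinner; under eq_fun do rewrite -sqnormE. Qed.

Lemma Im_sinner_diag e (F : 'cV[R]_d -> 'cV[C]_d) : complex.Im (sinner (m := T) e F F) = 0.
Proof.
rewrite Im_sinner; under eq_fun do rewrite Im_hdot_diag.
by rewrite sint_cst mulr0 mul0r.
Qed.

Lemma jump_traction e i j : jump (traction lam mu e i u) i j = fun=> tr_vec i i e - tr_vec i j e.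
Proof. by apply/funext => x; rewrite /jump !traction_u. Qed.

Lemma average_traction e i j :
  average (traction lam mu e i u) i j = fun=> 2^-1 *: (tr_vec i i e + tr_vec i j e).
Proof. by apply/funext => x; rewrite /average !traction_u. Qed.

(** On the diagonal the two consistency terms are conjugate: their real parts agree and their
    imaginary parts cancel. The imaginary part of [Ah] therefore stems from the penalties and the
    impedance term alone. *)
Lemma bh_diag : bh lam mu u u = (semi1h_sq lam mu u - 2 * risum flux_jump)%:C.
Proof.
have two : (2 * mu%:C : C) = (2 * mu)%:C by rewrite rmorphM rmorph_nat.
apply: ReIm_ext; rewrite /bh two.
  rewrite ReD ReN Re_sum Re_isum [RHS]/= -risumZ; congr (_ - _).
    apply: eq_bigr => i _; rewrite ReD !ReC; congr (_ * _ + _ * _).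
      by apply: eq_vint => x _; rewrite Re_mul_conj.
    by apply: eq_vint => x _; rewrite -[LHS]/(rdot _ _) -sqnormE.
  apply: eq_risum => i j e _ _; rewrite ReD !Re_sinner average_traction.
  under [X in _ + sint _ _ X]eq_fun do rewrite rdotC.
  by rewrite [RHS]mulr_natl mulr2n.
have I2 : risum (T := T) (fun i j e => complex.Im
    (sinner e (average (traction lam mu e i u) i j) (jump u i j) +
     sinner e (jump u i j) (average (traction lam mu e i u) i j))) = 0.
  rewrite /risum big1 // => i _; rewrite big1 // => j _.
  rewrite ImD average_traction; apply: Im_sinner_sym; first exact: face_si_cst.
  exact: face_si_jump.
have I1 i : complex.Im (lam%:C * vintC (cell i) (fun x => divg (u i) x * (divg (u i) x)^*) +
    (2 * mu)%:C * vintC (cell i) (fun x => hdot (strain (u i) x) (strain (u i) x))) = 0.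
  rewrite ImD !ImC.
  have -> : complex.Im (vintC (cell i) (fun x => divg (u i) x * (divg (u i) x)^*)) = 0.
    by rewrite -[RHS](vint0 (cell i)); apply: eq_vint => x _; rewrite Im_mul_conj.
  have -> : complex.Im (vintC (cell i) (fun x => hdot (strain (u i) x) (strain (u i) x))) = 0.
    by rewrite -[RHS](vint0 (cell i)); apply: eq_vint => x _; rewrite Im_hdot_diag.
  by rewrite !mulr0 addr0.
rewrite ImD ImN Im_sum Im_isum I2 subr0 [RHS]/=.
by apply: big1 => i _; exact: I1.
Qed.

Lemma J0_diag gam0 : J0 gam0 u u =
  (risum (fun i j e => gam0 e / size_facet e * jump_sq i j e))%:C.
Proof.
apply: ReIm_ext; rewrite /J0 ?Re_isum ?Im_isum [RHS]/=.
  by apply: eq_risum => i j e _ _; rewrite ReC Re_sinner_diag.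
rewrite /risum big1 // => i _; rewrite big1 // => j _.
by rewrite ImC Im_sinner_diag mulr0.
Qed.

Lemma J1_diag gam1 : J1 lam mu gam1 u u =
  (risum (fun i j e => gam1 e * size_facet e * jumpflux_sq i j e))%:C.
Proof.
apply: ReIm_ext; rewrite /J1 ?Re_isum ?Im_isum [RHS]/=.
  apply: eq_risum => i j e _ _; rewrite ReC Re_sinner_diag jump_traction //.
rewrite /risum big1 // => i _; rewrite big1 // => j _.
by rewrite ImC Im_sinner_diag mulr0.
Qed.

End Stress.

Definition impedance (A : 'M[R]_d) : R :=
  bsum (m := T) (fun i e => sint (vtx T) e (fun x => rdot (cplxmx A *m u i x) (u i x))).

Lemma Im_hdot_sym (A : 'M[R]_d) (z : 'cV[C]_d) : A^T = A ->
  complex.Im (hdot (cplxmx A *m z) z) = 0.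
Proof.
move=> AT; suff E : hdot (cplxmx A *m z) z = (hdot (cplxmx A *m z) z)^*.
  by have := congr1 (@complex.Im R) E; rewrite Im_conjc; lra.
rewrite -hdotC /hdot; under eq_bigr do rewrite big_ord1.
under [RHS]eq_bigr do rewrite big_ord1.
transitivity (\sum_i \sum_j (A i j)%:C * z j 0 * (z i 0)^*).
  by apply: eq_bigr => i _; rewrite mxE mulr_suml; apply: eq_bigr => j _; rewrite cplxmxE.
rewrite exchange_big /=; apply: eq_bigr => j _; rewrite mxE rmorph_sum mulr_sumr.
apply: eq_bigr => i _; rewrite cplxmxE -[in LHS]AT mxE [(A j i)%:C * z i 0]mulrC.
by rewrite [X in _ = _ * X](conj_mulC (z i 0) (A j i)); ring.
Qed.

Lemma inner_Gamma_impedance (A : 'M[R]_d) : A^T = A ->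
  inner_Gamma (m := T) (fun i x => cplxmx A *m u i x) u = (impedance A)%:C.
Proof.
move=> AT; apply: ReIm_ext; rewrite /inner_Gamma ?Re_bsum ?Im_bsum [RHS]/= //.
rewrite /bsum big1 // => i _; rewrite big1 // => e _; rewrite Im_sinner.
by under eq_fun do rewrite Im_hdot_sym //; rewrite sint_cst mulr0 mul0r.
Qed.

Lemma inner_Omega_diag :
  inner_Omega Omega (broken_fun u) u = (normsq_Omega Omega (broken_fun u))%:C.
Proof.
apply: ReIm_ext; rewrite /inner_Omega /=.
  by apply: eq_vint => x _; rewrite -[LHS]/(rdot _ _) -sqnormE.
by rewrite -[RHS](vint0 Omega); apply: eq_vint => x _; rewrite Im_hdot_diag.
Qed.

Lemma Ah_diag lam mu rho omega (A : 'M[R]_d) gam0 gam1 : A^T = A ->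
  Ah Omega lam mu rho omega A gam0 gam1 u u =
  (semi1h_sq lam mu u - 2 * risum (flux_jump lam mu)
     - omega ^+ 2 * rho * normsq_Omega Omega (broken_fun u)) +i*
  (risum (fun i j e => gam0 e / size_facet e * jump_sq i j e) +
   risum (fun i j e => gam1 e * size_facet e * jumpflux_sq lam mu i j e) +
   omega * impedance A).
Proof.
move=> AT; rewrite /Ah /ah bh_diag J0_diag J1_diag inner_Omega_diag inner_Gamma_impedance //.
have -> : ('i * omega%:C * (impedance A)%:C = 'i * (omega * impedance A)%:C)%C.
  by rewrite -mulrA -rmorphM.
rewrite -rmorphD -rmorphM.
apply: ReIm_ext; rewrite !(ReD, ImD, ReN, ImN) ?Re_mulic ?Im_mulic /=; ring.
Qed.

End EnergyIdentities.

(** * Choice of Young weights on a single facet *)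

Section FacetArithmetic.
Context {R : realType}.

(** The weight [s * h] cancels the factor [1 / h] of the trace inequality. The jump is then
    expressed by the summand of [J0], using [sz <= h] and [gamma <= Cs * gam]. *)
Lemma flux_jump_arith (s h K Es P Q gam gamma Cs sz X : R) :
  0 < s -> 0 < h -> 0 < gamma -> 0 < Cs -> 0 < sz -> sz <= h ->
  gamma <= Cs * gam -> 0 <= Q -> P <= K / h * Es ->
  2 * X <= s * h * P + Q / (s * h) ->
  2 * X <= s * K * Es + Cs / (s * gamma) * (gam / sz * Q).
Proof.
move=> s0 h0 g0 C0 z0 zh gC Q0 PE H; apply: le_trans H _; apply: lerD.
  apply: (@le_trans _ _ (s * h * (K / h * Es))); first by rewrite ler_wpM2l // mulr_ge0 // ltW.
  by rewrite le_eqVlt; apply/orP; left; apply/eqP; field; rewrite gt_eqF.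
have -> : Cs / (s * gamma) * (gam / sz * Q) = (Cs * gam / (gamma * sz)) * (Q / s).
  by field; rewrite !gt_eqF.
have -> : Q / (s * h) = h^-1 * (Q / s) by field; rewrite !gt_eqF.
apply: ler_wpM2r; first by rewrite divr_ge0 // ltW.
rewrite ler_pdivlMr ?mulr_gt0 // mulrC ler_pdivrMr //.
by apply: ler_pM => //; exact: ltW.
Qed.

(* The weight [(s w^2 h)^-1] is the one for which the element part becomes a small
   multiple of [w^2 |uh|^2]. *)
Lemma jumpflux_avg_arith (s w h K Ns P Q gam gamma Cs sz Y : R) :
  0 < s -> 0 < w -> 0 < h -> 0 < gamma -> 0 < Cs -> 0 < K -> h <= K * sz ->
  gamma <= Cs * gam -> 0 <= P -> Q <= K / h * Ns ->
  2 * Y <= (s * w ^+ 2 * h)^-1 * P + Q / (s * w ^+ 2 * h)^-1 ->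
  2 * Y <= Cs * K / (s * w ^+ 2 * h ^+ 2 * gamma) * (gam * sz * P) + s * w ^+ 2 * K * Ns.
Proof.
move=> s0 w0 h0 g0 C0 K0 hz gC P0 QN H; apply: le_trans H _.
have w20 : 0 < w ^+ 2 by rewrite exprn_gt0.
move: (w ^+ 2) w20 => v v0; apply: lerD.
  have -> : Cs * K / (s * v * h ^+ 2 * gamma) * (gam * sz * P) =
      (Cs * gam * (K * sz) / (gamma * h)) * ((s * v * h)^-1 * P).
    by field; rewrite !gt_eqF.
  rewrite -[leLHS]mul1r; apply: ler_wpM2r.
    by rewrite mulr_ge0 ?invr_ge0 // !mulr_ge0 // ltW.
  rewrite ler_pdivlMr ?mulr_gt0 // mul1r.
  by apply: ler_pM => //; exact: ltW.
rewrite invrK; apply: (@le_trans _ _ (K / h * Ns * (s * v * h))).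
  by rewrite ler_wpM2r // !mulr_ge0 // ltW.
by rewrite le_eqVlt; apply/orP; left; apply/eqP; field; rewrite gt_eqF.
Qed.

Lemma flux_trace_arith (s h K E P q Z : R) : 0 < s -> 0 < h ->
  P <= K / h * E -> 2 * Z <= s * h * P + q / (s * h) ->
  2 * Z <= s * K * E + (s * h)^-1 * q.
Proof.
move=> s0 h0 PE H; apply: le_trans H _; rewrite [q / _]mulrC lerD2r.
apply: (@le_trans _ _ (s * h * (K / h * E))); first by rewrite ler_wpM2l // mulr_ge0 // ltW.
by rewrite le_eqVlt; apply/orP; left; apply/eqP; field; rewrite gt_eqF.
Qed.

Lemma le_of_abs (x y : R) : 2 * `|x| <= y -> 2 * x <= y /\ 2 * - x <= y.
Proof.
move=> h; split; apply: le_trans h; rewrite ler_pM2l // ?ler_norm //.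
by rewrite -normrN ler_norm.
Qed.

End FacetArithmetic.

(** * Bounds for the energy and for the consistency term *)

Section Estimates.
Context {R : realType} {n : nat}.
Local Notation d := n.+1.
Local Notation C := R[i].

Definition trace_sq (T : mesh R d) (u : broken T) : R :=
  bsum (fun i e => sint (vtx T) e (fun x => sqnorm (u i x))).

(** Valid for every piecewise affine field. In the last bound the terms to be absorbed carry [s] and
    those that the imaginary part of the scheme controls carry [1 / s]; [s] and [w] remain free so
    that [K] does not depend on their later choice. *)
Lemma dg_estimates (kappa Cstar lam mu : R) : (1 < d)%N ->
  0 < kappa -> 0 < Cstar -> 0 < lam -> 0 < mu -> exists2 K : R, 0 < K &
  forall (h gamma0 gamma1 : R), 0 < h -> 0 < gamma0 -> 0 < gamma1 ->
  forall (T : mesh R d) (Omega : set 'cV[R]_d), open Omega ->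
  triangulation T Omega -> shape_regular T kappa ->
  (forall i, size_elt T i <= h <= Cstar * size_elt T i) ->
  forall (gam0 gam1 : {set 'I_(nvert T)} -> R),
  (forall e, interior_facet T e -> gam0 e <= gamma0 <= Cstar * gam0 e) ->
  (forall e, interior_facet T e -> gam1 e <= gamma1 <= Cstar * gam1 e) ->
  forall (u : broken T) b B, (forall i x, u i x = b i + B i *m cplxmx x) ->
  let E := semi1h_sq lam mu u in
  let N := normsq_Omega Omega (broken_fun u) in
  let X := risum (flux_jump u B lam mu) in
  let j0 := risum (fun i j e => gam0 e / size_facet e * jump_sq u i j e) in
  let j1 := risum (fun i j e => gam1 e * size_facet e * jumpflux_sq B lam mu i j e) in
  [/\ 0 <= E, 0 <= j0, 0 <= j1,
      2 * `|X| <= K * (E + j0 / gamma0) &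
      forall s w, 0 < s -> 0 < w ->
        E <= K * (s * E + j0 / (s * gamma0) + j1 / (s * w ^+ 2 * h ^+ 2 * gamma1) +
                  s * w ^+ 2 * N + trace_sq u / (s * h))].
Proof.
move=> d1 k0 C0 l0 m0; have [K K0 HK] := @element_bounds R n kappa Cstar lam mu k0 C0 l0 m0.
(* [L] dominates the coefficients of all terms of the final bound; [d + 1] is the number of facets
   of an element. *)
pose L := K * d.+1%:R + Cstar + Cstar * K + 1.
have dd : 0 <= d.+1%:R :> R by [].
have p2 := mulr_gt0 C0 K0; have p3 := mulr_ge0 (ltW K0) dd.
have [lcK lcC lcCK lc1] : [/\ K * d.+1%:R <= L, Cstar <= L, Cstar * K <= L & 1 <= L].
  by rewrite /L; move: (K * d.+1%:R) (Cstar * K) p2 p3 => x y; split; lra.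
have L0 : 0 < L by apply: lt_le_trans lc1.
have LKL : L <= (K + 1) * L by rewrite ler_peMl ?(ltW L0) // lerDr ltW.
exists ((K + 1) * L); first by rewrite mulr_gt0 // addr_gt0.
move=> h gamma0 gamma1 h0 g00 g10 T Omega oO HT sr hh gam0 gam1 G0 G1 u b B uE E N X j0 j1.
have /choice[Dv HD] : forall i, exists D : R, [/\ 0 < D,
    vint (cell (m := T) i) (fun=> 1) <= K * D,
    {in elt T i, forall v, size_facet (elt T i :\ v) <= h /\
      h <= K * size_facet (elt T i :\ v)} &
    [/\ \sum_(v in elt T i) flux_trace u B lam mu i (elt T i :\ v) =
        D * energy lam mu (B i),
      {in elt T i, forall v, sint (vtx T) (elt T i :\ v) (fun x => sqnorm (u i x)) <=
        K / h * vint (cell (m := T) i) (fun x => sqnorm (u i x))} &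
      {in elt T i, forall v nu, enorm nu = 1 ->
        sint (vtx T) (elt T i :\ v) (fun=> sqnorm (sig_of lam mu (B i) *m cplxmx nu)) <=
        K / h * elt_energy B lam mu i}]].
  move=> i; have [c [g Hb]] := elt_bary HT i; have /andP[h1 h2] := hh i.
  have [D [D0 vD fD uD]] := HK _ (vtx T) (elt T i) c g h (card_elt HT i) Hb h0 h1 h2 (sr i).
  exists D; split => //; last exact: uD (uE i).
  by move=> v vi; have [? /(_ d1)] := fD v vi.
pose Ei i := elt_energy B lam mu i.
pose Ni i := vint (cell (m := T) i) (fun x => sqnorm (u i x)).
have en0 i : 0 <= energy lam mu (B i) by apply: energy_ge0; exact: ltW.
have Ei0 i : 0 <= Ei i.
  by rewrite mulr_ge0 // ?vint_ge0 // => x _; exact: ler01.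
have Ni0 i : 0 <= Ni i by apply: vint_ge0 => x _; exact: sqnorm_ge0.
have EE : E = \sum_i Ei i by exact: (semi1h_sqE uE lam mu HT).
have E0 : 0 <= E by rewrite EE; apply: sumr_ge0.
have NN : \sum_i Ni i <= N.
  by apply: (sum_cells_le HT oO) => i; exists (b i), (B i) => x; exact: uE.
have facet_i i j e : Defs.ifacet i j -> e = elt T i :&: elt T j ->
    exists2 v, v \in elt T i & e = elt T i :\ v.
  move=> /andP[_ /eqP ce] eE; apply: (facet_vertex (card_elt HT i)); rewrite eE //.
  exact: finset.subsetIl.
have facet_j i j e : Defs.ifacet i j -> e = elt T i :&: elt T j ->
    exists2 v, v \in elt T j & e = elt T j :\ v.
  by move=> ij eE; apply: (facet_i j i); [rewrite ifacet_sym|rewrite finset.setIC].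
have facet_b i e : Defs.bfacet i e -> exists2 v, v \in elt T i & e = elt T i :\ v.
  by move=> /and3P[ei /eqP ce _]; exact: (facet_vertex (card_elt HT i)).
have unit_n i v : v \in elt T i ->
    enorm (onormal (vtx T) (elt T i) (elt T i :\ v)) = 1.
  move=> vi; have [c [g Hb]] := elt_bary HT i.
  by have [] := onormalP (card_elt HT i) Hb (ltn0Sn _) vi.
have sz i j e : Defs.ifacet i j -> e = elt T i :&: elt T j ->
    [/\ 0 < size_facet e, size_facet e <= h & h <= K * size_facet e].
  move=> ij /(facet_i i j e ij)[v vi ->]; have [_ _ /(_ v vi)[s1 s2] _] := HD i.
  by split => //; rewrite -(pmulr_rgt0 _ K0); exact: lt_le_trans s2.
have infac i j e : Defs.ifacet i j -> e = elt T i :&: elt T j -> interior_facet T e.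
  by move=> ij eE; exists i, j.
have tr_i i j e : Defs.ifacet i j -> e = elt T i :&: elt T j ->
    sint (vtx T) e (fun x => sqnorm (u i x)) <= K / h * Ni i /\
    sint (vtx T) e (fun x => sqnorm (u j x)) <= K / h * Ni j.
  move=> ij eE; split.
    by have [v vi ->] := facet_i i j e ij eE; have [_ _ _ [_ t _]] := HD i; exact: t.
  by have [v vj ->] := facet_j i j e ij eE; have [_ _ _ [_ t _]] := HD j; exact: t.
have st_i i j e : Defs.ifacet i j -> e = elt T i :&: elt T j ->
    sint (vtx T) e (fun=> sqnorm (tr_vec B lam mu i i e)) <= K / h * Ei i /\
    sint (vtx T) e (fun=> sqnorm (tr_vec B lam mu i j e)) <= K / h * Ei j.
  move=> ij eE; have [v vi ei] := facet_i i j e ij eE.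
  have n1 := unit_n i v vi; rewrite -ei in n1; split.
    by have [_ _ _ [_ _ t]] := HD i; rewrite {1}ei; exact: t.
  have [v' vj ej] := facet_j i j e ij eE.
  by have [_ _ _ [_ _ t]] := HD j; rewrite {1}ej; exact: t.
have si_cst e w : sintegrable (vtx T) e (fun=> w).
  by apply: stame_sintegrable; exact: tame_cst.
have si_sq e i : sintegrable (vtx T) e (fun x => sqnorm (u i x)).
  exact: (face_si_u uE e i).2.
have X_le s : 0 < s -> forall i j e, Defs.ifacet i j -> e = elt T i :&: elt T j ->
    2 * `|flux_jump u B lam mu i j e| <=
    s * K * (Ei i + Ei j) + Cstar / (s * gamma0) * (gam0 e / size_facet e * jump_sq u i j e).
  move=> s0 i j e ij eE; have [z0 zh _] := sz i j e ij eE.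
  have /andP[_ gC] := G0 e (infac i j e ij eE).
  have [t1 t2] := st_i i j e ij eE.
  apply: (@flux_jump_arith _ s h K _
    (sint (vtx T) e (fun=> sqnorm (2^-1 *: (tr_vec B lam mu i i e + tr_vec B lam mu i j e))))
    (jump_sq u i j e)) => //.
  - by apply: sint_ge0 => x; exact: sqnorm_ge0.
  - rewrite mulrDr; apply: le_trans (lerD t1 t2).
    rewrite -sintD //; apply: sint_le => // t _; exact: sqnorm_half_le.
  - apply: sint_rdot_young; [exact: face_si_cst|exact: face_si_jump uE e i j|exact: mulr_gt0].
have Y_le s w : 0 < s -> 0 < w -> forall i j e, Defs.ifacet i j -> e = elt T i :&: elt T j ->
    2 * `|jumpflux_avg u B lam mu i j e| <=
    Cstar * K / (s * w ^+ 2 * h ^+ 2 * gamma1) *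
      (gam1 e * size_facet e * jumpflux_sq B lam mu i j e) + s * w ^+ 2 * K * (Ni i + Ni j).
  move=> s0 w0 i j e ij eE; have [z0 _ hz] := sz i j e ij eE.
  have /andP[_ gC] := G1 e (infac i j e ij eE).
  have [t1 t2] := tr_i i j e ij eE.
  apply: (@jumpflux_avg_arith _ s w h K _ _
    (sint (vtx T) e (fun x => sqnorm (2^-1 *: (u i x + u j x))))) => //.
  - by apply: sint_ge0 => x; exact: sqnorm_ge0.
  - rewrite mulrDr; apply: le_trans (lerD t1 t2).
    rewrite -sintD //; apply: sint_le => [||t _]; last exact: sqnorm_half_le.
      exact: (face_si_avg uE e i j).2.
    by apply: (integrableD _ (si_sq e i) (si_sq e j)); case: (@tame_set_ref R n).
  - apply: sint_rdot_young; [exact: face_si_cst|exact: face_si_avg uE e i j|].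
    by rewrite invr_gt0 !mulr_gt0 // exprn_gt0.
have Z_le s : 0 < s -> forall i e, Defs.bfacet i e ->
    2 * `|flux_trace u B lam mu i e| <=
    s * K * Ei i + (s * h)^-1 * sint (vtx T) e (fun x => sqnorm (u i x)).
  move=> s0 i e ie; have [v vi ei] := facet_b i e ie.
  have n1 := unit_n i v vi; rewrite -ei in n1.
  apply: (@flux_trace_arith _ s h K _ (sint (vtx T) e (fun=> sqnorm (tr_vec B lam mu i i e)))) => //.
    by have [_ _ _ [_ _ t]] := HD i; rewrite {1}ei; exact: t.
  apply: sint_rdot_young; [exact: face_si_cst|exact: face_si_u uE e i|exact: mulr_gt0].
(* Every element is counted once for each of its [d + 1] facets, be they on the boundary or
   inside. *)
have sumE : bsum (m := T) (fun i _ => Ei i) + risum (T := T) (fun i j _ => Ei i + Ei j) =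
    d.+1%:R * E.
  rewrite -(sum_facets HT d1 (fun i _ => Ei i)) EE mulr_sumr; apply: eq_bigr => i _.
  by rewrite sumr_const (card_elt HT) mulr_natl.
have sumN : risum (T := T) (fun i j _ => Ni i + Ni j) <= d.+1%:R * N.
  apply: (@le_trans _ _ (d.+1%:R * \sum_i Ni i)); last by rewrite ler_wpM2l.
  rewrite mulr_sumr; apply: (@le_trans _ _ (\sum_i \sum_(v in elt T i) Ni i)).
    by rewrite (sum_facets HT d1 (fun i _ => Ni i)) lerDr bsum_ge0.
  by apply: ler_sum => i _; rewrite sumr_const (card_elt HT) mulr_natl.
have bE0 : 0 <= bsum (m := T) (fun i _ => Ei i) by apply: bsum_ge0.
have rE0 : 0 <= risum (T := T) (fun i j _ => Ei i + Ei j).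
  by apply: risum_ge0 => i j e _ _; exact: addr_ge0.
have N0 : 0 <= N by apply: le_trans NN; apply: sumr_ge0.
have j00 : 0 <= j0.
  apply: risum_ge0 => i j e ij eE; have [z0 _ _] := sz i j e ij eE.
  have /andP[_ gC] := G0 e (infac i j e ij eE).
  have gp : 0 < gam0 e by rewrite -(pmulr_rgt0 _ C0); exact: lt_le_trans gC.
  rewrite mulr_ge0 ?divr_ge0 ?(ltW gp) ?(ltW z0) //.
  by apply: sint_ge0 => x; exact: sqnorm_ge0.
have j10 : 0 <= j1.
  apply: risum_ge0 => i j e ij eE; have [z0 _ _] := sz i j e ij eE.
  have /andP[_ gC] := G1 e (infac i j e ij eE).
  have gp : 0 < gam1 e by rewrite -(pmulr_rgt0 _ C0); exact: lt_le_trans gC.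
  apply: mulr_ge0; first by rewrite mulr_ge0 // ltW.
  by apply: sint_ge0 => x; exact: sqnorm_ge0.
have Bq0 : 0 <= trace_sq u.
  by apply: bsum_ge0 => i e _; apply: sint_ge0 => x; exact: sqnorm_ge0.
have X_sum s : 0 < s ->
    2 * X <= s * K * risum (T := T) (fun i j _ => Ei i + Ei j) + Cstar / (s * gamma0) * j0 /\
    2 * - X <= s * K * risum (T := T) (fun i j _ => Ei i + Ei j) + Cstar / (s * gamma0) * j0.
  move=> s0; split.
    rewrite -!risumZ -risumD; apply: risum_le => i j e ij eE.
    by have [] := le_of_abs (X_le s s0 i j e ij eE).
  rewrite -mulN1r -!risumZ -risumD; apply: risum_le => i j e ij eE.
  by rewrite mulN1r; have [] := le_of_abs (X_le s s0 i j e ij eE).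
have Y_sum s w : 0 < s -> 0 < w -> 2 * risum (jumpflux_avg u B lam mu) <=
    Cstar * K / (s * w ^+ 2 * h ^+ 2 * gamma1) * j1 +
    s * w ^+ 2 * K * risum (T := T) (fun i j _ => Ni i + Ni j).
  move=> s0 w0; rewrite -!risumZ -risumD; apply: risum_le => i j e ij eE.
  by have [] := le_of_abs (Y_le s w s0 w0 i j e ij eE).
have Z_sum s : 0 < s -> 2 * bsum (flux_trace u B lam mu) <=
    s * K * bsum (m := T) (fun i _ => Ei i) + (s * h)^-1 * trace_sq u.
  move=> s0; rewrite /trace_sq -!bsumZ -bsumD; apply: bsum_le => i e ie.
  by have [] := le_of_abs (Z_le s s0 i e ie).
(* Each element contributes its own traction against its own trace, and the normals on a common
   facet are opposite. With [a], [a'] the tractions along the normal of [i], the two contributions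
   combine by [a . u - a' . u' = {a} . [u] + [a] . {u}]. The factor [K] compares [Dv i] with the
   volume of the cell. *)
have green_sum : E <= K * (bsum (flux_trace u B lam mu) + (X + risum (jumpflux_avg u B lam mu))).
  have -> : bsum (flux_trace u B lam mu) + (X + risum (jumpflux_avg u B lam mu)) =
      \sum_i Dv i * energy lam mu (B i).
    rewrite /X -risumD.
    transitivity (\sum_i \sum_(v in elt T i) flux_trace u B lam mu i (elt T i :\ v)).
      rewrite (sum_facets HT d1 (flux_trace u B lam mu)); congr (_ + _).
      apply: eq_risum => i j e ij eE.
      have half : (2^-1 : C) = (2^-1 : R)%:C by rewrite fmorphV rmorph_nat.
      have tj : tr_vec B lam mu j j e = - tr_vec B lam mu i j e.
        rewrite /tr_vec (onormal_neighbour HT d1 ij eE).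
        by rewrite /cplxmx map_mxN mulmxN.
      rewrite /flux_jump /jumpflux_avg /flux_trace.
      have ir F G : face_square_integrable (vtx T) e F -> face_square_integrable (vtx T) e G ->
          sintegrable (vtx T) e (fun x => rdot (F x) (G x)).
        exact: sint_rdot_integrable.
      rewrite -!sintD; last 4 first.
      - exact: ir (face_si_cst _ _) (face_si_u uE e i).
      - exact: ir (face_si_cst _ _) (face_si_u uE e j).
      - exact: ir (face_si_cst _ _) (face_si_jump uE e i j).
      - exact: ir (face_si_cst _ _) (face_si_avg uE e i j).
      congr (sint _ _ _); apply/funext => x; rewrite tj half rdotNl !rdotZl rdotZr.
      rewrite !rdotDl !rdotDr !rdotNl !rdotNr.
      move: (rdot _ _) (rdot _ _) (rdot _ _) (rdot _ _) => y1 y2 y3 y4; lra.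
    by apply: eq_bigr => i _; have [_ _ _ [t _ _]] := HD i.
  rewrite EE mulr_sumr; apply: ler_sum => i _; have [_ vD _ _] := HD i.
  by rewrite mulrA ler_wpM2r.
split => //.
  (* No small factor is sought here: this bound enters the real part with the full energy, and the
     resulting factor [2 + K] is compensated by the later choice of [s]. *)
  have [x1 x2] := X_sum 1 ltr01.
  rewrite !mul1r in x1 x2.
  have aux : K * risum (T := T) (fun i j _ => Ei i + Ei j) + Cstar / gamma0 * j0 <=
      (K + 1) * L * (E + j0 / gamma0).
    have r1 : risum (T := T) (fun i j _ => Ei i + Ei j) <= d.+1%:R * E by rewrite -sumE lerDr.
    have q0 : 0 <= j0 / gamma0 by rewrite divr_ge0 // ltW.
    have -> : Cstar / gamma0 * j0 = Cstar * (j0 / gamma0) by rewrite mulrAC mulrA.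
    rewrite mulrDr; apply: lerD.
      apply: (@le_trans _ _ (K * (d.+1%:R * E))); first by rewrite ler_wpM2l // ltW.
      by rewrite mulrA; apply: ler_wpM2r => //; exact: le_trans lcK LKL.
    by apply: ler_wpM2r => //; exact: le_trans lcC LKL.
  by case: (ger0P X) => _; apply: le_trans aux.
move=> s w s0 w0.
have [x1 _] := X_sum s s0; have y1 := Y_sum s w s0 w0; have z1 := Z_sum s s0.
pose S5 := s * E + j0 / (s * gamma0) + j1 / (s * w ^+ 2 * h ^+ 2 * gamma1) +
  s * w ^+ 2 * N + trace_sq u / (s * h).
have w20 : 0 < w ^+ 2 by rewrite exprn_gt0.
have h20 : 0 < h ^+ 2 by rewrite exprn_gt0.
have a1 : 0 <= s * E by rewrite mulr_ge0 // ltW.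
have a2 : 0 <= j0 / (s * gamma0) by rewrite divr_ge0 // mulr_ge0 // ltW.
have a3 : 0 <= j1 / (s * w ^+ 2 * h ^+ 2 * gamma1).
  by rewrite divr_ge0 // !mulr_ge0 // ltW.
have a4 : 0 <= s * w ^+ 2 * N by rewrite !mulr_ge0 // ltW.
have a5 : 0 <= trace_sq u / (s * h) by rewrite divr_ge0 // mulr_ge0 // ltW.
have key : 2 * (bsum (flux_trace u B lam mu) + (X + risum (jumpflux_avg u B lam mu))) <=
    L * S5.
  apply: (@le_trans _ _ (K * d.+1%:R * (s * E) + Cstar * (j0 / (s * gamma0)) +
     Cstar * K * (j1 / (s * w ^+ 2 * h ^+ 2 * gamma1)) + K * d.+1%:R * (s * w ^+ 2 * N) +
     trace_sq u / (s * h))).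
    have n1 : s * w ^+ 2 * K * risum (T := T) (fun i j _ => Ni i + Ni j) <=
        s * w ^+ 2 * K * (d.+1%:R * N) by rewrite ler_wpM2l // !mulr_ge0 // ltW.
    have e1 : s * K * bsum (m := T) (fun i _ => Ei i) +
        s * K * risum (T := T) (fun i j _ => Ei i + Ei j) = s * K * (d.+1%:R * E).
      by rewrite -mulrDr sumE.
    have -> : K * d.+1%:R * (s * E) = s * K * (d.+1%:R * E) by ring.
    have -> : K * d.+1%:R * (s * w ^+ 2 * N) = s * w ^+ 2 * K * (d.+1%:R * N) by ring.
    have -> : Cstar * (j0 / (s * gamma0)) = Cstar / (s * gamma0) * j0 by ring.
    have -> : Cstar * K * (j1 / (s * w ^+ 2 * h ^+ 2 * gamma1)) =
      Cstar * K / (s * w ^+ 2 * h ^+ 2 * gamma1) * j1 by ring.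
    rewrite -e1 [trace_sq u / _]mulrC !mulrDr.
    move: x1 y1 z1 n1; move: (_ * bsum _) (_ * j0) (_ * j1) (_ * risum _) => *; lra.
  rewrite /S5 [leRHS]mulrDr [L * (s * E + _ + _ + _)]mulrDr.
  rewrite [L * (s * E + _ + _)]mulrDr [L * (s * E + _)]mulrDr; apply: lerD; last by rewrite ler_peMl.
  apply: lerD; last exact: (ler_wpM2r a4 lcK).
  apply: lerD; last exact: (ler_wpM2r a3 lcCK).
  by apply: lerD; [exact: (ler_wpM2r a1 lcK)|exact: (ler_wpM2r a2 lcC)].
have S50 : 0 <= S5.
  by apply: addr_ge0 a5; apply: addr_ge0 a4; apply: addr_ge0 a3; exact: addr_ge0.
rewrite -/S5; apply: le_trans green_sum _.
apply: (@le_trans _ _ (K * (L * S5))).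
  rewrite ler_pM2l //; have := mulr_ge0 (ltW L0) S50; move: key.
  by move: (L * S5) (bsum _ + _) => y x; lra.
by rewrite -mulrA; apply: ler_wpM2r; [exact: mulr_ge0 (ltW L0) S50|rewrite lerDl].
Qed.

End Estimates.

(** * Absorption of the small terms *)

Section Absorption.
Context {R : realType}.

(* [kp] stands for [om * Csta]; [ig0], [q1] and [ih] for the weights [1 / gamma0],
   [1 / (om^2 h^2 gamma1)] and [1 / h], all of which it dominates. *)
Lemma absorb_energy (K c rho om kp ih ig0 q1 s E N j0 j1 B BA W X r1 r2 T G : R) :
  0 < K -> 0 < c -> 0 < rho -> 0 < om -> 0 < s -> 1 <= kp ->
  0 <= ig0 -> 0 <= q1 -> 0 <= ih ->
  ig0 <= kp -> q1 <= kp -> ih <= om * kp ->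
  0 <= E -> 0 <= N -> 0 <= j0 -> 0 <= j1 -> 0 <= B -> 0 <= G -> 0 <= T ->
  c * B <= BA -> W = j0 + j1 + om * BA ->
  E - 2 * X - om ^+ 2 * rho * N = r1 + r2 ->
  2 * `|X| <= K * (E + j0 * ig0) ->
  E <= K * (s * (E + om ^+ 2 * N) + s^-1 * (j0 * ig0 + j1 * q1 + B * ih)) ->
  2 * `|r1| <= T -> 2 * `|r2| <= G / om + om * B ->
  W <= T + G / (c * om) ->
  s = (2 * K * (1 + rho^-1) * (2 + K))^-1 ->
  E + om ^+ 2 * rho * N <=
  (2 * ((2 + K) * K * (2 + c^-1) / s + K + c^-1) * (1 + c^-1) + 1) * kp * (T + G / om).
Proof.
move=> K0 c0 rho0 om0 s0 kp1 ig00 q10 ih0 igk q1k ihk E0 N0 j00 j10 B0 G0 T0 cB WE re hX hE hr1 hr2 hW sE.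
have kp0 : 0 < kp by apply: lt_le_trans kp1.
have BA0 : 0 <= BA by apply: le_trans cB; rewrite mulr_ge0 // ltW.
have oBA0 : 0 <= om * BA by rewrite mulr_ge0 // ltW.
have W0 : 0 <= W by rewrite WE !addr_ge0.
have j0W : j0 <= W by rewrite WE -addrA lerDl addr_ge0.
have j1W : j1 <= W by rewrite WE addrAC lerDr addr_ge0.
have ci0 : 0 < c^-1 by rewrite invr_gt0.
have oBW : om * B <= c^-1 * W.
  rewrite mulrC ler_pdivlMl // mulrA [c * B]mulrC mulrAC [B * om * c]mulrAC.
  apply: (@le_trans _ _ (om * BA)); last by rewrite WE lerDr addr_ge0.
  by rewrite mulrC ler_pM2l // mulrC.
have kW0 : 0 <= kp * W by rewrite mulr_ge0 // ltW.
have WkW : W <= kp * W by rewrite ler_peMl.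
have t1 : j0 * ig0 <= kp * W by rewrite mulrC ler_pM.
have t2 : j1 * q1 <= kp * W by rewrite mulrC ler_pM.
have t3 : B * ih <= c^-1 * (kp * W).
  apply: (@le_trans _ _ (B * (om * kp))); first by rewrite ler_wpM2l.
  have -> : B * (om * kp) = kp * (om * B) by ring.
  by rewrite [leRHS]mulrCA ler_pM2l.
have oBk : om * B <= c^-1 * (kp * W).
  by apply: le_trans oBW _; rewrite ler_pM2l.
set P := E + om ^+ 2 * rho * N.
have rN0 : 0 <= om ^+ 2 * rho * N by rewrite !mulr_ge0 ?sqr_ge0 // ltW.
have EP : E <= P by rewrite lerDl.
have ri0 : 0 < rho^-1 by rewrite invr_gt0.
have NP : om ^+ 2 * N <= rho^-1 * P.
  rewrite ler_pdivlMl // /P; apply: (@le_trans _ _ (om ^+ 2 * rho * N)); last by rewrite lerDr.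
  by rewrite mulrCA mulrA.
have P0 : 0 <= P by rewrite addr_ge0.
have eP : E + om ^+ 2 * N <= (1 + rho^-1) * P by rewrite mulrDl mul1r lerD.
set kW := kp * W in WkW kW0 t1 t2 t3 oBk *.
(* The real part gives [P = 2 E - 2 X - (r1 + r2)], in which [2 |X| <= K (E + kW)], hence the factor
   [2 + K]. The value of [s] is the one for which [(2 + K) * K * s * (1 + rho^-1) * P] equals
   [P / 2]. *)
have E1 : (2 + K) * E <= P / 2 + (2 + K) * K * (2 + c^-1) / s * kW.
  have h1 : s * (E + om ^+ 2 * N) <= s * ((1 + rho^-1) * P) by rewrite ler_pM2l.
  have h2 : s^-1 * (j0 * ig0 + j1 * q1 + B * ih) <= s^-1 * ((2 + c^-1) * kW).
    rewrite ler_pM2l ?invr_gt0 // mulrDl; apply: lerD t3.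
    by rewrite mulr_natl mulr2n lerD.
  have h3 : E <= K * (s * ((1 + rho^-1) * P) + s^-1 * ((2 + c^-1) * kW)).
    by apply: le_trans hE _; rewrite ler_pM2l // lerD.
  have K2 : 0 < 2 + K by rewrite addr_gt0.
  apply: (@le_trans _ _ ((2 + K) * (K * (s * ((1 + rho^-1) * P) + s^-1 * ((2 + c^-1) * kW))))).
    by rewrite ler_pM2l.
  rewrite le_eqVlt; apply/orP; left; apply/eqP.
  have -> : (2 + K) * (K * (s * ((1 + rho^-1) * P) + s^-1 * ((2 + c^-1) * kW))) =
     s * (2 * K * (1 + rho^-1) * (2 + K)) * (P / 2) + (2 + K) * K * (2 + c^-1) / s * kW.
    by field; rewrite ?gt_eqF.
  congr (_ + _); rewrite sE mulVf ?mul1r // gt_eqF // !mulr_gt0 //.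
  by rewrite addr_gt0.
have X1 : 2 * - X <= K * (E + kW).
  apply: (@le_trans _ _ (2 * `|X|)); first by rewrite ler_pM2l // -normrN ler_norm.
  by apply: le_trans hX _; rewrite ler_pM2l // lerD2l.
have r1' : 2 * - r1 <= T.
  by apply: le_trans hr1; rewrite ler_pM2l // -normrN ler_norm.
have r2' : 2 * - r2 <= G / om + c^-1 * kW.
  apply: le_trans (lerD (lexx _) oBk); apply: le_trans hr2.
  by rewrite ler_pM2l // -normrN ler_norm.
have PE : P = E + (E - 2 * X - (r1 + r2)) by rewrite /P -re; ring.
set M0 := (2 + K) * K * (2 + c^-1) / s in E1 *.
have M00 : 0 <= M0 by rewrite !mulr_ge0 ?invr_ge0 // ltW // addr_gt0.
set g := G / om in r2' *; have g0 : 0 <= g by rewrite divr_ge0 // ltW.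
have P1 : P <= 2 * (M0 + K + c^-1) * kW + T + g.
  have cw : 0 <= c^-1 * kW by rewrite mulr_ge0 // ltW.
  clearbody P kW M0 g; clear -E1 X1 PE r2' r1' cw T0 g0; lra.
have WT : kW <= kp * ((1 + c^-1) * (T + g)).
  rewrite /kW ler_pM2l //; apply: le_trans hW _.
  have -> : G / (c * om) = c^-1 * g by rewrite /g; field; rewrite !gt_eqF.
  have cT : 0 <= c^-1 * T by rewrite mulr_ge0 // ltW.
  have -> : (1 + c^-1) * (T + g) = T + c^-1 * g + (c^-1 * T + g) by ring.
  by rewrite lerDl addr_ge0.
apply: le_trans P1 _; rewrite -addrA.
have M10 : 0 <= 2 * (M0 + K + c^-1).
  by rewrite mulr_ge0 // !addr_ge0 // ltW.
apply: (@le_trans _ _ (2 * (M0 + K + c^-1) * (kp * ((1 + c^-1) * (T + g))) + kp * (T + g))).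
  apply: lerD; first by rewrite ler_wpM2l.
  by rewrite ler_peMl // addr_ge0.
by rewrite le_eqVlt; apply/orP; left; apply/eqP; ring.
Qed.

(** The Young weight [a] for the volume data is left free until the end because the two estimates
    call for different values; the weights for the boundary data are dictated by [c] and [om]. *)
Lemma stability_arith (K c rho : R) : 0 < K -> 0 < c -> 0 < rho -> exists2 C : R, 0 < C &
  forall om h g0 g1 E N j0 j1 B BA X r1 r2 i1 i2 F G : R,
  0 < om -> 0 < h -> 0 < g0 -> 0 < g1 ->
  0 <= E -> 0 <= N -> 0 <= j0 -> 0 <= j1 -> 0 <= B -> 0 <= F -> 0 <= G -> c * B <= BA ->
  E - 2 * X - om ^+ 2 * rho * N = r1 + r2 ->
  j0 + j1 + om * BA = i1 + i2 ->
  2 * `|X| <= K * (E + j0 / g0) ->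
  (forall s, 0 < s -> E <= K * (s * E + j0 / (s * g0) + j1 / (s * om ^+ 2 * h ^+ 2 * g1) +
                  s * om ^+ 2 * N + B / (s * h))) ->
  (forall a, 0 < a -> 2 * `|r1| <= a * F + N / a /\ 2 * `|i1| <= a * F + N / a) ->
  (forall a, 0 < a -> 2 * `|r2| <= a * G + B / a /\ 2 * `|i2| <= a * G + B / a) ->
  let cs := Csta om h g0 g1 in
  E + om ^+ 2 * rho * N <= C * (cs ^+ 2 * F + cs * G) /\
  j0 + j1 + om * BA <= C / om * (cs * F + G).
Proof.
move=> K0 c0 rho0.
have ci0 : 0 < c^-1 by rewrite invr_gt0.
have ri0 : 0 < rho^-1 by rewrite invr_gt0.
pose s := (2 * K * (1 + rho^-1) * (2 + K))^-1.
have s0 : 0 < s by rewrite invr_gt0 !mulr_gt0 // addr_gt0.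
pose M := 2 * ((2 + K) * K * (2 + c^-1) / s + K + c^-1) * (1 + c^-1) + 1.
have K2 : 0 < 2 + K by rewrite addr_gt0.
have c2 : 0 < 2 + c^-1 by rewrite addr_gt0.
have q0 : 0 < (2 + K) * K * (2 + c^-1) / s by rewrite divr_gt0 // !mulr_gt0.
have M0 : 0 < M.
  apply: addr_gt0 => //; apply: mulr_gt0; last by rewrite addr_gt0.
  by apply: mulr_gt0 => //; rewrite !addr_gt0.
pose C1 := 4 * M ^+ 2 / rho + 2 * M.
have M20 : 0 < M ^+ 2 by exact: exprn_gt0.
have C10 : 0 < C1.
  by apply: addr_gt0; [apply: mulr_gt0 => //; exact: mulr_gt0|exact: mulr_gt0].
pose C2 := 1 + C1 / rho + c^-1.
have C20 : 0 < C2 by rewrite !addr_gt0 // mulr_gt0.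
exists (C1 + C2); first by rewrite addr_gt0.
move=> om h g0 g1 E N j0 j1 B BA X r1 r2 i1 i2 F G om0 h0 g00 g10 E0 N0 j00 j10 B0 F0 G0 cB.
move=> re im hX hE hf hg cs.
pose kp := om * cs.
(* Each weight of the energy bound is at most one of these summands: [1 / g0] and
   [1 / (om^2 h^2 g1)] directly, and [1 / h = om * (om h)^-1] because the boundary norm is paid for
   by [om * BA]. *)
have kpE : kp = 1 + g0^-1 + (om * h)^-1 + (om ^+ 2 * h ^+ 2 * g1)^-1.
  by rewrite /kp /cs /Csta; field; rewrite !gt_eqF.
have q00 : 0 < g0^-1 by rewrite invr_gt0.
have q20 : 0 < (om * h)^-1 by rewrite invr_gt0 mulr_gt0.
have q10 : 0 < (om ^+ 2 * h ^+ 2 * g1)^-1 by rewrite invr_gt0 !mulr_gt0 // exprn_gt0.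
have kp1 : 1 <= kp by rewrite kpE -!addrA lerDl !addr_ge0 // ltW.
have kp0 : 0 < kp by apply: lt_le_trans kp1.
have cs0 : 0 < cs by rewrite -(pmulr_rgt0 _ om0).
set W := j0 + j1 + om * BA.
have BA0 : 0 <= BA by apply: le_trans cB; rewrite mulr_ge0 // ltW.
(* The weight [(c * om)^-1] turns the boundary term of Young's inequality into
   [c * om * B <= om * BA <= W], which one of the two copies of [W] on the left absorbs. *)
have hW a : 0 < a -> W <= a * F + N / a + G / (c * om).
  move=> a0; have co0 : 0 < (c * om)^-1 by rewrite invr_gt0 mulr_gt0.
  have [_ f1] := hf a a0; have [_ f2] := hg _ co0.
  have oB : B / (c * om)^-1 <= W.
    rewrite invrK (_ : B * (c * om) = om * (c * B)); last by ring.
    apply: (@le_trans _ _ (om * BA)); first by rewrite ler_pM2l.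
    by rewrite lerDr addr_ge0.
  have w1 : 2 * W <= 2 * `|i1| + 2 * `|i2|.
    by rewrite /W im -mulrDr ler_pM2l //; apply: lerD; exact: ler_norm.
  move: f1 f2 oB w1; rewrite [G / _]mulrC.
  move: (B / _) (_ * G) (a * F + N / a) => x y z; move: W => w.
  clear; lra.
have main a : 0 < a -> E + om ^+ 2 * rho * N <= M * kp * (a * F + N / a + G / om).
  move=> a0; have [f1 _] := hf a a0.
  have oi0 : 0 < om^-1 by rewrite invr_gt0.
  have [f2 _] := hg _ oi0.
  apply: (@absorb_energy K c rho om kp h^-1 g0^-1 (om ^+ 2 * h ^+ 2 * g1)^-1 s E N j0 j1 B BA W X r1 r2) => //.
  - exact: ltW.
  - exact: ltW.
  - by rewrite invr_ge0 ltW.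
  - by rewrite kpE; move: q20 q10; move: (g0^-1) (_^-1) (_^-1) => x y z; clear; lra.
  - by rewrite kpE; move: q20 q00; move: (g0^-1) (_^-1) (_^-1) => x y z; clear; lra.
  - have -> : h^-1 = om * (om * h)^-1 by field; rewrite !gt_eqF.
    rewrite ler_pM2l // kpE.
    by move: q10 q00; move: (g0^-1) (_^-1) (_^-1) => x y z; clear; lra.
  - by rewrite addr_ge0 ?mulr_ge0 ?invr_ge0 // ltW.
  - apply: le_trans (hE s s0) _; rewrite ler_pM2l // le_eqVlt; apply/orP; left; apply/eqP.
    by field; rewrite !gt_eqF.
  - apply: le_trans f2 _; rewrite invrK [om^-1 * G]mulrC [B * om]mulrC //.
  - exact: hW.
have P1 : E + om ^+ 2 * rho * N <= C1 * (cs ^+ 2 * F + cs * G).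
  (* With this weight [M * kp * (N / a)] is half of [om^2 * rho * N] and goes to the left side. *)
  pose a := 2 * M * kp / (rho * om ^+ 2).
  have a0 : 0 < a by rewrite divr_gt0 ?mulr_gt0 ?exprn_gt0.
  have h1 := main a a0.
  have e1 : M * kp * (N / a) = om ^+ 2 * rho * N / 2.
    by rewrite /a; field; rewrite !gt_eqF.
  have e2 : M * kp * (a * F) = 2 * M ^+ 2 / rho * (cs ^+ 2 * F).
    by rewrite /a /kp; field; rewrite !gt_eqF.
  have e3 : M * kp * (G / om) = M * (cs * G).
    by rewrite /kp; field; rewrite gt_eqF.
  move: h1; rewrite !mulrDr e1 e2 e3 => h1.
  have p1 : 0 <= M * (cs ^+ 2 * F) by rewrite !mulr_ge0 ?sqr_ge0 // ltW.
  have p2 : 0 <= 4 * M ^+ 2 / rho * (cs * G).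
    by rewrite !mulr_ge0 ?sqr_ge0 // ltW.
  have -> : C1 * (cs ^+ 2 * F) + C1 * (cs * G) =
     2 * (2 * M ^+ 2 / rho * (cs ^+ 2 * F)) + 2 * (M * (cs ^+ 2 * F)) +
     4 * M ^+ 2 / rho * (cs * G) + 2 * (M * (cs * G)).
    by rewrite /C1; field; rewrite gt_eqF.
  move: h1 p1 p2 E0; move: (om ^+ 2 * rho * N) (2 * M ^+ 2 / rho * _) (M * (_ * F)) (_ * (cs * G)) (M * (cs * G)).
  by clear => x1 x2 x3 x4 x5; lra.
have S0 : 0 <= cs ^+ 2 * F + cs * G by rewrite addr_ge0 // mulr_ge0 ?sqr_ge0 // ltW.
have S1 : 0 <= cs * F + G by rewrite addr_ge0 // mulr_ge0 // ltW.
split.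
  by apply: le_trans P1 _; apply: ler_wpM2r => //; rewrite lerDl ltW.
apply: (@le_trans _ _ (C2 / om * (cs * F + G))); last first.
  by apply: ler_wpM2r => //; apply: ler_wpM2r; [rewrite invr_ge0 ltW|rewrite lerDr ltW].
(* The weight [cs / om] makes [a * F] a term of the claim. [N] is now bounded by the first estimate,
   one factor [cs] of which cancels against [1 / a]. *)
have co0 : 0 < cs / om by rewrite divr_gt0.
apply: le_trans (hW _ co0) _.
have nb : N / (cs / om) <= C1 / rho / om * (cs * F + G).
  have -> : N / (cs / om) = (om ^+ 2 * rho * N) * (rho * om * cs)^-1 by field; rewrite !gt_eqF.
  apply: (@le_trans _ _ (C1 * (cs ^+ 2 * F + cs * G) * (rho * om * cs)^-1)).
    apply: ler_wpM2r; first by rewrite invr_ge0 !mulr_ge0 // ltW.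
    by apply: le_trans P1; rewrite lerDr.
  by rewrite le_eqVlt; apply/orP; left; apply/eqP; field; rewrite !gt_eqF.
have fb : cs / om * F <= om^-1 * (cs * F + G).
  rewrite mulrDr -[leLHS]addr0; apply: lerD; last by rewrite mulr_ge0 ?invr_ge0 // ltW.
  by rewrite le_eqVlt; apply/orP; left; apply/eqP; field; rewrite gt_eqF.
have gb : G / (c * om) <= c^-1 / om * (cs * F + G).
  rewrite mulrDr -[leLHS]add0r; apply: lerD.
    by rewrite !mulr_ge0 ?invr_ge0 // ltW.
  by rewrite le_eqVlt; apply/orP; left; apply/eqP; field; rewrite !gt_eqF.
have -> : C2 / om * (cs * F + G) = om^-1 * (cs * F + G) + C1 / rho / om * (cs * F + G) +
    c^-1 / om * (cs * F + G) by rewrite /C2; ring.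
by apply: lerD gb; exact: lerD.
Qed.

End Absorption.

(** * Coercivity of the boundary matrix *)

Section Coercivity.
Context {R : realType} {d : nat}.
Local Notation C := R[i].

Lemma edot_mulmx_le (G : 'M[R]_d) : exists2 M : R, 0 < M &
  forall x, edot x (G *m x) <= M * edot x x.
Proof.
exists (1 + \sum_i \sum_j `|G i j|).
  by rewrite ltr_pwDl // sumr_ge0 // => i _; rewrite sumr_ge0.
move=> x; rewrite mulrDl mul1r ler_wpDl ?edot_ge0 //.
rewrite edotE mulr_suml; apply: ler_sum => i _.
rewrite mxE mulr_sumr mulr_suml; apply: ler_sum => j _.
apply: le_trans (ler_norm _) _; rewrite mulrCA !normrM ler_wpM2l //.
by rewrite -enorm_sqr expr2 ler_pM // coord_le_enorm.
Qed.

(* With y = A^-1 x, expand 0 <= (x - t y)^T A (x - t y) = x^T A x - 2 t |x|^2 + t^2 x^T y. *)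
Lemma posdef_coercive (A : 'M[R]_d) : A^T = A ->
  (forall x : 'cV[R]_d, x != 0 -> 0 < edot x (A *m x)) ->
  exists2 c : R, 0 < c & forall x, c * edot x x <= edot x (A *m x).
Proof.
move=> AT Apos.
have A0 x : 0 <= edot x (A *m x).
  have [->|x0] := eqVneq x 0; last exact/ltW/Apos.
  by rewrite mulmx0 edotE big1 // => k _; rewrite mxE mul0r.
have Au : A \in unitmx.
  apply: unitmx_inj => v vA; apply: trmx_inj; rewrite trmx0.
  apply/eqP; apply: contraT => /Apos.
  have -> : A *m v^T = 0 by rewrite -[A]AT -trmx_mul vA trmx0.
  by rewrite edotE big1 ?ltxx // => k _; rewrite [X in _ * X]mxE mulr0.
have [M M0 HM] := edot_mulmx_le (invmx A).
exists M^-1 => [|x]; first by rewrite invr_gt0.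
pose y := invmx A *m x; have Ay : A *m y = x by rewrite mulmxA mulmxV // mul1mx.
have sym u v : edot u (A *m v) = edot v (A *m u).
  by rewrite edotC /edot trmx_mul AT mulmxA.
have := A0 (x - M^-1 *: y).
have -> : edot (x - M^-1 *: y) (A *m (x - M^-1 *: y)) =
    edot x (A *m x) - 2 * (M^-1 * edot x x) + M^-1 * (M^-1 * edot x y).
  rewrite mulmxBr -scalemxAr Ay edotBr ![edot (x - _) _]edotC !edotBr !edotZr !edotZl.
  by rewrite (edotC (A *m x) x) (edotC (A *m x) y) (sym y x) Ay; ring.
have h2 : M^-1 * (M^-1 * edot x y) <= M^-1 * edot x x.
  by rewrite ler_pM2l ?invr_gt0 // ler_pdivrMl.
by move: h2; move: (M^-1 * edot x x) (M^-1 * (M^-1 * edot x y)) => q p h2 h; lra.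
Qed.

Lemma rdot_real_mx (A : 'M[R]_d) (z : 'cV[C]_d) :
  rdot (cplxmx A *m z) z =
  edot (\col_k complex.Re (z k 0)) (A *m \col_k complex.Re (z k 0)) +
  edot (\col_k complex.Im (z k 0)) (A *m \col_k complex.Im (z k 0)).
Proof.
rewrite rdotE !edotE -big_split; apply: eq_bigr => i _; rewrite big_ord1 !mxE Re_sum Im_sum.
congr (_ + _); rewrite mulrC; congr (_ * _); apply: eq_bigr => j _; rewrite cplxmxE !mxE.
  by rewrite ReC.
by rewrite ImC.
Qed.

Lemma rdot_coercive (A : 'M[R]_d) (c : R) (z : 'cV[C]_d) :
  (forall x, c * edot x x <= edot x (A *m x)) ->
  c * sqnorm z <= rdot (cplxmx A *m z) z.
Proof.
move=> Ac; rewrite rdot_real_mx.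
have -> : sqnorm z = edot (\col_k complex.Re (z k 0)) (\col_k complex.Re (z k 0)) +
    edot (\col_k complex.Im (z k 0)) (\col_k complex.Im (z k 0)).
  rewrite sqnormE rdotE !edotE -big_split; apply: eq_bigr => i _.
  by rewrite big_ord1 !mxE.
by rewrite mulrDr lerD.
Qed.

End Coercivity.

Theorem theorem4p6 (R : realType) (d : nat) (hd : d = 2%N \/ d = 3%N)
    (Omega : set 'cV[R]_d) (Omega_neq0 : Omega !=set0)
    (Omega_open : open Omega) (Omega_bounded : bounded_set Omega)
    (Omega_connected : connected Omega)
    (lam mu rho : R) (lam_gt0 : 0 < lam) (mu_gt0 : 0 < mu) (rho_gt0 : 0 < rho)
    (A : 'M[R]_d) (A_sym : A^T = A)
    (A_posdef : forall x : 'cV[R]_d, x != 0 -> 0 < edot x (A *m x))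
    (kappa Cstar : R) (kappa_gt0 : 0 < kappa) (Cstar_gt0 : 0 < Cstar) :
  exists2 C : R, 0 < C &
  forall (omega h gamma0 gamma1 : R),
  0 < omega -> 0 < h -> 0 < gamma0 -> 0 < gamma1 ->
  forall (T : mesh R d),
  triangulation T Omega -> shape_regular T kappa ->
  (forall i, size_elt T i <= h <= Cstar * size_elt T i) ->
  forall (gam0 gam1 : {set 'I_(nvert T)} -> R),
  (forall e, interior_facet T e -> gam0 e <= gamma0 <= Cstar * gam0 e) ->
  (forall e, interior_facet T e -> gam1 e <= gamma1 <= Cstar * gam1 e) ->
  forall (f g : 'cV[R]_d -> 'cV[R[i]]_d),
  inL2 Omega f -> inL2_Gamma T g ->
  forall (uh : broken T), inVh uh ->
  (forall vh : broken T, inVh vh ->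
     Ah Omega lam mu rho omega A gam0 gam1 uh vh =
     inner_Omega Omega f vh + inner_Gamma (fun _ => g) vh) ->
  let cs := Csta omega h gamma0 gamma1 in
  semi1h_sq lam mu uh + omega ^+ 2 * rho * normsq_Omega Omega (broken_fun uh)
    <= C * (cs ^+ 2 * normsq_Omega Omega f + cs * normsq_Gamma T g)
  /\
  J0 gam0 uh uh + J1 lam mu gam1 uh uh
    + omega%:C * inner_Gamma (fun i x => cplxmx A *m uh i x) uh
    <= (C / omega * (cs * normsq_Omega Omega f + normsq_Gamma T g))%:C.
Proof.
have {hd Omega_neq0 Omega_bounded Omega_connected} : (1 < d)%N by case: hd => ->.
case: d Omega Omega_open A A_sym A_posdef => // n Omega oO A AT Apos d1.
have [K K0 est] := @dg_estimates R n kappa Cstar lam mu d1 kappa_gt0 Cstar_gt0 lam_gt0 mu_gt0.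
have [c c0 Ac] := posdef_coercive AT Apos.
have [C C0 arith] := stability_arith K0 c0 rho_gt0.
exists C => // omega h gamma0 gamma1 om0 h0 g00 g10 T HT sr hh gam0 gam1 G0 G1 f g fL gL u uV eqn cs.
have /choice[b /choice[B uE]] : forall i, exists bi, exists Bi,
    forall x, u i x = bi + Bi *m cplxmx x by exact: uV.
have [E0 j00 j10 hX hE] := est h gamma0 gamma1 h0 g00 g10 T Omega oO HT sr hh gam0 gam1 G0 G1 u b B uE.
have tO := tame_set_Omega HT oO.
have sf : square_integrable Omega f by exact: inL2_square_integrable.
have su : square_integrable Omega (broken_fun u).
  by apply: vtame_square_integrable => //; exact: vtame_broken.
have sg i e : Defs.bfacet i e -> face_square_integrable (vtx T) e g.
  move=> /gL ge; apply: inL2_square_integrable => //; exact: tame_set_ref.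
have uniq_eqn := eqn u uV; rewrite (Ah_diag Omega uE lam mu rho omega gam0 gam1 AT) in uniq_eqn.
have /(congr1 (@complex.Re R)) := uniq_eqn; rewrite [LHS]/= ReD => re.
have /(congr1 (@complex.Im R)) := uniq_eqn; rewrite [LHS]/= ImD => im.
have sA e i : face_square_integrable (vtx T) e (fun x => cplxmx A *m u i x).
  by apply: affine_face_square_integrable; apply: affine_field_mul; exact: uV.
have cB : c * trace_sq u <= impedance u A.
  rewrite /trace_sq -bsumZ; apply: bsum_le => i e _; rewrite -sintZ.
    apply: sint_le => [||t _]; last exact: rdot_coercive.
      by apply: (integrableZl _ c (face_si_u uE e i).2); case: (@tame_set_ref R n).
    exact: sint_rdot_integrable (sA e i) (face_si_u uE e i).
  exact: (face_si_u uE e i).2.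
have hf a : 0 < a ->
    2 * `|complex.Re (inner_Omega Omega f u)| <=
      a * normsq_Omega Omega f + normsq_Omega Omega (broken_fun u) / a /\
    2 * `|complex.Im (inner_Omega Omega f u)| <=
      a * normsq_Omega Omega f + normsq_Omega Omega (broken_fun u) / a.
  by move=> a0; split; [exact: vint_rdot_young|exact: vint_Imhdot_young].
have bsum_abs (F1 F2 : 'I_(nelem T) -> {set 'I_(nvert T)} -> R) :
    (forall i e, Defs.bfacet i e -> 2 * `|F1 i e| <= F2 i e) ->
    2 * `|bsum (m := T) F1| <= bsum (m := T) F2.
  move=> hF; apply: (@le_trans _ _ (2 * bsum (m := T) (fun i e => `|F1 i e|))).
    rewrite ler_pM2l // (le_trans (ler_norm_sum _ _ _)) //; apply: ler_sum => i _.
    exact: ler_norm_sum.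
  by rewrite -bsumZ; apply: bsum_le.
have hg a : 0 < a ->
    2 * `|complex.Re (inner_Gamma (m := T) (fun=> g) u)| <=
      a * normsq_Gamma T g + trace_sq u / a /\
    2 * `|complex.Im (inner_Gamma (m := T) (fun=> g) u)| <=
      a * normsq_Gamma T g + trace_sq u / a.
  move=> a0; rewrite /inner_Gamma Re_bsum Im_bsum [trace_sq u / a]mulrC.
  rewrite /normsq_Gamma /trace_sq -!bsumZ -bsumD.
  split; apply: bsum_abs => i e ie; rewrite [_^-1 * _]mulrC.
    exact: sint_rdot_young (sg i e ie) (face_si_u uE e i) a0.
  exact: sint_Imhdot_young (sg i e ie) (face_si_u uE e i) a0.
have N0 : 0 <= normsq_Omega Omega (broken_fun u) by apply: vint_ge0 => x _; exact: sqnorm_ge0.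
have F0 : 0 <= normsq_Omega Omega f by apply: vint_ge0 => x _; exact: sqnorm_ge0.
have GG0 : 0 <= normsq_Gamma T g.
  by apply: bsum_ge0 => i e _; apply: sint_ge0 => x; exact: sqnorm_ge0.
have B0 : 0 <= trace_sq u.
  by apply: bsum_ge0 => i e _; apply: sint_ge0 => x; exact: sqnorm_ge0.
(* The free weight [w] is taken to be the frequency, so that the element terms match
   [omega^2 |uh|^2]. *)
have hE' s : 0 < s -> _ := fun s0 => hE s omega s0 om0.
have [r1 r2] := arith omega h gamma0 gamma1 _ _ _ _ _ _ _ _ _ _ _ _ _ om0 h0 g00 g10
  E0 N0 j00 j10 B0 F0 GG0 cB re im hX hE' hf hg.
split; first exact: r1.
(* The order on complex numbers also asks for equal imaginary parts; the diagonal identities show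
   that the left side is real. *)
rewrite J0_diag (J1_diag uE) (inner_Gamma_impedance u AT) -rmorphM -!rmorphD.
by rewrite lecE /= eqxx.
Qed.
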